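(* Let $f$ be a smooth real-valued function on a neighbourhood of the origin in $\mathbb{R}^n$ with $f(0)=0$ and $\nabla f(0)=0$. Assume that $f$ is non-negative, non-degenerate, partially convenient and satisfies the KN-condition. Then: (i) $\theta(f)=1-\dfrac{1}{\nu(f)}$; (ii) $\alpha(f)=\nu(f)$; (iii) $\mathcal{L}(f)=\nu(f)$.
   Context: Smooth means $C^\infty$; $\|\cdot\|$ is the Euclidean norm and $\operatorname{dist}(\mathbf{x},f^{-1}(0))$ the distance from $\mathbf{x}$ to $f^{-1}(0)$; $\mathbb{Z}_+$, $\mathbb{R}_+$ denote the nonnegative integers and reals. Newton polyhedron: if $\sum_\alpha c_\alpha \mathbf{x}^\alpha$ is the Taylor series of $f$ at $0$, then $\Gamma_+(f)$ is the convex hull of $\bigcup\{\alpha+\mathbb{R}^n_+ : c_\alpha\neq 0\}$; it is assumed non-empty. $V_{\Gamma_+(f)}$ is the set of its vertices. A pair $(\mathbf{a},l)\in\mathbb{R}^n\times\mathbb{R}$ is valid if $\langle\mathbf{a},\mathbf{x}\rangle\ge l$ for all $\mathbf{x}\in\Gamma_+(f)$; then $\gamma=\{\mathbf{x}\in\Gamma_+(f):\langle\mathbf{a},\mathbf{x}\rangle=l\}$ is the face of $\Gamma_+(f)$ defined by $(\mathbf{a},l)$. KN-condition: for every face $\gamma$ of $\Gamma_+(f)$ and every valid pair $(\mathbf{a},l)$ defining $\gamma$, with $\mathbf{a}=(a_1,\dots,a_n)$, the limit $\lim_{t\to 0^+} f(t^{a_1}x_1,\dots,t^{a_n}x_n)/t^l$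 exists for all $\mathbf{x}$ in a neighbourhood of the origin. Non-degeneracy: for a compact face $\gamma$ put $f_\gamma(\mathbf{x})=\sum_{\alpha\in\gamma\cap\mathbb{Z}^n_+}c_\alpha\mathbf{x}^\alpha$. $f$ is non-degenerate if for every compact face $\gamma$ of $\Gamma_+(f)$ the system $\partial f_\gamma/\partial x_j(\mathbf{x})=0$, $j=1,\dots,n$, has no solutions in $(\mathbb{R}\setminus\{0\})^n$. Partially convenient: there exist $I\subset\{1,\dots,n\}$ and positive integers $\nu_i$, $i\in I$, such that $\{\nu_i\mathbf{e}_i: i\in I\}\subset V_{\Gamma_+(f)}$ ($\mathbf{e}_i$ the $i$-th unit vector of $\mathbb{R}^n$), and every $\alpha=(\alpha_1,\dots,\alpha_n)\in V_{\Gamma_+(f)}$ satisfies $\alpha_j=0$ for all $j\notin I$. For such $f$, $\nu(f)=\max\{\nu_i:i\in I\}$. Łojasiewicz exponents: $\theta(f)$ is the infimum of all $\theta\in(0,1)$ for which there exist $c,\varepsilon>0$ such that $\|\nabla f(\mathbf{x})\|\ge c|f(\mathbf{x})|^{\theta}$ for all $\|\mathbf{x}\|<\varepsilon$. $\alpha(f)$ is the infimum of all $\alpha>0$ such that for every smooth $g$ near the origin with $f^{-1}(0)\subset g^{-1}(0)$ in a neighbourhood of the origin there exist $c,\varepsilon>0$ with $|f(\mathbf{x})|\ge c|g(\mathbf{x})|^{\alpha}$ for all $\|\mathbf{x}\|<\varepsilon$. $\mathcal{L}(f)$ is the infimum of all $\mathcal{L}>0$ for which there exist $c,\varepsilon>0$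 with $|f(\mathbf{x})|\ge c\operatorname{dist}(\mathbf{x},f^{-1}(0))^{\mathcal{L}}$ for all $\|\mathbf{x}\|<\varepsilon$. *)

(* Defs.v *)
From HB Require Import structures.
From mathcomp Require Import all_boot all_order all_algebra.
From mathcomp Require Import all_classical all_reals all_analysis.
Set Implicit Arguments.
Unset Strict Implicit.
Unset Printing Implicit Defensive.
Import Order.TTheory GRing.Theory Num.Theory.
Import numFieldNormedType.Exports.
Local Open Scope classical_set_scope.
Local Open Scope ring_scope.

(* Functions "on a neighbourhood of the origin" are total functions
   'rV[R]_n -> R about which something is assumed near 0 only. *)

Section Defs.
Context {R : realType} {n : nat}.
Implicit Types (f g : 'rV[R]_n -> R) (x a : 'rV[R]_n) (l : R).

(* The library norm on 'rV[R]_n is the sup norm, which induces the same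
   topology. *)
Definition l2norm x : R := Num.sqrt (\sum_i x 0 i ^+ 2).

Definition dotv a x : R := \sum_i a 0 i * x 0 i.

Definition l2dist x (A : set 'rV[R]_n) : R := inf [set l2norm (x - y) | y in A].

Definition partial (i : 'I_n) f : 'rV[R]_n -> R :=
  fun x => 'D_(delta_mx 0 i) f x.

Definition grad f x : 'rV[R]_n := \row_i partial i f x.

Definition iter_partial (s : seq 'I_n) f : 'rV[R]_n -> R := foldr partial f s.

Definition smooth_on (U : set 'rV[R]_n) f : Prop :=
  forall (s : seq 'I_n) x, U x ->
    {for x, continuous (iter_partial s f)} /\
    forall i, derivable (iter_partial s f) x (delta_mx 0 i).

Definition smooth_near0 f : Prop :=
  exists U : set 'rV[R]_n, [/\ open U, U 0 & smooth_on U f].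

Local Notation multi_index := {ffun 'I_n -> nat}.

Definition taylor_coef f (al : multi_index) : R :=
  iter_partial (flatten [seq nseq (al i) i | i <- enum 'I_n]) f 0
  / (\prod_i (al i)`!)%N%:R.

Definition mi_vec (al : multi_index) : 'rV[R]_n := \row_i (al i)%:R.

Definition monomial (al : multi_index) x : R := \prod_i x 0 i ^+ al i.

Definition orthant : set 'rV[R]_n := [set y | forall i, 0 <= y 0 i].

Definition convex_hull (A : set 'rV[R]_n) : set 'rV[R]_n :=
  smallest (@convex_set R 'rV[R]_n) A.

Definition newton_polyhedron f : set 'rV[R]_n :=
  convex_hull (\bigcup_(al in [set al | taylor_coef f al != 0])
                 [set mi_vec al + y | y in orthant]).

Definition valid_pair f a l : Prop :=
  forall x, newton_polyhedron f x -> l <= dotv a x.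

Definition dilation a (t : R) x : 'rV[R]_n := \row_i (t `^ a 0 i * x 0 i).

(* Faces are non-empty by convention. *)
Definition defines_face f a l (gam : set 'rV[R]_n) : Prop :=
  [/\ valid_pair f a l,
      gam = [set x | newton_polyhedron f x /\ dotv a x = l] & gam !=set0].

Definition is_face f (gam : set 'rV[R]_n) : Prop :=
  exists a l, defines_face f a l gam.

Definition vertices f : set 'rV[R]_n := [set v | is_face f [set v]].

Definition KN_condition f : Prop :=
  forall gam a l, defines_face f a l gam ->
    \forall x \near (0 : 'rV[R]_n),
      cvg ((fun t : R => f (dilation a t x) / t `^ l) @ 0^'+).

(* The index set is finite when gam is bounded; the finitely supported sum is
   only meant for that case. *)
Definition face_part f (gam : set 'rV[R]_n) : 'rV[R]_n -> R :=
  fun x => \sum_(al \in [set al | gam (mi_vec al)])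
             (taylor_coef f al * monomial al x).

Definition newton_nondegenerate f : Prop :=
  forall gam, is_face f gam -> compact gam ->
    ~ exists x, (forall i, x 0 i != 0) /\
                (forall j, partial j (face_part f gam) x = 0).

Definition partially_convenient_with f (I : {set 'I_n}) (nu : 'I_n -> nat) :
    Prop :=
  (forall i, i \in I ->
     (0 < nu i)%N /\ vertices f ((nu i)%:R *: delta_mx 0 i)) /\
  (forall v, vertices f v -> forall j, j \notin I -> v 0 j = 0).

Definition partially_convenient f : Prop :=
  exists I nu, partially_convenient_with f I nu.

(* Independent of the choice of (I, nu): see nuNE below. *)
Definition nuN f : nat :=
  xget 0%N [set m | exists I nu, partially_convenient_with f I nu /\
                                 m = (\max_(i in I) nu i)%N].

Lemma newton_polyhedronD f x y :
  newton_polyhedron f x -> orthant y -> newton_polyhedron f (x + y).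
Proof.
move=> fx y0 A [cA sA].
suff : [set z | A (z + y)] x by [].
apply: fx; split.
  move=> u v t; rewrite !inE /= => Au Av.
  have := cA _ _ t (mem_set Au) (mem_set Av); rewrite inE.
  congr A; rewrite /conv /=; rewrite /conv /=.
  rewrite !scalerDr addrACA -scalerDl.
  by rewrite [X in _ + X *: y](_ : _ = 1) ?scale1r// addrC subrK.
move=> _ [al al0 [w w0 <-]] /=; apply: sA; exists al => //.
exists (w + y); last by rewrite addrA.
by move=> i; rewrite mxE addr_ge0.
Qed.

Lemma vertices_sub f v : vertices f v -> newton_polyhedron f v.
Proof.
move=> [a [l [_ e _]]].
have : [set v] v by [].
by rewrite e => -[].
Qed.

Lemma dotv_axis a (c : R) i : dotv a (c *: delta_mx 0 i) = a 0 i * c.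
Proof.
rewrite /dotv (bigD1 i)//= big1 ?addr0 => [|j ji].
  by rewrite !mxE !eqxx mulr1.
by rewrite !mxE (negbTE ji) andbF !mulr0.
Qed.

Lemma vertices_axis_le f i (p q : nat) :
  vertices f (p%:R *: delta_mx 0 i) -> vertices f (q%:R *: delta_mx 0 i) ->
  (p <= q)%N.
Proof.
move=> vp /vertices_sub Nq; have Np := vertices_sub vp.
case: vp => [a [l [va e _]]]; rewrite leqNgt; apply/negP => qp.
have ap : a 0 i * p%:R = l.
  have : [set (p%:R *: delta_mx 0 i : 'rV[R]_n)] (p%:R *: delta_mx 0 i) by [].
  by rewrite e => -[_]; rewrite dotv_axis.
have := va _ Nq; rewrite dotv_axis -ap => aq.
have o1 : orthant (1 *: delta_mx 0 i : 'rV[R]_n).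
  by move=> j; rewrite !mxE mul1r ler0n.
have := va _ (newton_polyhedronD Np o1).
rewrite -scalerDl dotv_axis -ap mulrDr mulr1 lerDl => a0.
have qpR : (q%:R < p%:R :> R) by rewrite ltr_nat.
have ai0 : a 0 i = 0.
  apply/eqP; rewrite eq_le a0 andbT leNgt; apply/negP => a1.
  by move: aq; rewrite ler_pM2l// leNgt qpR.
have : [set (p%:R *: delta_mx 0 i : 'rV[R]_n)] (q%:R *: delta_mx 0 i).
  by rewrite e; split; rewrite // dotv_axis -ap ai0 !mul0r.
move=> /= /matrixP/(_ 0 i); rewrite !mxE !eqxx !mulr1 => /eqP.
by rewrite eqr_nat => /eqP E; move: qp; rewrite E ltnn.
Qed.

Lemma partially_convenient_with_uniq f (I J : {set 'I_n}) nu mu :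
  partially_convenient_with f I nu -> partially_convenient_with f J mu ->
  I = J /\ {in I, nu =1 mu}.
Proof.
have sub K L rho sig : partially_convenient_with f K rho ->
    partially_convenient_with f L sig -> K \subset L.
  move=> [K1 _] [_ L2]; apply/fintype.subsetP => i /K1[r0 v]; apply/negPn/negP => iL.
  have := L2 _ v _ iL; rewrite !mxE !eqxx mulr1 => /eqP.
  by rewrite pnatr_eq0 -leqn0 leqNgt r0.
move=> fI fJ; have IJ : I = J.
  by apply/eqP; rewrite finset.eqEsubset (sub _ _ _ _ fI fJ) (sub _ _ _ _ fJ fI).
split=> // i iI; have [_ v] := fI.1 i iI.
have [|_ w] := fJ.1 i; first by rewrite -IJ.
by apply/eqP; rewrite eqn_leq (vertices_axis_le v w) (vertices_axis_le w v).
Qed.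

Lemma nuNE f (I : {set 'I_n}) nu :
  partially_convenient_with f I nu -> nuN f = (\max_(i in I) nu i)%N.
Proof.
move=> fI; rewrite /nuN; case: xgetP => [m _ [J [mu [fJ ->]]]|/(_ _) h].
  have [<- e] := partially_convenient_with_uniq fI fJ.
  by apply: eq_bigr => i /e.
by case: (h (\max_(i in I) nu i)%N); exists I, nu.
Qed.

(* Infima are taken in the extended reals, where the empty set has
   infimum +oo. *)
Definition theta_exp f : \bar R :=
  ereal_inf [set th%:E | th in [set th : R | 0 < th < 1 /\
    exists c eps : R, [/\ 0 < c, 0 < eps &
      forall x, l2norm x < eps -> c * `|f x| `^ th <= l2norm (grad f x)]]].

Definition alpha_exp f : \bar R :=
  ereal_inf [set al%:E | al in [set al : R | 0 < al /\
    forall g, smooth_near0 g ->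
      (\forall x \near (0 : 'rV[R]_n), f x = 0 -> g x = 0) ->
      exists c eps : R, [/\ 0 < c, 0 < eps &
        forall x, l2norm x < eps -> c * `|g x| `^ al <= `|f x|]]].

Definition lojasiewicz_exp f : \bar R :=
  ereal_inf [set L%:E | L in [set L : R | 0 < L /\
    exists c eps : R, [/\ 0 < c, 0 < eps &
      forall x, l2norm x < eps ->
        c * l2dist x (f @^-1` [set 0]) `^ L <= `|f x|]]].

End Defs.

(* Main.v *)
Require Import Defs.
From HB Require Import structures.
From mathcomp Require Import all_boot all_order all_algebra.
From mathcomp Require Import all_classical all_reals all_analysis.
From mathcomp Require Import ring lra.
Import Order.TTheory GRing.Theory Num.Theory.
Import numFieldNormedType.Exports.
Local Open Scope classical_set_scope.
Local Open Scope ring_scope.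

Set Implicit Arguments.
Unset Strict Implicit.
Unset Printing Implicit Defensive.

(** Let S be the set of exponents of the Taylor series of f at 0, let I be the
    set of indices of the partial convenience hypothesis, and write nu for the
    largest nu_i, reached at i0.

    Which exponents count. By Dickson's lemma S has finitely many minimal
    elements, so every weight a >= 0 attains its minimum over the Newton
    polyhedron, and it does so at a vertex ([min_vertex]). Vertices are supported
    in I, so the finite set A of the exponents of S that lie in a fixed large box
    and are supported in I computes all these minima ([plane_exps_min]). Put
    m(x) = sum of |x^al| over A, the gauge. It vanishes exactly where the
    coordinates x_i, i in I, vanish, and |x_i|^nu_i <= m(x).

    Approximation. Near 0, f and x_i d_i f agree up to o(m) with the polynomial
    P = sum of c_al x^al over A and with x_i d_i P. Indeed expand f in the
    variables of I only, to a large order N: the remainder is bounded by the sum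
    of the |x_i|^N, which is o(m), and the coefficients are functions c_al(x') of
    the remaining variables. If |x^al| <= m on the unit cube off the coordinate
    hyperplanes, then replacing c_al(x') by c_al(0) costs o(m). Otherwise take a
    point where |x^al| > m: minus the logarithms of its coordinates in I form a
    weight a, zero off I, such that <a, al> is smaller than the minimum l of a over
    the polyhedron, and the existence of the limit of f(t^a x) / t^l forces
    c_al(x') to vanish for all small x' ([coef_vanishing]).

    Nondegeneracy gives m <= C sum |x_i d_i P| near 0 ([torus_gradient_bound]). If
    this failed, then along an ultrafilter converging to 0 the ratios x^al / m
    would converge; the exponents with nonzero limits would be those of a compact
    face, and the limits would give a critical point of its face polynomial off
    the coordinate hyperplanes.

    Nonnegativity then yields f >= c m: the logarithmic derivative of f is of
    size m, the second logarithmic derivatives are O(m), and a function that is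
    nonnegative cannot be much smaller than its slope ([function_lower_torus]).
    Altogether c m <= f <= C m and c m <= sum |x_i d_i f| over I
    ([local_bounds]).

    Exponents. What is used of these bounds is that f >= c |x_i|^nu for i in I,
    that f vanishes where all x_i with i in I do, that f(t e_i0) <= C t^nu, and
    that c f <= sum |x_i d_i f|. The upper bounds for the three exponents follow
    from |x_i| <= (f / c)^(1 / nu), the lower bounds from points on or near the
    axis of i0 ([theta_value], [alpha_value], [distance_value]). *)

(** * Monomials in logarithmic coordinates *)

Section Monomials.
Context {R : realType} {n : nat}.
Implicit Types (x y z a : 'rV[R]_n) (al be : {ffun 'I_n -> nat}).

Definition torus : set 'rV[R]_n := [set x | forall i, x 0 i != 0].

Definition logv x : 'rV[R]_n := \row_i - ln `|x 0 i|.

Lemma normr_monomial al x :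
  `|monomial al x| = \prod_i `|x 0 i| ^+ al i.
Proof. by rewrite /monomial normr_prod; apply: eq_bigr => i _; rewrite normrX. Qed.

Lemma norm_monomial_exp al x : torus x ->
  `|monomial al x| = expR (- dotv (logv x) (mi_vec al)).
Proof.
move=> x0; rewrite normr_monomial /dotv -sumrN.
rewrite (big_morph _ (@expRD R) (@expR0 R)); apply: eq_bigr => i _.
rewrite !mxE mulNr opprK mulr_natr -lnXn ?normr_gt0// lnK//.
by rewrite posrE exprn_gt0// normr_gt0.
Qed.

Lemma dotvBl a y x : dotv (a - y) x = dotv a x - dotv y x.
Proof. by rewrite /dotv -sumrB; apply: eq_bigr => i _; rewrite !mxE mulrBl. Qed.

Lemma dotvDl a y x : dotv (a + y) x = dotv a x + dotv y x.
Proof. by rewrite /dotv -big_split/=; apply: eq_bigr => i _; rewrite !mxE mulrDl. Qed.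

Lemma dotvZl (c : R) a x : dotv (c *: a) x = c * dotv a x.
Proof. by rewrite /dotv mulr_sumr; apply: eq_bigr => i _; rewrite !mxE mulrA. Qed.

Lemma dotvC a x : dotv a x = dotv x a.
Proof. by apply: eq_bigr => i _; rewrite mulrC. Qed.

Lemma dotvBr a y x : dotv x (a - y) = dotv x a - dotv x y.
Proof. by rewrite dotvC dotvBl !(dotvC x). Qed.

Lemma dotvDr a y x : dotv x (a + y) = dotv x a + dotv x y.
Proof. by rewrite dotvC dotvDl !(dotvC x). Qed.

Lemma dotvZr (c : R) a x : dotv x (c *: a) = c * dotv x a.
Proof. by rewrite dotvC dotvZl (dotvC x). Qed.

End Monomials.

(** * A gradient bound from the nondegeneracy of compact faces *)

Lemma ultra_bounded_cvg {R : realType} {T : Type} (F : set_system T) (u : T -> R)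
    (M : R) :
  UltraFilter F -> F [set x | `|u x| <= M] -> exists l : R, u @ F --> l.
Proof.
move=> FU uM.
have uFI : F (u @^-1` `[- M, M]%classic).
  have /= := uM; apply: (@filterS _ F) => x xM.
  by rewrite /= in_itv/= -ler_norml.
have [p [_ pc]] := @segment_compact R (- M) M (u @ F) _ uFI.
exists (p : R) => B pB; have [//|FnB] := in_ultra_setVsetC (u @^-1` B) FU.
by have [y []] := pc (~` B) B FnB pB.
Qed.

Lemma cvg_sumr {R : realType} {T I : Type} (F : set_system T) {FF : Filter F}
    (r : seq I) (P : pred I) (u : I -> T -> R) (l : I -> R) :
  (forall i, P i -> u i @ F --> l i) ->
  (fun x => \sum_(i <- r | P i) u i x) @ F --> \sum_(i <- r | P i) l i.
Proof. by move=> ul; apply: cvg_big => //; exact: add_continuous. Qed.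

Lemma cvg_near_eq {R : realType} {T : Type} (F : set_system T)
    {FF : ProperFilter F} (u v : T -> R) (k l : R) :
  F [set x | u x = v x] -> u @ F --> k -> v @ F --> l -> k = l.
Proof.
move=> uv uk vl; apply: (cvg_unique (@norm_hausdorff _ R^o) _ vl) => //.
by apply: cvg_trans uk; exact: near_eq_cvg.
Qed.

Section FaceOrBound.
Context {R : realType} {n : nat} {T : finType}.
Variables (A : {set T}) (e : T -> {ffun 'I_n -> nat}) (c : T -> R).
Implicit Types (x z a : 'rV[R]_n).

Let m x : R := \sum_(t in A) `|monomial (e t) x|.
Let th (j : 'I_n) x : R := \sum_(t in A) c t * (e t j)%:R * monomial (e t) x.
Let w t x : R := monomial (e t) x / m x.

Section Ultra.
Variable F : set_system 'rV[R]_n.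
Hypothesis FU : UltraFilter F.
(* F contains the points near 0 where the logarithmic gradient is arbitrarily
   small compared with the gauge m. *)
Hypothesis Fbad : forall k : R, 0 < k ->
  F [set x | [/\ torus x, forall i, `|x 0 i| < k &
                 \sum_j `|th j x| < k * m x]].

Let FP : ProperFilter F := @ultra_proper _ F FU.
Let FF : Filter F := @filter_filter _ F FP.

Let m_gt0 : F [set x | torus x /\ 0 < m x].
Proof.
have := Fbad ltr01; apply: (@filterS _ F FF) => x [x0 _ xm]; split=> //.
rewrite -(mul1r (m x)); apply: le_lt_trans xm.
by apply: sumr_ge0 => j _.
Qed.

Let w_le1 t : t \in A -> F [set x | `|w t x| <= 1].
Proof.
move=> tA; have := m_gt0; apply: (@filterS _ F FF) => x [x0 mx] /=.
rewrite /w normrM normfV (gtr0_norm mx) ler_pdivrMr// mul1r.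
by rewrite /m (bigD1 t)//= lerDl sumr_ge0.
Qed.

Let W t : R := lim (w t @ F).

Let w_cvg t : t \in A -> w t @ F --> W t.
Proof.
move=> tA; have [l ul] := ultra_bounded_cvg FU (w_le1 tA).
by apply/cvg_ex; exists l.
Qed.

Let A0 := [set t in A | W t != 0].

Let sumW1 : \sum_(t in A) `|W t| = 1.
Proof.
have h : (fun x => \sum_(t in A) `|w t x|) @ F --> \sum_(t in A) `|W t|.
  by apply: cvg_sumr => t tA; apply: cvg_norm; exact: w_cvg.
apply: (cvg_near_eq _ h (cvg_cst (1 : R))).
have := m_gt0; apply: (@filterS _ F FF) => x [_ mx] /=.
rewrite -(divff (lt0r_neq0 mx)) {2}/m mulr_suml; apply: eq_bigr => t tA.
by rewrite /w normrM normfV (gtr0_norm mx).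
Qed.

Let thW j : \sum_(t in A) c t * (e t j)%:R * W t = 0.
Proof.
have h : (fun x => \sum_(t in A) c t * (e t j)%:R * w t x) @ F -->
    \sum_(t in A) c t * (e t j)%:R * W t.
  apply: cvg_sumr => t tA; apply: cvgM; first exact: cvg_cst.
  exact: w_cvg.
apply: (cvg_unique (@norm_hausdorff _ R^o) h). rewrite /=; apply/cvgr0Pnorm_lt => k k0.
have H := @filterI _ F FF _ _ m_gt0 (Fbad k0). apply: (@filterS _ F FF _ _ _ H).
move=> x [[_ mx] [x0 _ xm]] /=.
rewrite (_ : \sum_(t in A) _ = th j x / m x); last first.
  by rewrite /th mulr_suml; apply: eq_bigr => t tA; rewrite /w mulrA.
rewrite normrM normfV (gtr0_norm mx) ltr_pdivrMr//.
by apply: le_lt_trans xm; rewrite (bigD1 j)//= lerDl sumr_ge0.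
Qed.

Let s i : R := if `[< F [set x | x 0 i < 0] >] then -1 else 1.

Let s_neq0 i : s i != 0.
Proof. by rewrite /s; case: ifP => _; rewrite ?oppr_eq0 oner_neq0. Qed.

Let sP : F [set x | forall i, x 0 i = s i * `|x 0 i| :> R].
Proof.
apply: filter_forall => i; rewrite /s; case: asboolP => [|nF].
  by apply: (@filterS _ F FF) => x /= xi; rewrite ltr0_norm// mulN1r opprK.
have [//|] := @in_ultra_setVsetC _ F [set x | x 0 i < 0] FU.
apply: (@filterS _ F FF) => x /= /negP; rewrite -leNgt => xi.
by rewrite ger0_norm// mul1r.
Qed.

Let sg t : R := \prod_i s i ^+ e t i.

Let W_sg t : t \in A -> W t = sg t * `|W t|.
Proof.
move=> tA; apply: (cvg_near_eq _ (w_cvg tA)); last first.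
  by apply: cvgM; [exact: cvg_cst|apply: cvg_norm; exact: w_cvg].
have := @filterI _ F FF _ _ m_gt0 sP; apply: (@filterS _ F FF) => x [[_ mx] xs] /=.
rewrite /w normrM normfV (gtr0_norm mx) mulrA; congr (_ / _).
rewrite normr_monomial /sg -big_split/=; apply: eq_bigr => i _.
by rewrite -exprMn -xs.
Qed.

Section Direction.
Variable t0 : T.
Hypothesis t0A : t0 \in A.
Hypothesis Wt0 : W t0 != 0.

Let d t : 'rV[R]_n := mi_vec (e t) - mi_vec (e t0).

Let ratioE t : F [set x | `|w t x| / `|w t0 x| = expR (- dotv (logv x) (d t))].
Proof.
have := m_gt0; apply: (@filterS _ F FF) => x [x0 mx] /=.
rewrite /w !normrM normfV -mulf_div divff ?mulr1; last first.
  by rewrite invr_eq0 normr_eq0 lt0r_neq0.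
rewrite !norm_monomial_exp// -expRN -expRD /d dotvBr; congr expR; ring.
Qed.

Let ratio_cvg t : t \in A ->
  (fun x => `|w t x| / `|w t0 x|) @ F --> `|W t| / `|W t0|.
Proof.
move=> tA; apply: cvgM; first by apply: cvg_norm; exact: w_cvg.
by apply: cvgV; [rewrite normr_eq0|apply: cvg_norm; exact: w_cvg].
Qed.

(* The exponents with nonzero limit share their value under logv x up to a
   convergent error. The correction q x is a vector, depending linearly on the
   products of logv x with the differences d t, that has the same products: so
   logv x - q x is exactly constant on these exponents, and q x converges because
   the products do. *)
Let D : 'M[R]_(#|T|, n) :=
  \matrix_k (if enum_val k \in A0 then d (enum_val k) else 0).

Let q x : 'rV[R]_n := logv x *m D^T *m pinvmx D^T.

Let Q : 'rV[R]_n :=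
  (\row_k (if enum_val k \in A0 then - ln (`|W (enum_val k)| / `|W t0|) else 0))
    *m pinvmx D^T.

Let logvD x k : (logv x *m D^T) 0 k =
  if enum_val k \in A0 then dotv (logv x) (d (enum_val k)) else 0.
Proof.
rewrite mxE; case: ifPn => kA0; last first.
  by apply: big1 => i _; rewrite !mxE (negbTE kA0) !mxE mulr0.
by apply: eq_bigr => i _; rewrite !mxE kA0 !mxE.
Qed.

Let q_cvg i : (fun x => q x 0 i) @ F --> Q 0 i.
Proof.
rewrite mxE; under eq_fun do rewrite mxE.
apply: cvg_sumr => k _; apply: cvgM; last exact: cvg_cst.
rewrite mxE; under eq_fun do rewrite logvD.
case: ifPn => [|_]; last exact: cvg_cst.
rewrite inE => /andP[kA Wk].
have h := ratio_cvg kA.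
have hl : (fun x => - ln (`|w (enum_val k) x| / `|w t0 x|)) @ F -->
    - ln (`|W (enum_val k)| / `|W t0|).
  apply: cvgN; apply: continuous_cvg h; apply: continuous_ln.
  by rewrite divr_gt0// normr_gt0.
apply: cvg_trans hl; apply: near_eq_cvg.
have := ratioE (enum_val k); apply: (@filterS _ F FF) => x /= ->.
by rewrite expRK opprK.
Qed.

Let qd_cvg t : (fun x => dotv (q x) (d t)) @ F --> dotv Q (d t).
Proof.
apply: cvg_sumr => i _; apply: cvgM; last exact: cvg_cst.
exact: q_cvg.
Qed.

Let qd x t : t \in A0 -> dotv (q x) (d t) = dotv (logv x) (d t).
Proof.
move=> tA0.
have /mulmxKpV/matrixP/(_ 0 (enum_rank t)) : (logv x *m D^T <= D^T)%MS.
  exact: submxMl.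
rewrite logvD enum_rankK tA0 => <-; rewrite [RHS]mxE.
by apply: eq_bigr => i _; rewrite !mxE enum_rankK tA0 !mxE.
Qed.

Let Qd t : t \in A0 -> expR (- dotv Q (d t)) = `|W t| / `|W t0|.
Proof.
move=> tA0; have tA : t \in A by move: tA0; rewrite inE => /andP[].
have hv : (fun x => expR (- dotv (q x) (d t))) @ F --> expR (- dotv Q (d t)).
  by apply: continuous_cvg; [exact: continuous_expR|apply: cvgN; exact: qd_cvg].
apply: (cvg_near_eq _ hv (ratio_cvg tA)).
by have := ratioE t; apply: (@filterS _ F FF) => x /= ->; rewrite qd.
Qed.

Let z : 'rV[R]_n := \row_i (s i * expR (- Q 0 i)).

Let z_torus : torus z.
Proof. by move=> i; rewrite mxE mulf_neq0// expR_eq0. Qed.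

Let monomial_z t : t \in A0 ->
  monomial (e t) z = W t * (expR (- dotv Q (mi_vec (e t0))) / `|W t0|).
Proof.
move=> tA0; have tA : t \in A by move: tA0; rewrite inE => /andP[].
have -> : monomial (e t) z = sg t * expR (- dotv Q (mi_vec (e t))).
  rewrite /monomial /sg /dotv -sumrN (big_morph _ (@expRD R) (@expR0 R)).
  rewrite -big_split/=; apply: eq_bigr => i _.
  by rewrite !mxE exprMn -expRM_natr mulNr.
have -> : mi_vec (e t) = d t + mi_vec (e t0) :> 'rV[R]_n by rewrite /d subrK.
rewrite dotvDr opprD expRD Qd// [in RHS]W_sg//; ring.
Qed.

Let p_gt0 : F [set x | forall i, 0 < (logv x - q x) 0 i].
Proof.
apply: filter_forall => i.
have Q1 : Q 0 i < Q 0 i + 1 by rewrite ltrDl.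
have h := @cvgr_lt _ _ F FF _ _ (@q_cvg i) _ Q1.
have := @filterI _ F FF _ _ h (Fbad (expR_gt0 (- (Q 0 i + 1)))); apply: (@filterS _ F FF).
move=> x [/= qx [x0 xk _]]; rewrite mxE [X in _ + X]mxE subr_gt0; apply: (lt_trans qx).
by rewrite [X in _ < X]mxE ltrNr -ltr_expR lnK ?posrE ?normr_gt0.
Qed.

Let p_face : F [set x | forall t, t \in A ->
  if t \in A0 then dotv (logv x - q x) (d t) = 0
              else 0 < dotv (logv x - q x) (d t)].
Proof.
apply: filter_forall => t; have [tA0|tA0] := boolP (t \in A0).
  by apply: filterE => x _; rewrite dotvBl qd ?subrr.
have [tA|tA] := boolP (t \in A); last by apply: filterE.
have h : (fun x => `|w t x| / `|w t0 x| * expR (dotv (q x) (d t))) @ F -->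
    `|W t| / `|W t0| * expR (dotv Q (d t)).
  apply: cvgM; first exact: ratio_cvg.
  by apply: continuous_cvg; [exact: continuous_expR|exact: qd_cvg].
move: tA0; rewrite inE tA/= negbK => /eqP Wt.
have /(@cvgr_lt _ _ F FF _ _ h) : `|W t| / `|W t0| * expR (dotv Q (d t)) < 1.
  by rewrite Wt normr0 !mul0r.
move=> h1; have := @filterI _ F FF _ _ h1 (ratioE t); apply: (@filterS _ F FF) => x [/= + E] _.
by rewrite E -expRD -[1]expR0 ltr_expR dotvBl addrC subr_lt0 subr_gt0.
Qed.

Lemma exists_critical_face : exists a t0 z,
  [/\ t0 \in A, forall i, 0 < a 0 i,
      forall t, t \in A -> dotv a (mi_vec (e t0)) <= dotv a (mi_vec (e t)),
      torus z &
      forall j, \sum_(t in A | dotv a (mi_vec (e t)) == dotv a (mi_vec (e t0)))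
         c t * (e t j)%:R * monomial (e t) z = 0].
Proof.
have [x [xp xf]] := filter_ex (@filterI _ F FF _ _ p_gt0 p_face).
exists (logv x - q x), t0, z; split=> //.
  move=> t tA; rewrite -subr_ge0 -dotvBr; have := xf t tA.
  by case: ifP => [_ -> //|_ /ltW].
move=> j.
rewrite (eq_bigl (mem A0)); last first.
  move=> t; rewrite -subr_eq0 -dotvBr -/(d t).
  rewrite [RHS]inE; case: (boolP (t \in A)) => //= tA; have := xf t tA.
  rewrite inE tA /=; case: ifP => _ => [->|/lt0r_neq0/negbTE ->//].
  by rewrite eqxx.
have := thW j; rewrite (bigID (mem A0))/= [X in _ + X]big1 ?addr0; last first.
  move=> t; rewrite inE => /andP[tA]; rewrite tA /= negbK => /eqP ->.
  by rewrite mulr0.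
move=> S0; set C := expR (- dotv Q (mi_vec (e t0))) / `|W t0|.
rewrite -[RHS](mul0r C) -[in RHS]S0 mulr_suml.
apply: eq_big => t; first by rewrite inE; case: (t \in A).
by move=> tA0; rewrite monomial_z// !mulrA.
Qed.

End Direction.

Lemma ultra_critical_face : exists a t0 z,
  [/\ t0 \in A, forall i, 0 < a 0 i,
      forall t, t \in A -> dotv a (mi_vec (e t0)) <= dotv a (mi_vec (e t)),
      torus z &
      forall j, \sum_(t in A | dotv a (mi_vec (e t)) == dotv a (mi_vec (e t0)))
         c t * (e t j)%:R * monomial (e t) z = 0].
Proof.
have [t0 t0A Wt0] : exists2 t0, t0 \in A & W t0 != 0.
  apply: contrapT => h; have := sumW1; rewrite big1 => [|t tA].
    by move=> /esym/eqP; rewrite oner_eq0.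
  apply/eqP; rewrite normr_eq0; apply/negPn/negP => Wt; apply: h; by exists t.
exact: (exists_critical_face t0A Wt0).
Qed.

End Ultra.

(** If the logarithmic gradient of the polynomial were not bounded below by the sum
    of the absolute values of its monomials, an ultrafilter of counterexamples
    would produce a positive weight and a point of the torus where the
    logarithmic gradient of the corresponding face polynomial vanishes. *)
Lemma torus_gradient_bound :
  (forall a t0 z, t0 \in A -> (forall i, 0 < a 0 i) ->
     (forall t, t \in A -> dotv a (mi_vec (e t0)) <= dotv a (mi_vec (e t))) ->
     torus z ->
     exists j, \sum_(t in A | dotv a (mi_vec (e t)) == dotv a (mi_vec (e t0)))
         c t * (e t j)%:R * monomial (e t) z != 0) ->
  exists2 k : R, 0 < k & forall x, torus x -> (forall i, `|x 0 i| < k) ->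
    k * \sum_(t in A) `|monomial (e t) x| <=
    \sum_j `|\sum_(t in A) c t * (e t j)%:R * monomial (e t) x|.
Proof.
move=> nd; apply: contrapT => nk.
pose E (k : R) := [set x | [/\ torus x, forall i, `|x 0 i| < k &
                 \sum_j `|th j x| < k * m x]].
have E0 k : 0 < k -> E k !=set0.
  move=> k0; apply: contrapT => Ek; apply: nk; exists k => // x x0 xk.
  rewrite leNgt; apply/negP => h; apply: Ek; exists x; split=> //.
have FE : ProperFilter (filter_from [set k : R | 0 < k] E).
  apply: filter_from_proper => //; apply: filter_from_filter; first by exists 1 => /=; exact: ltr01.
  move=> i j /= i0 j0; exists (Num.min i j); first by rewrite /= lt_min; apply/andP.
  have m0 x : 0 <= m x by apply: sumr_ge0.
  move=> x [x0 xk xm]; split; split=> //.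
  - by move=> l; have := xk l; rewrite lt_min => /andP[].
  - by apply: (lt_le_trans xm); rewrite ler_wpM2r// ge_min lexx.
  - by move=> l; have := xk l; rewrite lt_min => /andP[].
  - by apply: (lt_le_trans xm); rewrite ler_wpM2r// ge_min lexx orbT.
have [F [FU sF]] := ultraFilterLemma FE.
have [|a [t0 [z [t0A a0 at0 z0 h]]]] := @ultra_critical_face F FU.
  by move=> k k0; apply: sF; exists k.
by have [j] := nd a t0 z t0A a0 at0 z0; rewrite h eqxx.
Qed.

End FaceOrBound.

(** * Minimal exponents *)

Section Dickson.
Context {n : nat}.
Local Notation mi := {ffun 'I_n -> nat}.

(** Dickson's lemma. Fix an element s of S: an element not above s takes in
    some coordinate i one of the finitely many values below s i, and the elements
    with a prescribed i-th coordinate have one free coordinate less. *)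
Lemma dickson_box (S : set mi) :
  exists N, forall al, S al ->
    exists2 be, S be & forall i, (be i <= al i)%N /\ (be i < N)%N.
Proof.
suff P k : forall (W : {set 'I_n}) (S' : set mi), (#|W| <= k)%N ->
    (forall al be, S' al -> S' be -> forall i, i \notin W -> al i = be i) ->
    exists N, forall al, S' al ->
      exists2 be, S' be & forall i, (be i <= al i)%N /\ (be i < N)%N.
  by apply: (P _ finset.setT S (leqnn _)) => al be _ _ i; rewrite inE.
elim: k => [|k IH] W S' Wk agree; have [[s Ss]|S0] := pselect (S' !=set0).
- exists (\max_i s i).+1 => al Sal; exists s => // i.
  rewrite ltnS leq_bigmax; split=> //.
  rewrite (agree _ _ Ss Sal)//.
  by move: Wk; rewrite leqn0 cards_eq0 => /eqP ->; rewrite finset.in_set0.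
- by exists 0%N => al Sal; case: S0; exists al.
- pose M := (\max_i s i).+1.
  have h (iv : 'I_n * 'I_M) : exists N, iv.1 \in W -> forall al,
      S' al -> al iv.1 = iv.2 ->
      exists2 be, S' be & forall i, (be i <= al i)%N /\ (be i < N)%N.
    have [iW|iW] := boolP (iv.1 \in W); last by exists 0%N.
    have [|al be [Sal ai] [Sbe bi] j|N NP] :=
        IH (W :\ iv.1) [set al | S' al /\ al iv.1 = iv.2].
    + by move: Wk; rewrite (cardsD1 iv.1) iW.
    + rewrite !inE negb_and negbK => /orP[/eqP ->|jW]; last exact: agree.
      by rewrite ai bi.
    + exists N => _ al Sal ai; have [be [Sbe _] bP] := NP al (conj Sal ai).
      by exists be.
  have [N NP] := choice h.
  exists (M + \max_iv N iv)%N => al Sal.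
  have [le_s|/existsP[i]] := boolP [forall i, s i <= al i]%N.
    exists s => // i; split; first exact: (forallP le_s).
    by apply: (leq_trans _ (leq_addr _ _)); rewrite ltnS leq_bigmax.
  rewrite -ltnNge => ai.
  have iW : i \in W.
    apply: contraLR ai => iW; rewrite -leqNgt.
    by rewrite (agree _ _ Ss Sal).
  have aM : (al i < M)%N.
    by apply: (leq_trans ai); apply/leqW/leq_bigmax.
  have [be Sbe bP] := NP (i, Ordinal aM) iW al Sal erefl.
  exists be => // j; have [ba bN] := bP j; split=> //.
  apply: (leq_trans bN); apply: (leq_trans _ (leq_addl _ _)).
  exact: leq_bigmax.
- by exists 0%N => al Sal; case: S0; exists al.
Qed.

End Dickson.

(** * The Newton polyhedron and its faces *)

Lemma rV_norm_le {R : realType} {n : nat} (x : 'rV[R]_n) (c : R) :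
  0 <= c -> (forall i, `|x 0 i| <= c) -> `|x| <= c.
Proof.
move=> c0 xc; rewrite [leLHS]/Num.norm/= mx_normrE.
by apply: bigmax_le => // -[i k] _ /=; rewrite ord1.
Qed.

Section Polyhedron.
Context {R : realType} {n : nat}.
Variable f : 'rV[R]_n -> R.
Local Notation mi := {ffun 'I_n -> nat}.
Local Notation Gam := (newton_polyhedron f).
Implicit Types (x y z a : 'rV[R]_n) (al be : mi) (l : R).

Definition supp : set mi := [set al | taylor_coef f al != 0].

Lemma newton_convex x y (s : R) : 0 <= s <= 1 -> Gam x -> Gam y ->
  Gam (s *: x + (1 - s) *: y).
Proof.
move=> s01 Gx Gy C [cC sC].
have := cC x y (Itv01 (proj1 (andP s01)) (proj2 (andP s01))).
rewrite !inE; apply; rewrite ?inE; [exact: Gx|exact: Gy].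
Qed.

Lemma newton_supp al : supp al -> Gam (mi_vec al).
Proof.
move=> Sal C [_ sC]; apply: sC; exists al => //; exists 0; last by rewrite addr0.
by move=> i; rewrite mxE.
Qed.

Lemma newton_sub (C : set 'rV[R]_n) :
  (forall x y (s : R), 0 <= s <= 1 -> C x -> C y -> C (s *: x + (1 - s) *: y)) ->
  (forall al y, supp al -> orthant y -> C (mi_vec al + y)) ->
  Gam `<=` C.
Proof.
move=> cC sC x; apply; split.
  move=> u v s; rewrite !inE => Cu Cv; apply: cC => //.
  by apply/andP; split.
by move=> _ [al Sal [y y0 <-]]; exact: sC.
Qed.

Lemma valid_pair_supp a l : (forall i, 0 <= a 0 i) ->
  (forall al, supp al -> l <= dotv a (mi_vec al)) -> valid_pair f a l.
Proof.
move=> a0 la; apply: newton_sub => [x y s /andP[s0 s1] lx ly|al y Sal y0].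
  rewrite dotvDr !dotvZr.
  have -> : l = s * l + (1 - s) * l by ring.
  by rewrite lerD// ler_wpM2l// subr_ge0.
rewrite dotvDr -[l]addr0 lerD ?la//; apply: sumr_ge0 => i _.
exact: mulr_ge0.
Qed.

Lemma orthant_axis (c : R) i : 0 <= c -> orthant (c *: delta_mx 0 i : 'rV[R]_n).
Proof. by move=> c0 j; rewrite !mxE mulr_ge0// ler0n. Qed.

Lemma valid_pair_ge0 a l : Gam !=set0 -> valid_pair f a l -> forall i, 0 <= a 0 i.
Proof.
move=> [x Gx] va i; rewrite leNgt; apply/negP => ai.
have c0 : 0 <= (dotv a x - l + 1) / - a 0 i.
  by rewrite divr_ge0 ?oppr_ge0 ?(ltW ai)// addr_ge0// subr_ge0 va.
have := va _ (newton_polyhedronD Gx (orthant_axis i c0)).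
rewrite dotvDr dotv_axis invrN mulrN mulrN mulrCA divff ?lt_eqF// mulr1.
lra.
Qed.

Section Box.
Variable N : nat.
Local Notation B := {ffun 'I_n -> 'I_N}.

Definition mi_of (b : B) : mi := [ffun i => b i : nat].

Hypothesis box : forall al, supp al ->
  exists2 b : B, supp (mi_of b) & forall i, (b i <= al i)%N.

Lemma dotv_le a x y : (forall i, 0 <= a 0 i) -> (forall i, x 0 i <= y 0 i) ->
  dotv a x <= dotv a y.
Proof. by move=> a0 xy; apply: ler_sum => i _; rewrite ler_wpM2l. Qed.

Lemma valid_pair_box a l : (forall i, 0 <= a 0 i) ->
  (forall b : B, supp (mi_of b) -> l <= dotv a (mi_vec (mi_of b))) ->
  forall al, supp al -> l <= dotv a (mi_vec al).
Proof.
move=> a0 la al /box[b Sb ba]; apply: (le_trans (la b Sb)).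
by apply: dotv_le => // i; rewrite !mxE ffunE ler_nat.
Qed.

(** The polyhedron is the convex hull of its generators plus the orthant; the
    inequality stands for the orthant. *)
Lemma newton_combination x : Gam x -> exists t : B -> R,
  [/\ forall b, 0 <= t b, \sum_b t b = 1, forall b, t b != 0 -> supp (mi_of b) &
      forall i, (\sum_b t b *: mi_vec (mi_of b)) 0 i <= x 0 i].
Proof.
move: x; apply: newton_sub => [x y s /andP[s0 s1] [t [t0 t1 tS tx]]|al y Sal y0].
  move=> [u [u0 u1 uS uy]]; exists (fun b => s * t b + (1 - s) * u b); split.
  - by move=> b; rewrite addr_ge0// mulr_ge0// subr_ge0.
  - rewrite big_split/= -!mulr_sumr t1 u1; ring.
  - move=> b; have [tb|/tS//] := eqVneq (t b) 0.
    have [ub|/uS//] := eqVneq (u b) 0.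
    by rewrite tb ub !mulr0 addr0 eqxx.
  - move=> i; under eq_bigr do rewrite scalerDl -!scalerA.
    rewrite big_split/= -!scaler_sumr [leLHS]mxE [leRHS]mxE.
    rewrite [X in X + _ <= _]mxE [X in _ + X <= _]mxE.
    rewrite [X in _ <= X + _]mxE [X in _ <= _ + X]mxE.
    by rewrite lerD// ler_wpM2l// subr_ge0.
have [b Sb ba] := box Sal; exists (fun b' => (b' == b)%:R); split.
- by move=> b'; rewrite ler0n.
- by rewrite (bigD1 b)//= eqxx big1 ?addr0// => b' /negbTE ->.
- by move=> b'; have [->//|] := eqVneq b' b; rewrite eqxx.
- move=> i; rewrite (bigD1 b)//= eqxx scale1r big1 ?addr0; last first.
    by move=> b' /negbTE ->; rewrite scale0r.
  by rewrite !mxE ffunE -[leLHS]addr0 lerD ?ler_nat.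
Qed.

Lemma combination_newton (t : B -> R) :
  (forall b, 0 <= t b) -> \sum_b t b = 1 ->
  (forall b, t b != 0 -> supp (mi_of b)) ->
  Gam (\sum_b t b *: mi_vec (mi_of b)).
Proof.
suff P (r : seq B) : forall t : B -> R, (forall b, 0 <= t b) ->
    \sum_(b <- r) t b = 1 -> (forall b, t b != 0 -> supp (mi_of b)) ->
    Gam (\sum_(b <- r) t b *: mi_vec (mi_of b)) by exact: P.
elim: r => [|b r IH] u u0 u1 uS.
  by move: u1; rewrite big_nil => /esym/eqP; rewrite oner_eq0.
move: u1; rewrite !big_cons => u1.
have [ub|ub] := eqVneq (u b) 1.
  have r0 : \sum_(b' <- r) u b' = 0 by lra.
  rewrite ub scale1r big_seq big1 ?addr0.
    by apply: newton_supp; apply: uS; rewrite ub oner_neq0.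
  move=> b' b'r; move/eqP: r0; rewrite psumr_eq0// => /allP/(_ b' b'r)/=/eqP ->.
  by rewrite scale0r.
have s0 : 0 <= \sum_(b' <- r) u b' by exact: sumr_ge0.
have [ub0|ub0] := eqVneq (u b) 0.
  by rewrite ub0 scale0r add0r; apply: IH => //; rewrite -u1 ub0 add0r.
have Eu : \sum_(b' <- r) u b' = 1 - u b by rewrite -u1 addrAC subrr add0r.
have ub1 : 1 - u b != 0 by rewrite subr_eq0 eq_sym.
have -> : \sum_(b' <- r) u b' *: mi_vec (mi_of b') =
    (1 - u b) *: \sum_(b' <- r) ((u b' / (1 - u b)) *: mi_vec (mi_of b')) :> 'rV[R]_n.
  rewrite scaler_sumr; apply: eq_bigr => b' _.
  by rewrite scalerA mulrCA divff// mulr1.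
apply: newton_convex; first by rewrite u0/= -subr_ge0 -Eu.
  by apply: newton_supp; exact: uS.
apply: IH.
- by move=> b'; rewrite divr_ge0// -Eu.
- by rewrite -mulr_suml Eu divff.
- by move=> b'; rewrite mulf_eq0 negb_or => /andP[/uS].
Qed.

Lemma dotv_suml (I : Type) (r : seq I) (P : pred I) a (F : I -> 'rV[R]_n) :
  dotv a (\sum_(i <- r | P i) F i) = \sum_(i <- r | P i) dotv a (F i).
Proof.
apply: (big_morph (dotv a)) => [x y|]; first exact: dotvDr.
by apply: big1 => i _; rewrite mxE mulr0.
Qed.

(** A positive weight that is minimal at x leaves no room for the orthant part of x,
    nor for generators on which the weight is not minimal. *)
Lemma face_combination a l x : (forall i, 0 < a 0 i) ->
  (forall b : B, supp (mi_of b) -> l <= dotv a (mi_vec (mi_of b))) ->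
  Gam x -> dotv a x = l -> exists t : B -> R,
  [/\ forall b, 0 <= t b, \sum_b t b = 1,
      forall b, t b != 0 -> supp (mi_of b) /\ dotv a (mi_vec (mi_of b)) = l &
      x = \sum_b t b *: mi_vec (mi_of b)].
Proof.
move=> a0 la Gx ax; have [t [t0 t1 tS tx]] := newton_combination Gx.
set w := \sum_b _ in tx.
have lw : dotv a w - l = \sum_b t b * (dotv a (mi_vec (mi_of b)) - l).
  rewrite dotv_suml; under eq_bigr do rewrite dotvZr.
  by under [RHS]eq_bigr do rewrite mulrBr; rewrite sumrB -mulr_suml t1 mul1r.
have wpos b : true -> 0 <= t b * (dotv a (mi_vec (mi_of b)) - l).
  move=> _; have [->|/tS Sb] := eqVneq (t b) 0; first by rewrite mul0r.
  by rewrite mulr_ge0// subr_ge0 la.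
have wx : dotv a w <= l by rewrite -ax; apply: dotv_le => // i; exact: ltW.
have wl : dotv a w = l.
  by apply/eqP; rewrite eq_le wx -subr_ge0 lw sumr_ge0.
have xw : x = w.
  apply/rowP => i; apply/eqP; rewrite -subr_eq0.
  have : \sum_i a 0 i * (x 0 i - w 0 i) = 0.
    by under eq_bigr do rewrite mulrBr; rewrite sumrB -/(dotv a x) -/(dotv a w) ax wl subrr.
  move/eqP; rewrite psumr_eq0 => [/allP/(_ i (mem_index_enum _))/=|j _].
    by rewrite mulf_eq0 gt_eqF.
  by rewrite mulr_ge0 ?(ltW (a0 j))// subr_ge0.
exists t; split=> // b tb; split; first exact: tS.
apply/eqP; rewrite -subr_eq0.
move: lw; rewrite wl subrr => /esym/eqP; rewrite psumr_eq0//.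
by move=> /allP/(_ b (mem_index_enum _))/=; rewrite mulf_eq0 (negbTE tb).
Qed.

(** The face is the continuous image of a closed subset of a simplex. *)
Lemma face_compact a l : (forall i, 0 < a 0 i) ->
  (forall b : B, supp (mi_of b) -> l <= dotv a (mi_vec (mi_of b))) ->
  compact [set x | Gam x /\ dotv a x = l].
Proof.
move=> a0 la.
pose ok b := `[< supp (mi_of b) /\ dotv a (mi_vec (mi_of b)) = l >].
pose D := [set t : 'rV[R]_#|B| | (forall k, 0 <= t 0 k) /\
  ((forall k, ~~ ok (enum_val k) -> t 0 k = 0) /\ \sum_k t 0 k = 1)].
pose g (t : 'rV[R]_#|B|) := \sum_k t 0 k *: mi_vec (mi_of (enum_val k)) : 'rV[R]_n.
have sumB (V : nmodType) (F : B -> V) : \sum_b F b = \sum_(k < #|B|) F (enum_val k).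
  by rewrite -(big_enum_val F).
have -> : [set x | Gam x /\ dotv a x = l] = g @` D.
  apply/seteqP; split=> x /=.
    move=> [Gx ax]; have [t [t0 t1 tS ->]] := face_combination a0 la Gx ax.
    exists (\row_k t (enum_val k)).
      split; [by move=> k; rewrite mxE|split].
        move=> k; rewrite mxE; apply: contraNeq => /tS ?; exact/asboolP.
      by rewrite -t1 sumB; apply: eq_bigr => k _; rewrite mxE.
    by rewrite /g [RHS]sumB; apply: eq_bigr => k _; rewrite mxE.
  move=> [t [t0 [tok t1]] <-].
  have E : g t = \sum_b t 0 (enum_rank b) *: mi_vec (mi_of b).
    by rewrite sumB; apply: eq_bigr => k _; rewrite enum_valK.
  have okb b : t 0 (enum_rank b) != 0 -> supp (mi_of b) /\ dotv a (mi_vec (mi_of b)) = l.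
    by apply: contraNP => nok; apply/eqP/tok; rewrite enum_rankK; apply/asboolPn.
  rewrite E; split.
    apply: combination_newton => [b||b /okb[]//]; first exact: t0.
    by rewrite sumB -[RHS]t1; apply: eq_bigr => k _; rewrite enum_valK.
  rewrite dotv_suml (eq_bigr (fun b => t 0 (enum_rank b) * l)); last first.
    move=> b _; rewrite dotvZr; have [->|/okb[_ ->]//] := eqVneq (t 0 (enum_rank b)) 0.
    by rewrite !mul0r.
  rewrite -mulr_suml sumB -[RHS]mul1r; congr (_ * _); rewrite -t1.
  by apply: eq_bigr => k _; rewrite enum_valK.
have ck k : continuous (fun t : 'rV[R]_#|B| => t 0 k) by move=> t; exact: coord_continuous.
apply: continuous_compact.
  have cg : continuous g.
    move=> t; rewrite /continuous_at /g.
    apply: (@cvg_big _ _ _ _ _ _ _ (nbhs t)) => [|k _]; first exact: add_continuous.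
    by apply: cvgZr_tmp; exact: ck.
  exact: continuous_subspaceT.
apply: bounded_closed_compact.
  exists 1; split; first exact: num_real.
  move=> M M1 t [t0 [_ t1]]; apply: le_trans (ltW M1).
  apply: rV_norm_le => // k.
  by rewrite ger0_norm// -t1 (bigD1 k)//= lerDl sumr_ge0.
have closed_ge0 : closed [set t : 'rV[R]_#|B| | forall k, 0 <= t 0 k].
  rewrite (_ : mkset _ = \bigcap_k [set t : 'rV[R]_#|B| | 0 <= t 0 k]); last first.
    by apply/seteqP; split=> t h; [move=> k _; exact: h|move=> k; exact: h].
  apply: closed_bigI => k _; apply: (preimage_closed _ (@closed_ge R 0)) => t _.
  exact: ck.
rewrite /D (_ : mkset _ = [set t : 'rV[R]_#|B| | forall k, 0 <= t 0 k] `&`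
  (\bigcap_(k in [set k | ~~ ok (enum_val k)]) [set t : 'rV[R]_#|B| | t 0 k = 0] `&`
   [set t : 'rV[R]_#|B| | \sum_k t 0 k = 1])); last first.
  by apply/seteqP; split=> t [h0 [h1 h2]]; split=> //; split=> // k hk; exact: h1.
apply: closedI => //; apply: closedI.
  apply: closed_bigI => k _; apply: (preimage_closed _ (@closed_eq R 0)) => t _.
  exact: ck.
apply: (preimage_closed _ (@closed_eq R 1)) => t _.
by apply: (@cvg_big _ _ _ _ _ _ _ (nbhs t)) => [|k _]; [exact: add_continuous|exact: ck].
Qed.

End Box.
End Polyhedron.

(** * Vertices and the exponents in the convenient coordinate plane *)

Lemma ltr_sum1 {R : realType} {I : finType} (j : I) (F G : I -> R) :
  (forall i, F i <= G i) -> F j < G j -> \sum_i F i < \sum_i G i.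
Proof.
move=> FG FGj; rewrite (bigD1 j)//= [ltRHS](bigD1 j)//=.
by rewrite ltr_leD// ler_sum.
Qed.

Section Vertices.
Context {R : realType} {n : nat}.
Variable f : 'rV[R]_n -> R.
Variable N : nat.
Local Notation mi := {ffun 'I_n -> nat}.
Local Notation B := {ffun 'I_n -> 'I_N}.
Local Notation Gam := (newton_polyhedron f).
Local Notation S := (supp f).
Implicit Types (x y z a : 'rV[R]_n) (al be : mi) (l : R) (b : B).

Hypothesis box : forall al, S al -> exists2 b : B, S (mi_of b) & forall i, (b i <= al i)%N.
Hypothesis S_neq0 : S !=set0.

Lemma mi_of_inj : injective (@mi_of n N).
Proof.
move=> b b' /ffunP h; apply/ffunP => i; apply: val_inj => /=.
by have := h i; rewrite !ffunE.
Qed.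

Lemma mi_vec_inj : injective (@mi_vec R n).
Proof.
move=> al be /rowP h; apply/ffunP => i.
by have /eqP := h i; rewrite !mxE eqr_nat => /eqP.
Qed.

Lemma mi_vec_mi_of b i : mi_vec (mi_of b) 0 i = (b i)%:R :> R.
Proof. by rewrite mxE ffunE. Qed.

Lemma unique_min_vertex a b : (forall i, 0 < a 0 i) -> S (mi_of b) ->
  (forall b', S (mi_of b') -> b' != b ->
     dotv a (mi_vec (mi_of b)) < dotv a (mi_vec (mi_of b'))) ->
  vertices f (mi_vec (mi_of b)).
Proof.
move=> a0 Sb ltb; set l := dotv a (mi_vec (mi_of b)).
have la b' : S (mi_of b') -> l <= dotv a (mi_vec (mi_of b')).
  by move=> Sb'; have [->//|/ltb/ltW] := eqVneq b' b; apply.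
exists a, l; split.
- apply: valid_pair_supp => [i|]; first exact: ltW.
  by apply: (valid_pair_box box) => // i; exact: ltW.
- apply/seteqP; split=> x /=.
    by move=> ->; split=> //; exact: newton_supp.
  move=> [Gx ax]; have [t [t0 t1 tS ->]] := face_combination box a0 la Gx ax.
  rewrite -[RHS]scale1r -t1 scaler_suml; apply: eq_bigr => b' _.
  have [->|/tS[Sb' ab']] := eqVneq (t b') 0; first by rewrite !scale0r.
  by have [->//|/(ltb _ Sb')] := eqVneq b' b; rewrite ab' ltxx.
- by exists (mi_vec (mi_of b)).
Qed.

(** Perturbing a towards q - b keeps the pair positive; among the minimizers of
    a, the point b farthest from the corner q is singled out, since a sphere is
    strictly convex. *)
Lemma min_vertex a : (forall i, 0 <= a 0 i) -> exists b,
  [/\ S (mi_of b), vertices f (mi_vec (mi_of b)) &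
      forall b', S (mi_of b') -> dotv a (mi_vec (mi_of b)) <= dotv a (mi_vec (mi_of b'))].
Proof.
move=> a0.
have [al0 /box[b0 Sb0 _]] := S_neq0.
pose ok b := `[< S (mi_of b) >].
have okb0 : ok b0 by exact/asboolP.
pose v b := dotv a (mi_vec (mi_of b)).
case: (@arg_minP _ _ _ b0 ok v okb0) => bm okbm vmin.
pose q : 'rV[R]_n := const_mx N%:R.
pose D b := \sum_i (q 0 i - (b i)%:R) ^+ 2.
pose ok2 b := ok b && (v b == v bm).
have ok2m : ok2 bm by rewrite /ok2 okbm eqxx.
case: (@arg_maxP _ _ _ bm ok2 D ok2m) => b /andP[okb /eqP vb] Dmax.
have /asboolP Sb := okb.
have minb b' : S (mi_of b') -> v b <= v b'.
  by move=> Sb'; rewrite vb; apply: vmin; exact/asboolP.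
exists b; split=> //.
pose w := q - mi_vec (mi_of b).
have w0 i : 0 < w 0 i.
  by rewrite !mxE ffunE subr_gt0 ltr_nat.
pose d b' := mi_vec (mi_of b') - mi_vec (mi_of b) : 'rV[R]_n.
have wd b' : ok2 b' -> b' != b -> 0 < dotv w (d b').
  move=> okb' b'b.
  have E : 2 * dotv w (d b') = D b - D b' + \sum_i ((b i)%:R - (b' i)%:R) ^+ 2.
    rewrite /D /dotv mulr_sumr -sumrB -big_split/=; apply: eq_bigr => i _.
    rewrite !mxE !ffunE; ring.
  have : 0 < 2 * dotv w (d b').
    rewrite E; apply: ltr_wpDl; first by rewrite subr_ge0; exact: Dmax.
    have [i bi] : exists i, b' i != b i.
      apply/existsP; rewrite -negb_forall; apply: contra b'b => /forallP h.
      by apply/eqP/ffunP => i; exact/eqP.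
    rewrite (bigD1 i)//=; apply: ltr_pwDl; last by apply: sumr_ge0 => j _; exact: sqr_ge0.
    by rewrite lt0r sqr_ge0 sqrf_eq0 subr_eq0 eqr_nat eq_sym andbT.
  by rewrite pmulr_rgt0.
have Heps : \forall eps \near (0 : R)^'+, forall b', ok b' -> b' != b ->
    0 < dotv (a + eps *: w) (d b').
  apply: filter_forall => b'.
  have [okb'|_] := boolP (ok b'); last by apply: nearW.
  have [->|b'b] := eqVneq b' b; first by apply: nearW.
  have [vb'|vb'] := eqVneq (v b') (v bm).
    near=> eps => _ _; rewrite dotvDl dotvZl [X in X + _](_ : _ = 0); last first.
      by rewrite /d dotvBr -/(v b') -/(v b) vb vb' subrr.
    by rewrite add0r mulr_gt0// wd// /ok2 okb' vb' eqxx.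
  have dv : 0 < dotv a (d b').
    rewrite /d dotvBr subr_gt0 -/(v b') -/(v b) vb lt_neqAle eq_sym vb'.
    by rewrite vmin.
  near=> eps => _ _; rewrite dotvDl dotvZl.
  have e1 : eps * (`|dotv w (d b')| + 1) < dotv a (d b').
    by rewrite -ltr_pdivlMr ?ltr_wpDl//; near: eps; apply: nbhs_right_lt; rewrite divr_gt0// ltr_wpDl.
  have e0 : 0 < eps by [].
  have := ler_norm (- dotv w (d b')); rewrite normrN => h.
  nra.
near (0 : R)^'+ => eps.
have e0 : 0 < eps by [].
apply: (@unique_min_vertex (a + eps *: w)) => // [i|b' Sb' b'b].
  by rewrite 2!mxE ltr_wpDl// mulr_gt0.
rewrite -subr_gt0 -dotvBr -/(d b'); move: b' Sb' b'b.
suff h : forall b', ok b' -> b' != b -> 0 < dotv (a + eps *: w) (d b').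
  by move=> b' Sb'; apply: h; exact/asboolP.
by near: eps.
Unshelve. all: by end_near. Qed.

Lemma vertex_supp v : vertices f v -> exists2 b : B, S (mi_of b) & v = mi_vec (mi_of b).
Proof.
move=> vv; have Gv := vertices_sub vv; case: vv => a [l [va e _]].
have a0 := valid_pair_ge0 (ex_intro _ v Gv) va.
have [b [Sb _ minb]] := min_vertex a0.
exists b => //.
have vl : dotv a v = l.
  by have : [set v] v by []; rewrite e => -[].
have : [set v] (mi_vec (mi_of b)).
  rewrite e; split; first exact: newton_supp.
  apply/eqP; rewrite eq_le va ?andbT; last exact: newton_supp.
  have /(_ v Gv) : valid_pair f a (dotv a (mi_vec (mi_of b))).
    by apply: valid_pair_supp => //; exact: (valid_pair_box box).
  by rewrite vl.
by move=> /= ->.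
Qed.

Variables (I : {set 'I_n}) (nu : 'I_n -> nat).
Hypothesis pc : partially_convenient_with f I nu.

Definition plane_exps : {set B} :=
  [set b | `[< S (mi_of b) >] && [forall j, (j \in I) || (b j == 0 :> nat)]].

Lemma plane_expsP b : b \in plane_exps <->
  S (mi_of b) /\ forall j, j \notin I -> b j = 0 :> nat.
Proof.
rewrite inE; split.
  move=> /andP[/asboolP Sb /forallP bI]; split=> // j jI.
  by have := bI j; rewrite (negbTE jI) => /eqP.
move=> [Sb bI]; apply/andP; split; first exact/asboolP.
by apply/forallP => j; case: (boolP (j \in I)) => //= /bI ->.
Qed.

Lemma vertex_conv_exps b : vertices f (mi_vec (mi_of b)) -> b \in plane_exps.
Proof.
move=> vb; apply/plane_expsP; split.
  by have [b' Sb' /mi_vec_inj/mi_of_inj ->] := vertex_supp vb.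
move=> j jI; have /eqP := pc.2 _ vb j jI.
by rewrite mi_vec_mi_of pnatr_eq0 => /eqP.
Qed.

Lemma plane_exps_min a : (forall i, 0 <= a 0 i) -> exists2 b : B, b \in plane_exps &
  forall al, S al -> dotv a (mi_vec (mi_of b)) <= dotv a (mi_vec al).
Proof.
move=> a0; have [b [Sb vb minb]] := min_vertex a0.
by exists b; [exact: vertex_conv_exps|exact: (valid_pair_box box)].
Qed.

Lemma plane_exps_axis i : i \in I -> exists2 b : B, b \in plane_exps &
  forall j, b j = (if j == i then nu i else 0)%N :> nat.
Proof.
move=> /pc.1[_ vi]; have [b Sb vb] := vertex_supp vi.
exists b; first by apply: vertex_conv_exps; rewrite -vb.
move=> j; have /rowP/(_ j)/eqP := vb.
rewrite !mxE ffunE eqxx/= -natrM eqr_nat eq_sym => /eqP ->.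
by case: eqP; rewrite ?muln1 ?muln0.
Qed.

(** An exponent of a compact face lies in the box, since a smaller exponent would
    have a smaller weight, and is supported in I, since lowering the weight of the
    other coordinates to 0 does not change the minimum. *)
Lemma plane_exps_face a t0 : (forall i, 0 < a 0 i) -> t0 \in plane_exps ->
  (forall t, t \in plane_exps ->
     dotv a (mi_vec (mi_of t0)) <= dotv a (mi_vec (mi_of t))) ->
  (forall al, S al -> dotv a (mi_vec (mi_of t0)) <= dotv a (mi_vec al)) /\
  (forall al, S al -> dotv a (mi_vec al) = dotv a (mi_vec (mi_of t0)) ->
     exists2 b : B, b \in plane_exps & al = mi_of b).
Proof.
move=> a0 t0A min0; set l := dotv a (mi_vec (mi_of t0)).
have lS al : S al -> l <= dotv a (mi_vec al).
  move=> Sal; have [b bA] := plane_exps_min (fun i => ltW (a0 i)).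
  by move=> /(_ _ Sal); apply: le_trans; exact: min0.
split=> // al Sal al_l.
have [b Sb ba] := box Sal.
have alb : al = mi_of b.
  apply/ffunP => i; rewrite ffunE; apply/eqP; move: i; apply/forallP.
  apply/negPn/negP; rewrite negb_forall => /existsP[i bi].
  have := lS _ Sb; rewrite -al_l leNgt => /negP; apply.
  rewrite /dotv; apply: (ltr_sum1 (j := i)) => [j|].
    by rewrite ler_pM2l// !mxE ler_nat ffunE ba.
  by rewrite ltr_pM2l// !mxE ltr_nat ffunE ltn_neqAle eq_sym bi ba.
exists b => //; apply/plane_expsP; split=> // j jI; apply/eqP/negPn/negP => bj.
pose a' : 'rV[R]_n := \row_i (if i \in I then a 0 i else 0).
have a'0 i : 0 <= a' 0 i by rewrite mxE; case: ifP => // _; exact: ltW.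
have a'E b' : b' \in plane_exps -> dotv a' (mi_vec (mi_of b')) = dotv a (mi_vec (mi_of b')).
  move=> /plane_expsP[_ b'I]; apply: eq_bigr => i _; rewrite [a' _ _]mxE.
  by case: ifPn => // /b'I; rewrite mi_vec_mi_of => ->; rewrite !mulr0.
have [b' b'A /(_ _ Sal)] := plane_exps_min a'0.
rewrite a'E// leNgt => /negP; apply; apply: lt_le_trans (min0 _ b'A).
rewrite -/l -al_l alb; apply: (ltr_sum1 (j := j)) => [i|].
  rewrite [a' _ _]mxE ler_wpM2r ?mi_vec_mi_of ?ler0n//.
  by case: ifP => // _; exact: ltW.
rewrite [a' _ _]mxE (negbTE jI) mul0r mulr_gt0//.
by rewrite mi_vec_mi_of ltr0n lt0n.
Qed.

Lemma face_part_conv_exps a t0 : (forall i, 0 < a 0 i) -> t0 \in plane_exps ->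
  (forall t, t \in plane_exps ->
     dotv a (mi_vec (mi_of t0)) <= dotv a (mi_vec (mi_of t))) ->
  face_part f [set x | Gam x /\ dotv a x = dotv a (mi_vec (mi_of t0))] =
  fun x => \sum_(t in plane_exps | dotv a (mi_vec (mi_of t)) == dotv a (mi_vec (mi_of t0)))
     taylor_coef f (mi_of t) * monomial (mi_of t) x.
Proof.
move=> a0 t0A min0; have [lS faceS] := plane_exps_face a0 t0A min0.
set l := dotv a (mi_vec (mi_of t0)) in lS faceS *.
apply/funext => x.
pose A' := [pred t | (t \in plane_exps) && (dotv a (mi_vec (mi_of t)) == l)].
have memA' al : al \in [seq mi_of t | t <- enum A'] <->
    exists t, [/\ t \in plane_exps, dotv a (mi_vec (mi_of t)) = l & al = mi_of t].
  split.
    move=> /mapP[t]; rewrite mem_enum inE => /andP[tA /eqP tl] ->; by exists t.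
  move=> [t [tA tl ->]]; apply/mapP; exists t => //.
  by rewrite mem_enum inE tA tl eqxx.
rewrite /face_part (fsbigE [seq mi_of t | t <- enum A']).
- rewrite big_map big_enum_cond/=; apply: eq_bigl => t.
  rewrite inE; case: (boolP (t \in plane_exps)) => //= tA.
  case: eqP => //= tl; apply/asboolP; split=> //.
  by apply: newton_supp; have /plane_expsP[] := tA.
- by rewrite map_inj_uniq ?enum_uniq//; exact: mi_of_inj.
- move=> al /= /memA'[t [tA tl ->]]; split=> //.
  by apply: newton_supp; have /plane_expsP[] := tA.
- move=> al [Gal al_l] /negP nal; have [->|Sal] := eqVneq (taylor_coef f al) 0.
    by rewrite mul0r.
  case: nal; apply/memA'; have [t tA alE] := faceS al Sal al_l.
  by exists t; split=> //; rewrite -alE.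
Qed.

End Vertices.

(** * Partial derivatives along coordinate lines *)

Section Lines.
Context {R : realType} {n : nat}.
Implicit Types (x y : 'rV[R]_n) (i j : 'I_n) (f g : 'rV[R]_n -> R) (r s t u : R).

Definition upd x i s : 'rV[R]_n := \row_j (if j == i then s else x 0 j).

Definition cube r : set 'rV[R]_n := [set x | forall i, `|x 0 i| < r].

Lemma updE x i s j : upd x i s 0 j = if j == i then s else x 0 j.
Proof. by rewrite mxE. Qed.

Lemma upd_same x i : upd x i (x 0 i) = x.
Proof. by apply/rowP => j; rewrite updE; case: eqP => [->|]. Qed.

Lemma updC x i j s t : i != j -> upd (upd x i s) j t = upd (upd x j t) i s.
Proof.
move=> ij; apply/rowP => k; rewrite !updE.
by have [->|] := eqVneq k j; rewrite // eq_sym (negbTE ij).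
Qed.

Lemma cube_upd r x i s : cube r x -> `|s| < r -> cube r (upd x i s).
Proof. by move=> xr sr j; rewrite updE; case: eqP. Qed.

Lemma cube_le r r' x : r' <= r -> cube r' x -> cube r x.
Proof. by move=> rr xr i; apply: lt_le_trans rr. Qed.

Lemma cubeE r : 0 < r -> cube r = ball (0 : 'rV[R]_n) r.
Proof.
move=> r0; rewrite mx_norm_ball /ball_; apply/seteqP; split=> x /=.
  move=> xr; rewrite sub0r normrN.
  rewrite [ltLHS]/Num.norm/= mx_normrE bigmax_lt// => -[i k] _ /=.
  by rewrite ord1.
rewrite sub0r normrN => xr i; apply: le_lt_trans xr.
rewrite [leRHS]/Num.norm/= mx_normrE.
by apply: (le_trans _ (le_bigmax _ _ (0, i))).
Qed.

Lemma open_cube r : 0 < r -> open (cube r).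
Proof. by move=> r0; rewrite cubeE//; exact: ball_open. Qed.

Lemma near_cube (P : set 'rV[R]_n) :
  (\forall x \near (0 : 'rV[R]_n), P x) <-> exists2 r, 0 < r & cube r `<=` P.
Proof.
split=> [/nbhs_ballP[r r0 rP]|[r r0 rP]].
  by exists r => //; rewrite cubeE.
by apply/nbhs_ballP; exists r => //; rewrite -cubeE.
Qed.

Lemma is_derive_upd f x i s d :
  is_derive (upd x i s) (delta_mx 0 i) f d <->
  is_derive s 1 (fun u => f (upd x i u)) d.
Proof.
have E : (fun h : R => h^-1 *: ((f \o shift (upd x i s)) (h *: delta_mx 0 i) - f (upd x i s)))
       = (fun h : R => h^-1 *: (((fun u => f (upd x i u)) \o shift s) (h *: 1) - f (upd x i s))).
  apply/funext => h /=; congr (_ *: (f _ - _)); apply/rowP => j.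
  rewrite !mxE eqxx/= /GRing.scale/= mulr1; case: eqP => _; first by rewrite mulr1.
  by rewrite mulr0 add0r.
split=> -[D <-]; (apply: DeriveDef; first by move: D; rewrite /derivable E);
by rewrite /derive E.
Qed.

Lemma partial_local (U : set 'rV[R]_n) i f g x : open U -> U x ->
  (forall y, U y -> f y = g y) -> partial i f x = partial i g x.
Proof.
move=> oU Ux fg; apply: near_eq_derive.
by apply: filterS (open_nbhs_nbhs (conj oU Ux)).
Qed.

End Lines.

(** * One-variable Taylor bounds *)

Section OneVariable.
Context {R : realType}.
Implicit Types (r y z M C : R).

Lemma mvt_segment (g dg : R -> R) a b : a < b ->
  (forall y, a <= y <= b -> is_derive y 1 g (dg y)) ->
  exists2 c, a < c < b & g b - g a = dg c * (b - a).
Proof.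
move=> ab gd.
have gdo y : y \in `]a, b[ -> is_derive y 1 g (dg y).
  by rewrite in_itv/= => /andP[ay yb]; apply: gd; rewrite !ltW.
have gc : {within `[a, b], continuous g}.
  apply: derivable_within_continuous => y; rewrite in_itv/= => yab.
  by have [] := gd y yab.
by have [c] := MVT ab gdo gc; rewrite in_itv/= => cab E; exists c.
Qed.

Lemma mvt_bound (g dg : R -> R) z M :
  (forall y, `|y| <= `|z| -> is_derive y 1 g (dg y)) ->
  (forall y, `|y| <= `|z| -> `|dg y| <= M) ->
  `|g z - g 0| <= M * `|z|.
Proof.
move=> gd gM; have [z0|z0|<-] := ltgtP 0 z.
- have gd' y : 0 <= y <= z -> is_derive y 1 g (dg y).
    by move=> /andP[y1 y2]; apply: gd; rewrite !ger0_norm// ltW.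
  have [c /andP[c0 cz] ->] := mvt_segment z0 gd'.
  rewrite subr0 normrM ler_wpM2r// gM// !ger0_norm// ltW//.
- have gd' y : z <= y <= 0 -> is_derive y 1 g (dg y).
    by move=> /andP[y1 y2]; apply: gd; rewrite !ler0_norm ?lerN2// ltW.
  have [c /andP[cz c0] E] := mvt_segment z0 gd'.
  rewrite distrC E sub0r normrM normrN ler_wpM2r// gM// !ler0_norm ?lerN2// ltW//.
- by rewrite subrr normr0 mulr0.
Qed.

Lemma is_derive_exp (k : nat) z :
  is_derive z 1 (fun u : R => u ^+ k) (k%:R * z ^+ k.-1).
Proof.
have -> : (fun u : R => u ^+ k) = (@id R) ^+ k by apply/funext => u; rewrite exprfctE.
apply: (is_derive_eq (is_deriveX k (is_derive_id z (1 : R)))).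
by rewrite /GRing.scale/= mulr1.
Qed.

Lemma taylor1 (K : nat) (phi : nat -> R -> R) r C :
  (forall k y, (k < K)%N -> `|y| < r -> is_derive y 1 (phi k) (phi k.+1 y)) ->
  (forall y, `|y| < r -> `|phi K y| <= C) ->
  forall y, `|y| < r ->
  `|phi 0%N y - \sum_(k < K) phi k 0 * y ^+ k / (k`!)%:R| <= C * `|y| ^+ K.
Proof.
elim: K phi => [|K IH] phi dphi bphi y yr.
  by rewrite big_ord0 subr0 expr0 mulr1; exact: bphi.
pose g (z : R) := phi 0%N z - \sum_(k < K.+1) phi k 0 * z ^+ k / (k`!)%:R.
pose dg (z : R) := phi 1%N z - \sum_(k < K) phi k.+1 0 * z ^+ k / (k`!)%:R.
have g0 : g 0 = 0.
  rewrite /g big_ord_recl expr0 fact0 divr1 mulr1 big1 ?addr0 ?subrr// => k _.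
  by rewrite expr0n/= mulr0 mul0r.
have gd z : `|z| < r -> is_derive z 1 g (dg z).
  move=> zr.
  have h (k : 'I_K.+1) : is_derive z 1 (fun z : R => phi k 0 * z ^+ k / (k`!)%:R)
     (phi k 0 * (k%:R * z ^+ k.-1) / (k`!)%:R).
    have -> : (fun z : R => phi k 0 * z ^+ k / (k`!)%:R) =
        ((phi k 0 / (k`!)%:R) \*: (fun z : R => z ^+ k)).
      by apply/funext => u; rewrite /= /GRing.scale/= mulrAC.
    apply: is_derive_eq.
      by apply: is_deriveZ; exact: is_derive_exp.
    by rewrite /GRing.scale/= mulrAC.
  have -> : g = phi 0%N - \sum_(k < K.+1) (fun z : R => phi k 0 * z ^+ k / (k`!)%:R).
    by apply/funext => u; rewrite /g !fctE fct_sumE.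
  apply: (is_derive_eq (is_deriveB (dphi 0%N z erefl zr) (is_derive_sum h))).
  congr (_ - _); rewrite big_ord_recl/= mul0r mulr0 mul0r add0r.
  apply: eq_bigr => k _; rewrite /bump/= add1n/= factS natrM.
  field; rewrite nat1r.
  by rewrite pnatr_eq0 -lt0n fact_gt0 pnatr_eq0.
have zr z : `|z| <= `|y| -> `|z| < r by move=> /le_lt_trans; apply.
have := @mvt_bound g dg y (C * `|y| ^+ K).
rewrite g0 subr0 exprSr mulrA; apply => z zy; first exact/gd/zr.
apply: (le_trans (IH (fun k => phi k.+1) _ _ z (zr z zy))) => [k u kK ur|u ur|].
- exact: dphi.
- exact: bphi.
- rewrite ler_wpM2l//; last by rewrite lerXn2r// nnegrE.
  by apply: (le_trans (normr_ge0 (phi K.+1 y))); exact: bphi.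
Qed.

End OneVariable.

(** * Symmetry of iterated partial derivatives *)

Section Smooth.
Context {R : realType} {n : nat}.
Implicit Types (x y : 'rV[R]_n) (i j : 'I_n) (f g : 'rV[R]_n -> R) (r u : R).

Lemma continuous_cube g x (e : R) : {for x, continuous g} -> 0 < e ->
  exists2 d : R, 0 < d & forall p : 'rV[R]_n, (forall k, `|p 0 k - x 0 k| <= d) -> `|g p - g x| < e.
Proof.
move=> gc e0.
have /nbhs_ballP[d d0 dP] : \forall p \near x, `|g x - g p| < e.
  exact: (@cvgr_dist_lt _ _ _ _ _ g (g x) gc e e0).
exists (d / 2); first by rewrite divr_gt0.
move=> p px; rewrite distrC; apply: dP.
rewrite mx_norm_ball /ball_/= distrC; apply: le_lt_trans (_ : d / 2 < d).
  by apply: rV_norm_le => [|i]; [rewrite ltW// divr_gt0|rewrite !mxE px].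
by rewrite ltr_pdivrMr// ltr_pMr// ltr1n.
Qed.

Lemma half_dist_absurd (a b c : R) :
  `|c - a| < `|b - a| / 2 -> `|c - b| < `|b - a| / 2 -> False.
Proof.
move=> ca cb; have := ler_distD c b a; rewrite (distrC b c) leNgt => /negP; apply.
by rewrite [ltRHS]splitr ltrD.
Qed.

Lemma smooth_iter U f s : smooth_on U f -> smooth_on U (iter_partial s f).
Proof. by move=> sf t x Ux; rewrite /iter_partial -foldr_cat; exact: sf. Qed.

Lemma smooth_partial U f i : smooth_on U f -> smooth_on U (partial i f).
Proof. exact: (smooth_iter [:: i]). Qed.

Lemma smooth_continuous U f x : smooth_on U f -> U x -> {for x, continuous f}.
Proof. by move=> sf Ux; have [] := sf [::] x Ux. Qed.

Lemma smooth_is_derive U f x i u : smooth_on U f -> U (upd x i u) ->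
  is_derive u 1 (fun v => f (upd x i v)) (partial i f (upd x i u)).
Proof.
move=> sf Ux; apply/is_derive_upd; apply: DeriveDef => //.
by have [_] := sf [::] _ Ux; apply.
Qed.

(** The mixed second difference is symmetric in i and j up to exchanging its terms;
    comparing the two expressions for a small step gives the symmetry of second
    derivatives. *)
Lemma double_mvt f r x i j (h : R) : smooth_on (cube r) f -> i != j -> 0 < h ->
  (forall k, `|x 0 k| + h < r) ->
  exists2 p : 'rV[R]_n, (forall k, `|p 0 k - x 0 k| <= h) &
    f (upd (upd x i (x 0 i + h)) j (x 0 j + h)) - f (upd x i (x 0 i + h))
     - f (upd x j (x 0 j + h)) + f x = h * h * partial j (partial i f) p.
Proof.
move=> sf ij h0 xr.
have xc : cube r x by move=> k; apply: le_lt_trans (xr k); rewrite lerDl ltW.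
have near_r k u : x 0 k <= u <= x 0 k + h -> `|u| < r.
  move=> /andP[u1 u2]; apply: le_lt_trans (xr k).
  rewrite -[u](subrK (x 0 k)) addrC (le_trans (ler_normD _ _))// lerD2l.
  by rewrite ger0_norm ?subr_ge0// lerBlDl.
have hj : `|x 0 j + h| < r by apply: (near_r j); rewrite lexx lerDl ltW.
pose phi u := f (upd (upd x j (x 0 j + h)) i u) - f (upd x i u).
pose dphi u := partial i f (upd (upd x j (x 0 j + h)) i u) - partial i f (upd x i u).
have phid u : x 0 i <= u <= x 0 i + h -> is_derive u 1 phi (dphi u).
  move=> /near_r ur; apply: is_deriveB; apply: smooth_is_derive sf _;
    apply: cube_upd => //; exact: cube_upd.
have xh k : x 0 k < x 0 k + h by rewrite ltrDl.
have [c /andP[c1 c2] Ec] := mvt_segment (xh i) phid.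
have cr : `|c| < r by apply: (near_r i); rewrite !ltW.
pose psi v := partial i f (upd (upd x i c) j v).
have psid v : x 0 j <= v <= x 0 j + h ->
    is_derive v 1 psi (partial j (partial i f) (upd (upd x i c) j v)).
  move=> /near_r vr; apply: smooth_is_derive (smooth_partial i sf) _.
  by apply: cube_upd => //; exact: cube_upd.
have [d /andP[d1 d2] Ed] := mvt_segment (xh j) psid.
exists (upd (upd x i c) j d).
  move=> k; rewrite !updE; have [->|kj] := eqVneq k j.
    by rewrite ler_norml; apply/andP; split; lra.
  have [->|ki] := eqVneq k i; last by rewrite subrr normr0 ltW.
  by rewrite ler_norml; apply/andP; split; lra.
have E : dphi c = psi (x 0 j + h) - psi (x 0 j).
  rewrite /dphi /psi (updC _ _ _ ij); congr (_ - partial i f _).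
  by rewrite -[X in upd _ j X](_ : upd x i c 0 j = _) ?upd_same// updE eq_sym (negbTE ij).
have E' : upd (upd x j (x 0 j + h)) i (x 0 i) = upd x j (x 0 j + h).
  by rewrite -[X in upd _ i X](_ : upd x j (x 0 j + h) 0 i = _) ?upd_same// updE (negbTE ij).
move: Ec; rewrite E Ed /phi E' upd_same => Ec.
rewrite (updC _ _ _ ij).
have -> : h * h = (x 0 j + h - x 0 j) * (x 0 i + h - x 0 i) by ring.
rewrite mulrC mulrA -Ec; ring.
Qed.

Lemma partialC f r x i j : smooth_on (cube r) f -> cube r x ->
  partial i (partial j f) x = partial j (partial i f) x.
Proof.
move=> sf xr; have [->//|ij] := eqVneq i j.
apply/eqP/negPn/negP => AB.
set A := partial j (partial i f) in AB *; set B := partial i (partial j f) in AB *.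
have e0 : 0 < `|B x - A x| / 2 by rewrite divr_gt0// normr_gt0 subr_eq0.
have Ac : {for x, continuous A} by have [] := sf [:: j; i] x xr.
have Bc : {for x, continuous B} by have [] := sf [:: i; j] x xr.
have [d1 d10 d1P] := continuous_cube Ac e0.
have [d2 d20 d2P] := continuous_cube Bc e0.
have [h [h0 hr hd1 hd2]] : exists h : R, [/\ 0 < h, forall k, `|x 0 k| + h < r,
    h <= d1 & h <= d2].
  have H : \forall h \near (0 : R)^'+, forall k, `|x 0 k| + h < r.
    apply: filter_forall => k; near=> h; rewrite -ltrBrDl; near: h.
    by apply: nbhs_right_lt; rewrite subr_gt0.
  near (0 : R)^'+ => h; exists h; split=> //; first by near: h.
    by near: h; apply: nbhs_right_le.
  by near: h; apply: nbhs_right_le.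
have [p px Ep] := double_mvt sf ij h0 hr.
have ji : j != i by rewrite eq_sym.
have [q qx Eq] := double_mvt sf ji h0 hr.
have ApBq : A p = B q.
  have : h * h * A p = h * h * B q.
    apply: etrans (esym Ep) _; apply: etrans _ Eq.
    by rewrite (updC _ _ _ ij) (addrAC (f _)).
  by apply: mulfI; rewrite mulf_neq0// gt_eqF.
have hA : `|A p - A x| < `|B x - A x| / 2 by apply: d1P => k; exact: le_trans (px k) hd1.
have hB : `|B q - B x| < `|B x - A x| / 2 by apply: d2P => k; exact: le_trans (qx k) hd2.
by apply: (half_dist_absurd hA); rewrite ApBq.
Unshelve. all: by end_near. Qed.

Lemma partial_iterC f r x i s : smooth_on (cube r) f -> 0 < r -> cube r x ->
  partial i (iter_partial s f) x = iter_partial s (partial i f) x.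
Proof.
move=> sf r0; elim: s x => [//|j s IH] x xr /=.
rewrite (partialC _ _ (smooth_iter s sf) xr).
by apply: (partial_local _ (open_cube r0)).
Qed.

Lemma iter_iterC f r x s t : smooth_on (cube r) f -> 0 < r -> cube r x ->
  iter_partial s (iter_partial t f) x = iter_partial t (iter_partial s f) x.
Proof.
move=> sf r0; elim: s x => [//|j s IH] x xr /=.
rewrite -(partial_iterC _ _ (smooth_iter s sf))//.
by apply: (partial_local _ (open_cube r0)).
Qed.

Lemma iter_partial_perm f r x s t : smooth_on (cube r) f -> 0 < r -> cube r x ->
  perm_eq s t -> iter_partial s f x = iter_partial t f x.
Proof.
move=> sf r0 xr st; pose P (u : seq 'I_n) := iter_partial s f x = iter_partial u f x.
apply: (@catCA_perm_ind _ P _ _ _ st); rewrite /P// => s1 s2 s3 ->.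
rewrite /iter_partial !foldr_cat -!/(iter_partial _ _).
exact: iter_iterC (smooth_iter s3 sf) _ _.
Qed.

Lemma smooth_bounded f r r' : smooth_on (cube r) f -> 0 < r' -> r' < r ->
  exists2 C : R, 0 <= C & forall x, cube r' x -> `|f x| <= C.
Proof.
move=> sf r'0 r'r.
pose K := [set x : 'rV[R]_n | forall i, x 0 i \in `[- r', r']].
have Kr x : K x -> cube r x.
  move=> Kx i; apply: le_lt_trans r'r; have := Kx i.
  by rewrite in_itv/= ler_norml.
have cK : compact K.
  apply: (@rV_compact _ _ (fun=> `[- r', r']%classic)).
  by move=> _; exact: segment_compact.
have fK : {within K, continuous f}.
  apply: continuous_in_subspaceT => x; rewrite inE => /Kr xr.
  exact: smooth_continuous sf xr.
have [M [_ MP]] := compact_bounded (continuous_compact fK cK).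
exists (Num.max 0 (M + 1)); first by rewrite le_max lexx.
move=> x xr; rewrite le_max; apply/orP; right.
apply: (MP (M + 1)); first by rewrite ltrDl.
exists x => // i; rewrite in_itv/= -ler_norml ltW//; exact: xr.
Qed.

End Smooth.

(** * Taylor expansion in some of the variables *)

Section Taylor.
Context {R : realType} {n N' : nat}.
Local Notation N := N'.+1.
Local Notation mi := {ffun 'I_n -> nat}.
Local Notation B := {ffun 'I_n -> 'I_N}.
Implicit Types (x y : 'rV[R]_n) (i j : 'I_n) (f g : 'rV[R]_n -> R) (r : R).
Implicit Types (al be : mi) (b : B) (s : seq 'I_n).

Definition diffs s al : seq 'I_n := flatten [seq nseq (al i) i | i <- s].

Definition mfact al : nat := (\prod_i (al i)`!)%N.

(** The Taylor coefficients in the variables of s, as functions of all variables;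
    the order of differentiation follows s, so that for the enumeration of all
    indices this is the definition of taylor_coef. *)
Definition tcoef s f al y : R := iter_partial (diffs s al) f y / (mfact al)%:R.

Definition zero_on s x : 'rV[R]_n := \row_j (if j \in s then 0 else x 0 j).

Definition iset al i k : mi := [ffun j => if j == i then k else al j].

Definition bset b i (k : 'I_N) : B := [ffun j => if j == i then k else b j].

Definition supported s b := [forall j, (j \notin s) ==> (b j == ord0)].

Lemma supportedP s b : reflect (forall j, j \notin s -> b j = ord0) (supported s b).
Proof.
apply: (iffP forallP) => h j; first by move=> js; apply/eqP; have := h j; rewrite js.
by apply/implyP => /h ->.
Qed.

Lemma mi_of_bset b i k : mi_of (bset b i k) = iset (mi_of b) i k.
Proof. by apply/ffunP => j; rewrite !ffunE; case: eqP. Qed.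

Lemma sum_supported_cons (V : zmodType) s i (F : B -> V) : i \notin s ->
  \sum_(b | supported (i :: s) b) F b =
  \sum_(b | supported s b) \sum_k F (bset b i k).
Proof.
move=> is_; rewrite (partition_big (fun b => bset b i ord0) (supported s)); last first.
  move=> b /supportedP h; apply/supportedP => j js; rewrite ffunE.
  by case: eqP => // /eqP ji; apply: h; rewrite inE negb_or ji.
apply: eq_bigr => b /supportedP bs.
rewrite (reindex_onto (fun k => bset b i k) (fun b => b i)); last first.
  move=> b' /andP[_ /eqP <-]; apply/ffunP => j; rewrite !ffunE.
  by case: eqP => [->|].
apply: eq_bigl => k.
have -> : bset (bset b i k) i ord0 = b.
  by apply/ffunP => j; rewrite !ffunE; case: eqP => // ->; rewrite bs.
have -> : bset b i k i = k by rewrite ffunE eqxx.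
rewrite !eqxx !andbT; apply/supportedP => j.
by rewrite inE negb_or ffunE => /andP[/negbTE -> js]; exact: bs.
Qed.

Lemma monomial_iset al i k x : al i = 0%N ->
  monomial (iset al i k) x = monomial al x * x 0 i ^+ k.
Proof.
move=> ali; rewrite /monomial (bigD1 i)//= [in RHS](bigD1 i)//= ali expr0 mul1r.
rewrite ffunE eqxx mulrC; congr (_ * _); apply: eq_bigr => j /negbTE ji.
by rewrite ffunE ji.
Qed.

Lemma mfact_iset al i k : al i = 0%N -> mfact (iset al i k) = (mfact al * k`!)%N.
Proof.
move=> ali; rewrite /mfact (bigD1 i)//= [in RHS](bigD1 i)//= ali fact0 mul1n.
rewrite ffunE eqxx mulnC; congr (_ * _)%N; apply: eq_bigr => j /negbTE ji.
by rewrite ffunE ji.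
Qed.

Lemma mfact_gt0 al : (0 < mfact al)%N.
Proof. by apply: prodn_gt0 => i; exact: fact_gt0. Qed.

Lemma diffs_iset s al i k : i \notin s -> diffs s (iset al i k) = diffs s al.
Proof.
move=> is_; congr flatten; apply/eq_in_map => j js; rewrite ffunE.
by case: eqP => // ji; move: is_; rewrite -ji js.
Qed.

Lemma monomial_le1 al x : cube 1 x -> `|monomial al x| <= 1.
Proof.
move=> x1; rewrite normr_monomial; apply: prodr_ile1 => // i _.
by rewrite exprn_ge0//= exprn_ile1// ltW.
Qed.

Lemma upd_zero_on s i x : upd (zero_on s x) i 0 = zero_on (i :: s) x.
Proof. by apply/rowP => j; rewrite !mxE inE; case: eqP. Qed.

Lemma cube_zero_on s r x : cube r x -> cube r (zero_on s x).
Proof.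
move=> xr j; rewrite mxE; case: ifP => // _; rewrite normr0.
exact: le_lt_trans (normr_ge0 _) (xr j).
Qed.

Lemma taylor_direction f r r' i : smooth_on (cube r) f -> 0 < r' -> r' < r ->
  exists2 C : R, 0 <= C & forall y, cube r' y ->
   `|f y - \sum_(k < N) iter_partial (nseq k i) f (upd y i 0) * y 0 i ^+ k / (k`!)%:R|
     <= C * `|y 0 i| ^+ N.
Proof.
move=> sf r'0 r'r.
have [C C0 CP] := smooth_bounded (smooth_iter (nseq N i) sf) r'0 r'r.
exists C => // y yr.
have := @taylor1 R N (fun k u => iter_partial (nseq k i) f (upd y i u)) r' C.
rewrite /= => /(_ _ _ (y 0 i) (yr i)); rewrite upd_same; apply.
- move=> k u kN ur; apply: smooth_is_derive (smooth_iter _ sf) _.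
  by apply: (cube_le (ltW r'r)); exact: cube_upd.
- by move=> u ur; apply: CP; exact: cube_upd.
Qed.

(** The variables of s are expanded one after the other. Each remainder is bounded
    by a power of a single variable, so it need not be expanded further. *)
Lemma taylor_multi s f r r' : uniq s -> smooth_on (cube r) f ->
  0 < r' -> r' < r -> r' <= 1 ->
  exists2 C : R, 0 <= C & forall x, cube r' x ->
   `|f x - \sum_(b | supported s b) monomial (mi_of b) x * tcoef s f (mi_of b) (zero_on s x)|
   <= C * \sum_(i <- s) `|x 0 i| ^+ N.
Proof.
move=> + sf r'0 r'r r'1; elim: s => [_|i s IH /andP[is_ /IH[C C0 CP]]].
  exists 0 => // x xr; rewrite big_nil mulr0.
  rewrite (big_pred1 [ffun => ord0]); last first.
    move=> b; apply/supportedP/eqP => [h|->]; last by move=> j _; rewrite ffunE.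
    by apply/ffunP => j; rewrite ffunE h.
  have -> : monomial (mi_of ([ffun => ord0] : B)) x = 1.
    by rewrite /monomial big1// => j _; rewrite !ffunE.
  have E1 : mfact (mi_of ([ffun => ord0] : B)) = 1%N.
    by rewrite /mfact big1// => j _; rewrite !ffunE.
  rewrite /tcoef /diffs E1/=.
  rewrite divr1 mul1r (_ : zero_on [::] x = x) ?subrr ?normr0//.
  by apply/rowP => j; rewrite mxE.
have h b : exists D, 0 <= D /\ forall y, cube r' y ->
    `|iter_partial (diffs s (mi_of b)) f y - \sum_(k < N)
      iter_partial (nseq k i) (iter_partial (diffs s (mi_of b)) f) (upd y i 0)
        * y 0 i ^+ k / (k`!)%:R| <= D * `|y 0 i| ^+ N.
  have [D D0 DP] := @taylor_direction _ r r' i (smooth_iter (diffs s (mi_of b)) sf) r'0 r'r.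
  by exists D.
have [D DP] := choice h.
exists (C + \sum_b D b).
  by rewrite addr_ge0// sumr_ge0// => b _; have [] := DP b.
move=> x xr; set y := zero_on s x.
have yr : cube r' y by exact: cube_zero_on.
have yi : y 0 i = x 0 i by rewrite mxE (negbTE is_).
pose T b := \sum_(k < N)
      iter_partial (nseq k i) (iter_partial (diffs s (mi_of b)) f) (upd y i 0)
        * y 0 i ^+ k / (k`!)%:R.
have -> : \sum_(b | supported (i :: s) b) monomial (mi_of b) x *
     tcoef (i :: s) f (mi_of b) (zero_on (i :: s) x) =
   \sum_(b | supported s b) monomial (mi_of b) x * (T b / (mfact (mi_of b))%:R).
  rewrite sum_supported_cons//; apply: eq_bigr => b /supportedP bs.
  have bi : mi_of b i = 0%N by rewrite ffunE bs.
  rewrite /T mulr_suml mulr_sumr; apply: eq_bigr => k _.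
  rewrite mi_of_bset monomial_iset// /tcoef mfact_iset// natrM.
  have -> : diffs (i :: s) (iset (mi_of b) i k) = nseq k i ++ diffs s (mi_of b).
    by rewrite /diffs/= -!/(diffs _ _) diffs_iset// ffunE eqxx.
  rewrite /iter_partial foldr_cat yi upd_zero_on invfM; ring.
have E : f x - \sum_(b | supported s b) monomial (mi_of b) x * (T b / (mfact (mi_of b))%:R)
  = (f x - \sum_(b | supported s b) monomial (mi_of b) x * tcoef s f (mi_of b) y) +
    \sum_(b | supported s b) monomial (mi_of b) x / (mfact (mi_of b))%:R *
       (iter_partial (diffs s (mi_of b)) f y - T b).
  rewrite -addrA; congr (_ + _); rewrite -sumrN -[X in X + _]sumrN -big_split/=.
  by apply: eq_bigr => b _; rewrite /tcoef; ring.
rewrite E big_cons; apply: (le_trans (ler_normD _ _)).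
have le1 : `|f x - \sum_(b | supported s b) monomial (mi_of b) x * tcoef s f (mi_of b) y|
    <= C * \sum_(j <- s) `|x 0 j| ^+ N by exact: CP.
have sN0 : 0 <= \sum_(j <- s) `|x 0 j| ^+ N by apply: sumr_ge0 => j _; rewrite exprn_ge0.
have le2 : `|\sum_(b | supported s b) monomial (mi_of b) x / (mfact (mi_of b))%:R *
       (iter_partial (diffs s (mi_of b)) f y - T b)| <= (\sum_b D b) * `|x 0 i| ^+ N.
  apply: (le_trans (ler_norm_sum _ _ _)).
  rewrite mulr_suml big_mkcond; apply: ler_sum => b _.
  have [Db0 DbP] := DP b.
  have Db : 0 <= D b * `|x 0 i| ^+ N by rewrite mulr_ge0// exprn_ge0.
  case: ifP => // _; rewrite -[leRHS]mul1r normrM ler_pM//.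
    rewrite normrM normfV normr_nat ler_pdivrMr ?ltr0n ?mfact_gt0// mul1r.
    apply: (le_trans (monomial_le1 _ (cube_le r'1 xr))).
    by rewrite ler1n mfact_gt0.
  by rewrite -yi; exact: DbP.
apply: (le_trans (lerD le1 le2)).
have Dsum0 : 0 <= \sum_b D b by rewrite sumr_ge0// => b _; have [] := DP b.
have xi0 : 0 <= `|x 0 i| ^+ N by rewrite exprn_ge0.
rewrite mulrDl !mulrDr addrA.
rewrite [leLHS]addrC -addrA [leRHS]addrC.
have : 0 <= C * `|x 0 i| ^+ N by rewrite mulr_ge0.
have : 0 <= (\sum_b D b) * \sum_(j <- s) `|x 0 j| ^+ N by rewrite mulr_ge0.
move: (_ * _) (_ * _) (_ * _) (_ * _) => p1 p2 p3 p4; lra.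
Qed.

End Taylor.

(** * Sums of real powers *)

Section PowerSums.
Context {R : realType} {T : finType}.
Variables (e c : T -> R) (l M : R).

Lemma power_sum_min0 (P : pred T) (b0 : T) : P b0 ->
  (forall b, P b -> e b0 <= e b) -> e b0 < l ->
  (\forall t \near (0 : R)^'+, `|\sum_(b | P b) c b * t `^ e b| <= M * t `^ l) ->
  \sum_(b | P b && (e b == e b0)) c b = 0.
Proof.
move=> Pb0 emin el H; set g := \sum_(b | _) c b.
have hg : (fun t : R => \sum_(b | P b) c b * t `^ (e b - e b0)) @ (0 : R)^'+ --> g.
  rewrite /g big_mkcondr; apply: cvg_sumr => b Pb; case: eqP => [->|/eqP eb].
    by under eq_fun do rewrite subrr powRr0 mulr1; exact: cvg_cst.
  rewrite -[X in _ --> X](mulr0 (c b)); apply: cvgM; first exact: cvg_cst.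
  by apply: powR_cvg0; rewrite subr_gt0 lt_neqAle eq_sym eb emin.
have hM : (fun t : R => M * t `^ (l - e b0)) @ (0 : R)^'+ --> (0 : R).
  rewrite -[X in _ --> X](mulr0 M); apply: cvgM; first exact: cvg_cst.
  by apply: powR_cvg0; rewrite subr_gt0.
apply/eqP; rewrite -normr_le0.
apply: (ler_cvg_to (cvg_norm hg) hM).
near=> t.
have t0 : 0 < t by [].
have te : 0 < t `^ e b0 by rewrite powR_gt0.
rewrite -(ler_pM2r te) -mulrA -powRD ?subrK; last by rewrite (gt_eqF t0) implybT.
rewrite -[X in `|_| * X](gtr0_norm te) -normrM mulr_suml.
under eq_bigr => b Pb do rewrite -mulrA -powRD ?subrK ?(gt_eqF t0) ?implybT//.
by near: t.
Unshelve. all: by end_near. Qed.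

(** Divide by the smallest power, as long as its exponent is below l, and let t tend
    to 0: the group of terms with that exponent sums to 0 and can be removed. *)
Lemma power_sum_level0 (P : pred T) :
  (\forall t \near (0 : R)^'+, `|\sum_(b | P b) c b * t `^ e b| <= M * t `^ l) ->
  forall s, s < l -> \sum_(b | P b && (e b == s)) c b = 0.
Proof.
move: {2}(#|P|) (leqnn #|P|) => k; elim: k P => [|k IH] P Pk H s sl.
  apply: big_pred0 => b; move: Pk; rewrite leqn0 => /eqP/card0_eq/(_ b).
  by rewrite unfold_in => ->.
have [b1 Pb1|P0] := pickP P; last by apply: big_pred0 => b; rewrite P0.
case: (@arg_minP _ _ _ b1 P e Pb1) => b0 Pb0 emin.
have [el|le] := ltP (e b0) l; last first.
  apply: big_pred0 => b; apply/negbTE/negP => /andP[Pb /eqP eb].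
  have := lt_le_trans sl (le_trans le (emin b Pb)).
  by rewrite eb ltxx.
have g0 := power_sum_min0 Pb0 emin el H.
have [->//|es] := eqVneq s (e b0).
pose P' := [pred b | P b && (e b != e b0)].
have := IH P' _ _ s sl; rewrite (eq_bigl (fun b => P b && (e b == s))); last first.
  move=> b /=; rewrite -andbA; congr andb; case: (e b =P s) => [->|]; last by rewrite andbF.
  by rewrite es.
apply.
  rewrite -ltnS; apply: leq_trans Pk; apply/proper_card/fintype.properP; split.
    by apply/fintype.subsetP => b; rewrite !unfold_in => /andP[].
  by exists b0; rewrite !unfold_in ?Pb0// eqxx.
near=> t.
have t0 : 0 < t by [].
have -> : \sum_(b | P' b) c b * t `^ e b = \sum_(b | P b) c b * t `^ e b.
  rewrite [RHS](bigID (fun b => e b == e b0))/= [X in X + _](_ : _ = 0) ?add0r//.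
  rewrite (eq_bigr (fun b => c b * t `^ e b0)); last by move=> b /andP[_ /eqP ->].
  by rewrite -mulr_suml g0 mul0r.
by near: t.
Unshelve. all: by end_near. Qed.

End PowerSums.

(** * Expansion of f and of its logarithmic derivatives *)

Section Expansion.
Context {R : realType} {n N' : nat}.
Local Notation N := N'.+1.
Local Notation mi := {ffun 'I_n -> nat}.
Local Notation B := {ffun 'I_n -> 'I_N}.
Variables (f : 'rV[R]_n -> R) (r0 : R) (I : {set 'I_n}).
Implicit Types (x y w : 'rV[R]_n) (i j : 'I_n) (al be : mi) (b : B).

Hypothesis r0_gt0 : 0 < r0.
Hypothesis sf : smooth_on (cube r0) f.

Let s := enum I.
Local Notation A := (@plane_exps R n f N I).

Definition slice_coef b y : R := tcoef s f (mi_of b) (zero_on s y).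

Definition newton_gauge x : R := \sum_(t in A) `|monomial (mi_of t) x|.

Lemma expansion_function : exists r1 C, [/\ 0 < r1, r1 < r0, r1 <= 1, 0 <= C &
  forall x, cube r1 x ->
  `|f x - \sum_(b | supported s b) monomial (mi_of b) x * slice_coef b x| <=
    C * \sum_(i in I) `|x 0 i| ^+ N].
Proof.
pose r1 := Num.min (r0 / 2) 1.
have r10 : 0 < r1 by rewrite lt_min divr_gt0/=.
have r1r : r1 < r0.
  by apply: (@le_lt_trans _ _ (r0 / 2)); rewrite ?ge_min ?lexx// ltr_pdivrMr// ltr_pMr// ltr1n.
have r11 : r1 <= 1 by rewrite ge_min lexx orbT.
have [C C0 CP] := @taylor_multi R n N' s f r0 r1 (enum_uniq _) sf r10 r1r r11.
exists r1, C; split=> // x xr; rewrite -[X in C * X]big_enum/=; exact: CP.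
Qed.

(** With i at the head of the list of variables, the series for
    x_i d_i f is that of f shifted by one in the degree of x_i; the two sums differ
    by a top term, which is of the size of the remainder, and by a term of degree
    0, which has weight 0. *)
Lemma expansion_partial i : i \in I -> exists r1 C, [/\ 0 < r1, r1 < r0, r1 <= 1, 0 <= C &
  forall x, cube r1 x ->
  `|x 0 i * partial i f x
     - \sum_(b | supported s b) (b i)%:R * (monomial (mi_of b) x * slice_coef b x)| <=
    C * \sum_(j in I) `|x 0 j| ^+ N].
Proof.
move=> iI.
pose t := rem i s.
have is_ : i \in s by rewrite mem_enum.
have pst : perm_eq s (i :: t) by exact: perm_to_rem.
have mst j : (j \in i :: t) = (j \in s) by rewrite (perm_mem pst).
have zst x : zero_on s x = zero_on (i :: t) x.
  by apply/rowP => j; rewrite !mxE mst.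
have sst b : supported s b = supported (i :: t) b.
  by apply: eq_forallb => j; rewrite mst.
have := enum_uniq I; rewrite -/s (perm_uniq pst) => uit.
have /andP[it ut] := uit.
pose r1 := Num.min (r0 / 2) 1.
have r10 : 0 < r1 by rewrite lt_min divr_gt0/=.
have r1r : r1 < r0.
  by apply: (@le_lt_trans _ _ (r0 / 2)); rewrite ?ge_min ?lexx// ltr_pdivrMr// ltr_pMr// ltr1n.
have r11 : r1 <= 1 by rewrite ge_min lexx orbT.
have [C C0 CP] := @taylor_multi R n N' (i :: t) (partial i f) r0 r1 uit
  (smooth_partial i sf) r10 r1r r11.
pose h b k := iter_partial (nseq k i ++ diffs t (mi_of b)) f.
have hb b : exists D, 0 <= D /\ forall y, cube r1 y -> `|h b N y| <= D.
  have [D D0 DP] := smooth_bounded (smooth_iter (nseq N i ++ diffs t (mi_of b)) sf) r10 r1r.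
  by exists D.
have [D DP] := choice hb.
exists r1, (C + \sum_b D b); split=> //.
  by rewrite addr_ge0// sumr_ge0// => b _; have [] := DP b.
move=> x xr.
have xr0 : cube r0 x by apply: cube_le xr; exact: ltW.
set z := zero_on s x.
have zr : cube r1 z by exact: cube_zero_on.
have zr0 : cube r0 z by exact: cube_zero_on.
pose G b k : R := monomial (mi_of b) x * x 0 i ^+ k * k%:R * h b k z /
   ((mfact (mi_of b))%:R * (k`!)%:R).
have E1 : \sum_(b | supported s b) (b i)%:R * (monomial (mi_of b) x * slice_coef b x) =
  \sum_(b | supported t b) \sum_(k < N) G b k.
  rewrite (eq_bigl _ _ sst) sum_supported_cons//; apply: eq_bigr => b /supportedP bt.
  have bi : mi_of b i = 0%N by rewrite ffunE bt.
  apply: eq_bigr => k _; rewrite mi_of_bset monomial_iset// /slice_coef mi_of_bset /tcoef mfact_iset//.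
  rewrite (_ : bset b i k i = k) ?ffunE ?eqxx// natrM /G.
  rewrite (@iter_partial_perm _ _ f r0 z (diffs s _) (nseq k i ++ diffs t (mi_of b)))//.
    by rewrite -/(h b k); ring.
  rewrite /diffs; apply: (perm_trans (perm_flatten (perm_map _ pst))) => /=.
  by rewrite ffunE eqxx -!/(diffs _ _) diffs_iset.
have E2 : x 0 i * (\sum_(b : B | supported (i :: t) b) monomial (mi_of b) x *
     tcoef (i :: t) (partial i f) (mi_of b) (zero_on (i :: t) x)) =
  \sum_(b | supported t b) \sum_(k < N) G b k.+1.
  rewrite sum_supported_cons// mulr_sumr; apply: eq_bigr => b /supportedP bt.
  have bi : mi_of b i = 0%N by rewrite ffunE bt.
  rewrite mulr_sumr; apply: eq_bigr => k _.
  rewrite mi_of_bset monomial_iset// /tcoef mfact_iset// natrM -zst -/z /G factS natrM.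
  have -> : diffs (i :: t) (iset (mi_of b) i k) = nseq k i ++ diffs t (mi_of b).
    by rewrite /diffs/= -!/(diffs _ _) diffs_iset// ffunE eqxx.
  have -> : iter_partial (nseq k i ++ diffs t (mi_of b)) (partial i f) z = h b k.+1 z.
    rewrite -[partial i f]/(iter_partial [:: i] f) /iter_partial -foldr_cat.
    apply: (@iter_partial_perm _ _ f r0 z) => //.
    by rewrite perm_catC.
  rewrite exprS -/(h b k.+1); field.
  by rewrite !nat1r !pnatr_eq0 -!lt0n mfact_gt0 fact_gt0.
have E3 : x 0 i * partial i f x
     - \sum_(b | supported s b) (b i)%:R * (monomial (mi_of b) x * slice_coef b x) =
   x 0 i * (partial i f x - \sum_(b : B | supported (i :: t) b) monomial (mi_of b) x *
     tcoef (i :: t) (partial i f) (mi_of b) (zero_on (i :: t) x)) +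
   \sum_(b | supported t b) G b N.
  rewrite mulrBr E1 E2 -addrA; congr (_ + _).
  rewrite -sumrN -sumrN -big_split/=; apply: eq_bigr => b _.
  rewrite -[X in _ + X]addr0 -[X in _ = X](addrK (\sum_(k < N) G b k)).
  rewrite [X in _ = X - _](_ : _ = 0) ?sub0r ?addr0//.
  rewrite -addrA [X in _ + X](_ : _ = \sum_(k < N) G b k.+1) ?addNr//.
  rewrite addrC -(big_ord_recr _ (fun k => G b k))/= big_ord_recl.
  by rewrite {1}/G/= mulr0 !mul0r add0r.
rewrite E3; apply: (le_trans (ler_normD _ _)); rewrite mulrDl; apply: lerD.
  rewrite normrM -[leRHS]mul1r ler_pM//.
    by apply: le_trans r11; rewrite ltW.
  by rewrite -[X in C * X]big_enum/= -/s (perm_big _ pst); exact: CP.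
apply: (le_trans (ler_norm_sum _ _ _)).
rewrite mulr_suml big_mkcond; apply: ler_sum => b _.
have [Db0 DbP] := DP b.
have S0 : 0 <= \sum_(j in I) `|x 0 j| ^+ N by apply: sumr_ge0 => j _; rewrite exprn_ge0.
have Db : 0 <= D b * \sum_(j in I) `|x 0 j| ^+ N by rewrite mulr_ge0.
case: ifP => // _.
have -> : G b N = monomial (mi_of b) x / ((mfact (mi_of b))%:R * (N'`!)%:R) *
     (h b N z * x 0 i ^+ N).
  rewrite /G factS natrM; field.
  by rewrite !nat1r !pnatr_eq0 -!lt0n mfact_gt0 fact_gt0.
rewrite -[leRHS]mul1r normrM ler_pM//.
  rewrite normrM normfV -natrM normr_nat ler_pdivrMr ?ltr0n ?muln_gt0 ?mfact_gt0 ?fact_gt0//.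
  rewrite mul1r; apply: (le_trans (monomial_le1 _ (cube_le r11 xr))).
  by rewrite ler1n muln_gt0 mfact_gt0 fact_gt0.
rewrite normrM ler_pM// ?DbP// normrX (bigD1 i)//= lerDl.
by apply: sumr_ge0 => j _; rewrite exprn_ge0.
Qed.

End Expansion.

(** * Coefficients killed by the existence of the dilation limits *)

Section Vanishing.
Context {R : realType} {n N' : nat}.
Local Notation N := N'.+1.
Local Notation mi := {ffun 'I_n -> nat}.
Local Notation B := {ffun 'I_n -> 'I_N}.
Variables (f : 'rV[R]_n -> R) (r0 : R) (I : {set 'I_n}) (nu : 'I_n -> nat).
Implicit Types (x y w a : 'rV[R]_n) (i j : 'I_n) (al be : mi) (b : B).

Hypothesis r0_gt0 : 0 < r0.
Hypothesis sf : smooth_on (cube r0) f.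
Hypothesis box : forall al, supp f al ->
  exists2 b : B, supp f (mi_of b) & forall i, (b i <= al i)%N.
Hypothesis S_neq0 : supp f !=set0.
Hypothesis pc : partially_convenient_with f I nu.
Hypothesis nu_le : forall i, i \in I -> (nu i <= N')%N.
Hypothesis KN : KN_condition f.

Let s := enum I.
Local Notation A := (@plane_exps R n f N I).
Local Notation coef := (@slice_coef R n N' f I).
Local Notation gauge := (@newton_gauge R n N' f I).

Definition dominated b := forall x, torus x -> cube 1 x ->
  `|monomial (mi_of b) x| <= gauge x.

Lemma powR_sum (t : R) (F : 'I_n -> R) : 0 < t ->
  t `^ (\sum_i F i) = \prod_i t `^ F i.
Proof.
move=> t0; apply: (big_morph (fun e => t `^ e)) => [e1 e2|]; last exact: powRr0.
by rewrite powRD// (gt_eqF t0) implybT.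
Qed.

Lemma monomial_dilation a t w al : 0 < t ->
  monomial al (dilation a t w) = t `^ dotv a (mi_vec al) * monomial al w.
Proof.
move=> t0; rewrite /dotv powR_sum// /monomial -big_split/=; apply: eq_bigr => i _.
by rewrite !mxE exprMn powRrM powR_mulrn// powR_ge0.
Qed.

Lemma supported_enumP b : supported s b -> forall j, j \notin I -> b j = ord0.
Proof. by move=> /supportedP h j jI; apply: h; rewrite mem_enum. Qed.

Lemma eq_coef b x y : (forall j, j \notin I -> x 0 j = y 0 j) -> coef b x = coef b y.
Proof.
move=> xy; suff E : zero_on (enum I) x = zero_on (enum I) y by rewrite /slice_coef E.
by apply/rowP => j; rewrite !mxE mem_enum; case: ifPn => // /xy.
Qed.

(** Taking logarithms, a point where the monomial exceeds the gauge is a weight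
    vector separating its exponent from the exponents of the gauge. *)
Lemma log_separation b : supported s b -> ~ dominated b -> exists a,
  [/\ forall i, i \in I -> 0 < a 0 i, forall i, i \notin I -> a 0 i = 0 &
      forall t, t \in A -> dotv a (mi_vec (mi_of b)) < dotv a (mi_vec (mi_of t))].
Proof.
move=> sb nd.
have [x [x0 x1 xm]] : exists x, [/\ torus x, cube 1 x &
    gauge x < `|monomial (mi_of b) x|].
  apply: contrapT => h; apply: nd => x x0 x1; rewrite leNgt; apply/negP => xm.
  by apply: h; exists x.
pose a : 'rV[R]_n := \row_i (if i \in I then - ln `|x 0 i| else 0).
have aE (t : B) : (forall j, j \notin I -> t j = 0%N :> nat) ->
    dotv a (mi_vec (mi_of t)) = dotv (logv x) (mi_vec (mi_of t)).
  move=> tI; apply: eq_bigr => i _; rewrite [a _ _]mxE [logv x _ _]mxE.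
  by case: ifPn => // /tI; rewrite mi_vec_mi_of => ->; rewrite !mulr0.
exists a; split=> [i iI|i /negbTE iI|t tA]; rewrite ?mxE ?iI//.
  by rewrite oppr_gt0 ln_lt0// normr_gt0 x0 x1.
have /(plane_expsP _ _ _)[_ tI] := tA.
rewrite !aE//; last by move=> j /(supported_enumP sb) ->.
rewrite -ltrN2 -ltr_expR -!norm_monomial_exp//.
by apply: le_lt_trans xm; rewrite /newton_gauge (bigD1 t)//= lerDl sumr_ge0.
Qed.

Section Bad.
Variables (a : 'rV[R]_n) (b : B).
Hypothesis sb : supported s b.
Hypothesis a_gt0 : forall i, i \in I -> 0 < a 0 i.
Hypothesis a_eq0 : forall i, i \notin I -> a 0 i = 0.
Hypothesis ab : forall t, t \in A ->
  dotv a (mi_vec (mi_of b)) < dotv a (mi_vec (mi_of t)).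

Let a_ge0 i : 0 <= a 0 i.
Proof. by have [/a_gt0/ltW|/a_eq0 ->] := boolP (i \in I). Qed.

Let e b' := dotv a (mi_vec (mi_of b')).

(** Along the dilations the expansion of f becomes a finite sum of powers of t, which
    is O(t^l) because f(t^a x) / t^l converges. The weight of b being less than l,
    the terms of that weight cancel. The remainder does not interfere: as
    nu_i e_i is an exponent of f, l is at most N times every a_i with i in I. *)
Lemma level_vanishing : exists2 r : R, 0 < r & forall w, cube r w ->
  \sum_(b' | supported s b' && (e b' == e b)) monomial (mi_of b') w * coef b' w = 0.
Proof.
have [t0 t0A lS] := plane_exps_min box S_neq0 pc a_ge0.
set l := dotv a (mi_vec (mi_of t0)) in lS.
have St0 : supp f (mi_of t0) by have /(plane_expsP _ _ _)[] := t0A.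
have bl : e b < l by exact: ab.
have lN i : i \in I -> l <= a 0 i * N%:R.
  move=> iI; have [b1 b1A b1E] := plane_exps_axis box S_neq0 pc iI.
  have Sb1 : supp f (mi_of b1) by have /(plane_expsP _ _ _)[] := b1A.
  apply: (le_trans (lS _ Sb1)).
  rewrite /dotv (bigD1 i)//= big1 ?addr0 => [|j ji]; last first.
    by rewrite mi_vec_mi_of b1E (negbTE ji) mulr0.
  by rewrite mi_vec_mi_of b1E eqxx ler_wpM2l// ler_nat leqW// nu_le.
have face : defines_face f a l [set x | newton_polyhedron f x /\ dotv a x = l].
  split=> //; first exact: valid_pair_supp.
  by exists (mi_vec (mi_of t0)); split=> //; exact: newton_supp.
have /near_cube[r2 r20 KN2] := KN face.
have [r1 [C [r10 r1r r11 C0 CP]]] := expansion_function (N' := N') I r0_gt0 sf.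
exists (Num.min r1 r2); first by rewrite lt_min r10.
move=> w wr.
have w1 : cube r1 w by apply: cube_le wr; rewrite ge_min lexx.
have w2 : cube r2 w by apply: cube_le wr; rewrite ge_min lexx orbT.
have [lf lfP] : exists lf : R, f (dilation a t w) / t `^ l @[t --> 0^'+] --> lf.
  by apply/cvg_ex; exact: KN2.
apply: (@power_sum_level0 R _ e (fun b' => monomial (mi_of b') w * coef b' w) l
  (`|lf| + 1 + C * \sum_(i in I) 1)) => //.
have Hlf : \forall t \near (0 : R)^'+, `|lf - f (dilation a t w) / t `^ l| < 1.
  exact: (@cvgr_dist_lt _ _ _ _ _ _ _ lfP).
near=> t.
have t0' : 0 < t by [].
have t1 : t <= 1 by near: t; apply: nbhs_right_le.
have tl : 0 < t `^ l by rewrite powR_gt0.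
have ta i : 0 <= t `^ a 0 i <= 1.
  rewrite powR_ge0/= -(powRr0 t); apply: ger_powR; [by rewrite t0' t1|exact: a_ge0].
have dr : cube r1 (dilation a t w).
  move=> i; rewrite mxE normrM; apply: le_lt_trans (w1 i).
  have /andP[ta0 ta1] := ta i.
  by rewrite ger0_norm// -[leRHS]mul1r ler_wpM2r.
have -> : \sum_(b' | supported s b') monomial (mi_of b') w * coef b' w * t `^ e b' =
    \sum_(b' | supported s b') monomial (mi_of b') (dilation a t w) * coef b' (dilation a t w).
  apply: eq_bigr => b' _; rewrite monomial_dilation// -/(e b').
  rewrite (@eq_coef b' (dilation a t w) w); first by ring.
  by move=> j jI; rewrite mxE a_eq0// powRr0 mul1r.
have h1 := CP _ dr.
have h2 : `|f (dilation a t w)| <= (`|lf| + 1) * t `^ l.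
  rewrite -ler_pdivrMr// -[X in _ / X](gtr0_norm tl) -normfV -normrM.
  have : `|lf - f (dilation a t w) / t `^ l| < 1 by near: t.
  move=> h; rewrite -[X in `|X|](subrK lf) addrC.
  apply: (le_trans (ler_normD _ _)); rewrite lerD2l distrC ltW//.
have h3 : \sum_(i in I) `|dilation a t w 0 i| ^+ N <= (\sum_(i in I) 1) * t `^ l.
  rewrite mulr_suml; apply: ler_sum => i iI; rewrite mul1r mxE normrM exprMn.
  have /andP[ta0 ta1] := ta i.
  rewrite ger0_norm// -powR_mulrn// -powRrM -[leRHS]mulr1 ler_pM ?powR_ge0 ?exprn_ge0//.
    by apply: ger_powR; [rewrite t0' t1|exact: lN].
  by rewrite exprn_ile1//; apply: ltW; exact: lt_le_trans (w1 i) r11.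
set Sg := \sum_(b' | _) _ in h1 *.
rewrite -[Sg](subrK (f (dilation a t w))) mulrDl.
apply: (le_trans (ler_normD _ _)); rewrite addrC lerD//.
rewrite distrC; apply: (le_trans h1).
by rewrite -mulrA ler_wpM2l.
Unshelve. all: by end_near. Qed.

(** A polynomial vanishing on a neighbourhood of 0 has vanishing coefficients: scale
    one variable at a time and separate the terms by their degree in it. *)
Lemma slice_vanishing r : (forall w, cube r w ->
    \sum_(b' | supported s b' && (e b' == e b)) monomial (mi_of b') w * coef b' w = 0) ->
  forall u, {subset u <= I} -> forall w, cube r w ->
    \sum_(b' | (supported s b' && (e b' == e b)) && all (fun i => b' i == b i) u)
       monomial (mi_of b') w * coef b' w = 0.
Proof.
move=> h; elim=> [_ w wr|i u IH uI w wr].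
  by rewrite (eq_bigl _ _ (fun b' => andbT _)) h.
have iI : i \in I by apply: uI; rewrite inE eqxx.
have uI' : {subset u <= I} by move=> j ju; apply: uI; rewrite inE ju orbT.
pose P b' := (supported s b' && (e b' == e b)) && all (fun i => b' i == b i) u.
have := @power_sum_level0 R _ (fun b' : B => (b' i)%:R)
  (fun b' => monomial (mi_of b') w * coef b' w) (b i).+1%:R 0 P.
move=> /(_ _ (b i)%:R) H.
rewrite -[RHS]H; last by rewrite ltr_nat.
  apply: eq_bigl => b'; rewrite /P/= eqr_nat -!andbA; do 2 congr (_ && _).
  by rewrite andbC.
near=> t.
have t0 : 0 < t by [].
have t1 : t <= 1 by near: t; apply: nbhs_right_le.
rewrite mul0r normr_le0.
have wt : cube r (upd w i (t * w 0 i)).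
  apply: cube_upd => //; rewrite normrM; apply: le_lt_trans (wr i).
  by rewrite gtr0_norm// -[leRHS]mul1r ler_wpM2r.
rewrite -[X in _ == X](IH uI' _ wt); apply/eqP; apply: eq_bigr => b' _.
rewrite (@eq_coef b' (upd w i (t * w 0 i)) w); last first.
  by move=> j jI; rewrite updE; case: eqP => // ji; move: jI; rewrite ji iI.
rewrite powR_mulrn ?ltW// mulrAC; congr (_ * _).
rewrite /monomial (bigD1 i)//= [in RHS](bigD1 i)//= updE eqxx exprMn ffunE.
rewrite mulrC -mulrA; do 2 congr (_ * _).
by apply: eq_bigr => j ji; rewrite updE (negbTE ji).
Unshelve. all: by end_near. Qed.

(** The coefficient depends only on the coordinates outside I, so it may be read off
    at a point whose coordinates in I are nonzero. *)
Lemma bad_coef_vanishing : exists2 r : R, 0 < r & forall x, cube r x -> coef b x = 0.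
Proof.
have [r r0' h] := level_vanishing; exists r => // x xr.
pose w : 'rV[R]_n := \row_i (if i \in I then r / 2 else x 0 i).
have wr : cube r w.
  move=> i; rewrite mxE; case: ifP => // _.
  by rewrite gtr0_norm ?divr_gt0// ltr_pdivrMr// ltr_pMr// ltr1n.
have := slice_vanishing h (u := s) _ wr; rewrite (big_pred1 b); last first.
  move=> b'; apply/idP/eqP => [/andP[/andP[sb' _] /allP bb']|->].
    apply/ffunP => j; have [jI|jI] := boolP (j \in I).
      by apply/eqP/bb'; rewrite mem_enum.
    by rewrite (supported_enumP sb')// (supported_enumP sb).
  by rewrite sb eqxx/=; apply/allP.
rewrite (@eq_coef b w x); last by move=> j /negbTE jI; rewrite mxE jI.
move=> H; have /eqP := H (fun i => etrans (esym (mem_enum _ _))); rewrite mulf_eq0.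
case/orP; last by move=> /eqP.
rewrite /monomial => /prodf_eq0[i _]; rewrite expf_eq0 mxE ffunE => /andP[bi].
case: ifPn => [_|/(supported_enumP sb) E]; last by move: bi; rewrite E.
by rewrite gt_eqF// divr_gt0.
Qed.

End Bad.

Lemma coef_vanishing b : supported s b -> ~ dominated b ->
  exists2 r : R, 0 < r & forall x, cube r x -> coef b x = 0.
Proof.
move=> sb /(log_separation sb)[a [a1 a2 a3]].
exact: (bad_coef_vanishing sb a1 a2 a3).
Qed.

End Vanishing.

(** * Comparison of f with the gauge *)

Lemma is_derive_bigsum {R : realType} {T : Type} (r : seq T) (P : pred T)
    (F : T -> R -> R) (dF : T -> R) (u : R) :
  (forall t, is_derive u 1 (F t) (dF t)) ->
  is_derive u 1 (fun v => \sum_(t <- r | P t) F t v) (\sum_(t <- r | P t) dF t).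
Proof.
move=> h; elim: r => [|t r IH].
  under eq_fun do rewrite big_nil; rewrite big_nil; exact: is_derive_cst.
under eq_fun do rewrite big_cons; rewrite big_cons; case: ifP => // _.
exact: is_deriveD.
Qed.

Lemma torus_dense {R : realType} {n : nat} (F G : 'rV[R]_n -> R) (r : R) :
  (forall x, cube r x -> {for x, continuous F}) ->
  (forall x, cube r x -> {for x, continuous G}) ->
  (forall x, cube r x -> torus x -> F x <= G x) ->
  forall x, cube r x -> F x <= G x.
Proof.
move=> Fc Gc FG x xr; rewrite leNgt; apply/negP => GF.
have e0 : 0 < (F x - G x) / 2 by rewrite divr_gt0// subr_gt0.
have [d1 d10 d1P] := continuous_cube (Fc x xr) e0.
have [d2 d20 d2P] := continuous_cube (Gc x xr) e0.
have [h [h0 hr hd1 hd2]] : exists h : R, [/\ 0 < h, forall k, `|x 0 k| + h < r,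
    h <= d1 & h <= d2].
  have H : \forall h \near (0 : R)^'+, forall k, `|x 0 k| + h < r.
    apply: filter_forall => k; near=> h; rewrite -ltrBrDl; near: h.
    by apply: nbhs_right_lt; rewrite subr_gt0.
  near (0 : R)^'+ => h; exists h; split=> //; first by near: h.
    by near: h; apply: nbhs_right_le.
  by near: h; apply: nbhs_right_le.
pose y : 'rV[R]_n := \row_i (if x 0 i == 0 then h else x 0 i).
have yx k : `|y 0 k - x 0 k| <= h.
  rewrite mxE; case: eqP => [->|_]; first by rewrite subr0 gtr0_norm.
  by rewrite subrr normr0 ltW.
have yr : cube r y.
  move=> k; apply: le_lt_trans (hr k); rewrite -[y 0 k](subrK (x 0 k)) addrC.
  by apply: (le_trans (ler_normD _ _)); rewrite lerD2l.
have yt : torus y by move=> k; rewrite mxE; case: (x 0 k =P 0) => [_|/eqP//]; rewrite gt_eqF.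
have := FG y yr yt.
have := d1P y (fun k => le_trans (yx k) hd1).
have := d2P y (fun k => le_trans (yx k) hd2).
rewrite !ltr_norml => /andP[_ +] /andP[+ _].
move: (F x) (F y) (G x) (G y) => a b c d; lra.
Unshelve. all: by end_near. Qed.

Lemma monomial_continuous {R : realType} {n : nat} al :
  continuous (@monomial R n al).
Proof.
move=> x; apply: (@cvg_big _ _ _ _ _ _ _ (nbhs x)) => [|i _].
  by move=> y; apply: mul_continuous.
apply: (@continuous_comp _ _ _ (fun y : 'rV[R]_n => y 0 i) (fun u : R => u ^+ al i)).
  exact: coord_continuous.
exact: exprn_continuous.
Qed.

Lemma exp_second_order {R : realType} (k : nat) (s : R) : `|s| <= 1 ->
  `|(1 + s) ^+ k - 1 - k%:R * s| <= 4 ^+ k * s ^+ 2.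
Proof.
move=> s1; elim: k => [|k IH].
  by rewrite expr0 subrr mul0r subr0 normr0 mul1r sqr_ge0.
have -> : (1 + s) ^+ k.+1 - 1 - k.+1%:R * s =
    (1 + s) * ((1 + s) ^+ k - 1 - k%:R * s) + k%:R * s ^+ 2.
  by rewrite exprS -natr1; ring.
apply: (le_trans (ler_normD _ _)).
rewrite [X in X + _]normrM [X in _ + X]normrM normr_nat.
have s2 : `|s ^+ 2| = s ^+ 2 by rewrite ger0_norm// sqr_ge0.
have h1 : `|1 + s| <= 2.
  by have := ler_normD 1 s; rewrite normr1; lra.
have h2 : k%:R <= 4 ^+ k :> R by rewrite -natrX ler_nat ltnW// ltn_expl.
have q0 : 0 <= s ^+ 2 by exact: sqr_ge0.
have h3 : `|1 + s| * `|(1 + s) ^+ k - 1 - k%:R * s| <= 2 * (4 ^+ k * s ^+ 2) by rewrite ler_pM.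
have h4 : k%:R * s ^+ 2 <= 4 ^+ k * s ^+ 2 by rewrite ler_wpM2r.
have h5 : 0 <= 4 ^+ k * s ^+ 2 by rewrite mulr_ge0// exprn_ge0.
rewrite s2 (exprS 4) -(mulrA 4); move: h3 h4 h5.
move: (4 ^+ k * s ^+ 2) (k%:R * s ^+ 2) (`|1 + s| * _) => X Y Z; lra.
Qed.

Section LocalBounds.
Context {R : realType} {n N' : nat}.
Local Notation N := N'.+1.
Local Notation mi := {ffun 'I_n -> nat}.
Local Notation B := {ffun 'I_n -> 'I_N}.
Variables (f : 'rV[R]_n -> R) (r0 : R) (I : {set 'I_n}) (nu : 'I_n -> nat).
Implicit Types (x y w a : 'rV[R]_n) (i j : 'I_n) (al be : mi) (b : B).

Hypothesis r0_gt0 : 0 < r0.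
Hypothesis sf : smooth_on (cube r0) f.
Hypothesis box : forall al, supp f al ->
  exists2 b : B, supp f (mi_of b) & forall i, (b i <= al i)%N.
Hypothesis S_neq0 : supp f !=set0.
Hypothesis pc : partially_convenient_with f I nu.
Hypothesis nu_le : forall i, i \in I -> (nu i < N')%N.
Hypothesis KN : KN_condition f.
Hypothesis nd : newton_nondegenerate f.
Hypothesis f_ge0 : \forall x \near (0 : 'rV[R]_n), 0 <= f x.

Let s := enum I.
Local Notation A := (@plane_exps R n f N I).
Local Notation coef := (@slice_coef R n N' f I).
Local Notation gauge := (@newton_gauge R n N' f I).

Let nu_le' i : i \in I -> (nu i <= N')%N.
Proof. by move=> /nu_le/ltnW. Qed.

(** With k = 1 this is the principal part of f, and with k b = b j its logarithmic
    derivative in the direction j. *)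
Definition principal (k : B -> R) x : R :=
  \sum_(b in A) taylor_coef f (mi_of b) * k b * monomial (mi_of b) x.

Lemma gauge_ge0 x : 0 <= gauge x.
Proof. exact: sumr_ge0. Qed.

Lemma le_gauge b x : b \in A -> `|monomial (mi_of b) x| <= gauge x.
Proof. by move=> bA; rewrite /newton_gauge (bigD1 b)//= lerDl sumr_ge0. Qed.

Lemma axis_gauge i x : i \in I -> `|x 0 i| ^+ nu i <= gauge x.
Proof.
move=> iI; have [b bA bE] := plane_exps_axis box S_neq0 pc iI.
apply: le_trans (le_gauge x bA); rewrite normr_monomial (bigD1 i)//=.
rewrite ffunE bE eqxx big1 ?mulr1// => j /negbTE ji.
by rewrite ffunE bE ji.
Qed.

Lemma plane_exps_supported b : b \in A -> supported s b.
Proof.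
move=> /(plane_expsP _ _ _)[_ bI]; apply/supportedP => j.
by rewrite mem_enum => /bI bj; apply: val_inj.
Qed.

Lemma slice_coef0 b : supported s b -> coef b 0 = taylor_coef f (mi_of b).
Proof.
move=> sb; rewrite /slice_coef /tcoef /taylor_coef; congr (iter_partial _ _ _ / _).
  have H (r : seq 'I_n) : diffs [seq i <- r | i \in I] (mi_of b) = diffs r (mi_of b).
    rewrite /diffs; elim: r => //= i r IH; case: ifPn => /= [_|iI]; first by rewrite IH.
    by rewrite ffunE (supported_enumP sb iI)/= IH.
  by rewrite -[RHS]H /diffs {1}/enum_mem -enumT.
by apply/rowP => j; rewrite !mxE; case: ifP.
Qed.

(** A dominated monomial may have its coefficient frozen at 0 at the cost of o(1)
    times the gauge; the coefficients of the other monomials vanish near 0. *)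
Lemma weighted_approx (k : B -> R) (eta : R) : 0 < eta ->
  \forall x \near (0 : 'rV[R]_n), torus x ->
  `|\sum_(b | supported s b) k b * (monomial (mi_of b) x * coef b x) - principal k x|
    <= eta * gauge x.
Proof.
move=> eta0.
have B0 : (0 < #|{: B}|)%N by apply/card_gt0P; exists [ffun => ord0].
pose e : R := eta / #|{: B}|%:R.
have e0 : 0 < e by rewrite divr_gt0// ltr0n.
have H : \forall x \near (0 : 'rV[R]_n), forall b, supported s b -> torus x ->
    `|k b * (monomial (mi_of b) x * (coef b x - coef b 0))| <= e * gauge x.
  apply: (@filter_forall _ B (fun b x => supported s b -> torus x ->
    `|k b * (monomial (mi_of b) x * (coef b x - coef b 0))| <= e * gauge x)
    (nbhs (0 : 'rV[R]_n))) => b.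
  have [sb|_] := boolP (supported s b); last by apply: nearW.
  have [db|ndb] := pselect (dominated f I b); last first.
    have [r r0' rP] := coef_vanishing r0_gt0 sf box S_neq0 pc nu_le' KN sb ndb.
    apply/near_cube; exists r => // x xr _ _.
    rewrite rP// rP; last by move=> i; rewrite mxE normr0.
    by rewrite subrr !mulr0 normr0 mulr_ge0 ?gauge_ge0// ltW.
  pose g := iter_partial (diffs s (mi_of b)) f.
  have gc : {for 0, continuous g}.
    apply: (smooth_continuous (smooth_iter _ sf)) => i; by rewrite mxE normr0.
  have e1 : 0 < e / (`|k b| + 1) by rewrite divr_gt0// ltr_wpDl.
  have [d d0 dP] := continuous_cube gc e1.
  apply/near_cube; exists (Num.min d 1); first by rewrite lt_min d0 ltr01.
  move=> x xr _ x0.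
  have x1 : cube 1 x by apply: cube_le xr; rewrite ge_min lexx orbT.
  have : `|coef b x - coef b 0| <= e / (`|k b| + 1).
    rewrite /slice_coef /tcoef -mulrBl normrM normfV normr_nat.
    rewrite ler_pdivrMr ?ltr0n ?mfact_gt0//.
    apply: (@le_trans _ _ (e / (`|k b| + 1))).
      have -> : zero_on (enum I) 0 = 0 :> 'rV[R]_n by apply/rowP => j; rewrite !mxE; case: ifP.
      apply/ltW/dP => j; rewrite [X in _ - X]mxE subr0; apply: ltW.
      have xd : cube d x by apply: cube_le xr; rewrite ge_min lexx.
      exact: (cube_zero_on (enum I) xd).
    by rewrite ler_peMr ?ler1n ?mfact_gt0// ltW.
  move=> h; rewrite normrM normrM.
  have h1 : `|k b| * `|coef b x - coef b 0| <= e.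
    apply: (@le_trans _ _ ((`|k b| + 1) * (e / (`|k b| + 1)))).
      by apply: ler_pM => //; rewrite lerDl.
    by rewrite mulrCA divff ?mulr1// gt_eqF// ltr_wpDl.
  have -> : `|k b| * (`|monomial (mi_of b) x| * `|coef b x - coef b 0|) =
      `|k b| * `|coef b x - coef b 0| * `|monomial (mi_of b) x| by ring.
  by apply: ler_pM => //; exact: db.
near=> x; move=> x0.
have -> : principal k x = \sum_(b | supported s b) k b * (monomial (mi_of b) x * coef b 0).
  rewrite /principal big_mkcond [RHS]big_mkcond; apply: eq_bigr => b _.
  have [bA|bA] := boolP (b \in A).
    by rewrite plane_exps_supported// slice_coef0 ?plane_exps_supported//; ring.
  have [sb|//] := boolP (supported s b).
  rewrite slice_coef0//; have [->|c0] := eqVneq (taylor_coef f (mi_of b)) 0.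
    by rewrite !mulr0.
  move: bA; rewrite (_ : b \in A)//; apply/(plane_expsP _ _ _); split=> // j jI.
  by rewrite (supported_enumP sb).
rewrite -sumrB; under eq_bigr do rewrite -mulrBr -mulrBr.
apply: (le_trans (ler_norm_sum _ _ _)).
apply: (@le_trans _ _ (\sum_(b : B) e * gauge x)).
  rewrite big_mkcond; apply: ler_sum => b _; case: ifPn => [sb|_].
    have : torus x by []. move: b sb. near: x. 
    by apply: filterS H => x xP b sb x0; exact: xP.
  by rewrite mulr_ge0 ?gauge_ge0// ltW.
rewrite sumr_const -mulr_natr mulrAC divfK// pnatr_eq0 -lt0n//.
Unshelve. all: by end_near. Qed.

(** The expansion order exceeds every nu_i, and |x_i|^nu_i is one of the monomials
    of the gauge. *)
Lemma error_small (C eta : R) : 0 <= C -> 0 < eta ->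
  \forall x \near (0 : 'rV[R]_n), C * \sum_(i in I) `|(x : 'rV[R]_n) 0 i| ^+ N <= eta * gauge x.
Proof.
move=> C0 eta0.
have q0 : 0 < C * #|I|%:R + 1 by rewrite ltr_wpDl// mulr_ge0.
pose d := Num.min 1 (eta / (C * #|I|%:R + 1)).
have d0 : 0 < d by rewrite lt_min ltr01 divr_gt0.
apply/near_cube; exists d => // x xd.
have x1 i : `|x 0 i| <= 1 by apply: ltW; apply: lt_le_trans (xd i) _; rewrite ge_min lexx.
have h : \sum_(i in I) `|x 0 i| ^+ N <= #|I|%:R * (d * gauge x).
  rewrite mulr_natl -sumr_const; apply: ler_sum => i iI; rewrite exprS.
  apply: ler_pM; rewrite ?exprn_ge0//; first exact: ltW (xd i).
  apply: le_trans (axis_gauge x iI).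
  by rewrite ler_wiXn2l// nu_le'.
apply: (le_trans (ler_wpM2l C0 h)); rewrite !mulrA ler_wpM2r ?gauge_ge0//.
apply: (@le_trans _ _ ((C * #|I|%:R + 1) * (eta / (C * #|I|%:R + 1)))).
  apply: ler_pM; rewrite ?mulr_ge0 ?(ltW d0)//; first by rewrite lerDl.
  by rewrite ge_min lexx orbT.
by rewrite mulrCA divff ?mulr1// gt_eqF.
Qed.

Lemma approx_function (eta : R) : 0 < eta ->
  \forall x \near (0 : 'rV[R]_n), torus x ->
  `|f x - principal (fun=> 1) x| <= eta * gauge x.
Proof.
move=> eta0; have e2 : 0 < eta / 2 by rewrite divr_gt0.
have [r1 [C [r10 _ _ C0 CP]]] := expansion_function (N' := N') I r0_gt0 sf.
have H1 : \forall x \near (0 : 'rV[R]_n), cube r1 x by apply/near_cube; exists r1.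
near=> x => x0; set Sg := \sum_(b | supported s b) monomial (mi_of b) x * coef b x.
have h1 : `|f x - Sg| <= eta / 2 * gauge x.
  apply: le_trans (_ : C * \sum_(i in I) `|x 0 i| ^+ N <= _).
    by apply: CP; near: x.
  by near: x; exact: error_small.
have h2 : `|Sg - principal (fun=> 1) x| <= eta / 2 * gauge x.
  rewrite (_ : Sg = \sum_(b | supported s b) 1 * (monomial (mi_of b) x * coef b x)); last first.
    by apply: eq_bigr => b _; rewrite mul1r.
  by move: x0; near: x; exact: weighted_approx.
apply: (le_trans (ler_distD Sg _ _)); apply: (le_trans (lerD h1 h2)).
by rewrite -mulrDl -splitr.
Unshelve. all: by end_near. Qed.

Lemma approx_partial i (eta : R) : i \in I -> 0 < eta ->
  \forall x \near (0 : 'rV[R]_n), torus x ->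
  `|x 0 i * partial i f x - principal (fun b => (b i)%:R) x| <= eta * gauge x.
Proof.
move=> iI eta0; have e2 : 0 < eta / 2 by rewrite divr_gt0.
have [r1 [C [r10 _ _ C0 CP]]] := expansion_partial (N' := N') r0_gt0 sf iI.
have H1 : \forall x \near (0 : 'rV[R]_n), cube r1 x by apply/near_cube; exists r1.
near=> x => x0.
set Sg := \sum_(b | supported s b) (b i)%:R * (monomial (mi_of b) x * coef b x).
have h1 : `|x 0 i * partial i f x - Sg| <= eta / 2 * gauge x.
  apply: le_trans (_ : C * \sum_(i in I) `|x 0 i| ^+ N <= _).
    by apply: CP; near: x.
  by near: x; exact: error_small.
have h2 : `|Sg - principal (fun b => (b i)%:R) x| <= eta / 2 * gauge x.
  by rewrite /Sg; move: x0; near: x; exact: weighted_approx.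
apply: (le_trans (ler_distD Sg _ _)); apply: (le_trans (lerD h1 h2)).
by rewrite -mulrDl -splitr.
Unshelve. all: by end_near. Qed.

(** Multiplication by z_j avoids the special case of exponents with e t j = 0. *)
Lemma partial_polynomial (T : finType) (P : pred T) (c : T -> R) (e : T -> mi) j (z : 'rV[R]_n) :
  z 0 j * partial j (fun x => \sum_(t | P t) c t * monomial (e t) x) z =
  \sum_(t | P t) c t * (e t j)%:R * monomial (e t) z.
Proof.
pose q t : R := \prod_(i | i != j) z 0 i ^+ e t i.
have mE t u : monomial (e t) (upd z j u) = q t * u ^+ e t j.
  rewrite /monomial (bigD1 j)//= updE eqxx mulrC; congr (_ * _).
  by apply: eq_bigr => i /negbTE ij; rewrite updE ij.
have D : is_derive (upd z j (z 0 j)) (delta_mx 0 j)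
    (fun x => \sum_(t | P t) c t * monomial (e t) x)
    (\sum_(t | P t) c t * q t * ((e t j)%:R * z 0 j ^+ (e t j).-1)).
  apply/is_derive_upd.
  rewrite (_ : (fun u => _) = fun u => \sum_(t | P t) (c t * q t) * u ^+ e t j); last first.
    by apply/funext => u; apply: eq_bigr => t _; rewrite mE mulrA.
  by apply: is_derive_bigsum => t; apply: is_deriveZ; exact: is_derive_exp.
rewrite upd_same in D; rewrite /partial (derive_val (is_derive := D)) mulr_sumr.
apply: eq_bigr => t _; rewrite -{3}(upd_same z j) mE.
case: (e t j) => [|k]; first by rewrite mul0r !(mulr0, mul0r).
by rewrite exprS /=; ring.
Qed.

Lemma face_nondegenerate a t0 (z : 'rV[R]_n) : t0 \in A -> (forall i, 0 < a 0 i) ->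
  (forall t, t \in A -> dotv a (mi_vec (mi_of t0)) <= dotv a (mi_vec (mi_of t))) ->
  torus z ->
  exists j, \sum_(t in A | dotv a (mi_vec (mi_of t)) == dotv a (mi_vec (mi_of t0)))
    taylor_coef f (mi_of t) * (mi_of t j)%:R * monomial (mi_of t) z != 0.
Proof.
move=> t0A a0 min0 z0; apply: contrapT => nj.
have [lS _] := plane_exps_face box S_neq0 pc a0 t0A min0.
have St0 : supp f (mi_of t0) by have /(plane_expsP _ _ _)[] := t0A.
set l := dotv a (mi_vec (mi_of t0)) in min0 nj lS.
have gf : is_face f [set x | newton_polyhedron f x /\ dotv a x = l].
  exists a, l; split=> //; first by apply: valid_pair_supp => // i; exact: ltW.
  by exists (mi_vec (mi_of t0)); split=> //; exact: newton_supp.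
have gc : compact [set x | newton_polyhedron f x /\ dotv a x = l].
  by apply: (face_compact box a0) => b Sb; exact: lS.
apply: (nd gf gc); exists z; split=> // j.
apply: (mulfI (z0 j)); rewrite mulr0.
rewrite (face_part_conv_exps box S_neq0 pc a0 t0A min0) partial_polynomial.
by apply/eqP/negPn/negP => h; apply: nj; exists j.
Qed.

Lemma principal_gradient : exists2 k : R, 0 < k & forall x, torus x -> cube k x ->
  k * gauge x <= \sum_j `|principal (fun b => (b j)%:R) x|.
Proof.
have [a t0 z t0A a0 m0 z0|k k0 kP] := @torus_gradient_bound R n B A (@mi_of n N)
    (fun t => taylor_coef f (mi_of t)).
  exact: face_nondegenerate t0A a0 m0 z0.
exists k => // x x0 xk; have h := kP x x0 xk; apply: le_trans h _.
apply: ler_sum => j _; rewrite le_eqVlt; apply/orP; left; apply/eqP; congr (`|_|).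
by apply: eq_bigr => t _; rewrite ffunE.
Qed.

Lemma principal_out j x : j \notin I -> principal (fun b => (b j)%:R) x = 0.
Proof.
move=> jI; apply: big1 => b /plane_exps_supported/supported_enumP -> //.
by rewrite mulr0 mul0r.
Qed.

Lemma gradient_lower_torus : exists2 c : R, 0 < c &
  \forall x \near (0 : 'rV[R]_n), torus x ->
  c * gauge x <= \sum_(i in I) `|x 0 i * partial i f x|.
Proof.
have [k k0 kP] := principal_gradient.
have q0 : 0 < (#|I|.+1)%:R *+ 2 :> R by rewrite pmulrn_lgt0// ltr0n.
pose eta : R := k / ((#|I|.+1)%:R *+ 2).
have eta0 : 0 < eta by rewrite divr_gt0.
exists (k / 2); first by rewrite divr_gt0.
have H : \forall x \near (0 : 'rV[R]_n), forall i, i \in I -> torus x ->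
    `|x 0 i * partial i f x - principal (fun b => (b i)%:R) x| <= eta * gauge x.
  apply: (@filter_forall _ 'I_n (fun i x => i \in I -> torus x ->
    `|x 0 i * partial i f x - principal (fun b => (b i)%:R) x| <= eta * gauge x)
    (nbhs (0 : 'rV[R]_n))) => i.
  have [iI|_] := boolP (i \in I); last by apply: nearW.
  have := approx_partial iI eta0.
  by apply: filterS => x h _; exact: h.
have H1 : \forall x \near (0 : 'rV[R]_n), cube k x by apply/near_cube; exists k.
near=> x => x0.
have xk : cube k x by near: x.
have hx : forall i, i \in I -> torus x ->
    `|x 0 i * partial i f x - principal (fun b => (b i)%:R) x| <= eta * gauge x by near: x.
have h1 := kP x x0 xk.
have h2 : \sum_j `|principal (fun b => (b j)%:R) x| <=
    \sum_(i in I) `|x 0 i * partial i f x| + \sum_(i in I) eta * gauge x.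
  rewrite (bigID (mem I))/= [X in _ + X]big1 ?addr0; last first.
    by move=> j jI; rewrite principal_out// normr0.
  rewrite -big_split/=; apply: ler_sum => i iI.
  rewrite -lerBlDl; apply: le_trans (hx i iI x0).
  by rewrite distrC; exact: lerB_dist.
have h3 : \sum_(i in I) eta * gauge x <= k / 2 * gauge x.
  rewrite sumr_const -mulrnAl ler_wpM2r ?gauge_ge0//.
  rewrite /eta -mulr_natr -(mulr_natr _.+1%:R 2) invfM mulrA mulrAC ler_wpM2r ?invr_ge0//.
  by rewrite mulrAC ler_pdivrMr ?ltr0n// ler_wpM2l ?ltW// ltr_nat.
have := le_trans h1 h2.
move: h3; rewrite {2}(splitr k) mulrDl; move: (k / 2 * gauge x) => p; lra.
Unshelve. all: by end_near. Qed.

Lemma monomial_stretch (b : B) j (x : 'rV[R]_n) (u : R) :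
  monomial (mi_of b) (upd x j (u * x 0 j)) = u ^+ b j * monomial (mi_of b) x.
Proof.
rewrite /monomial (bigD1 j)//= [in RHS](bigD1 j)//= updE eqxx exprMn ffunE -mulrA.
do 2 congr (_ * _).
by apply: eq_bigr => i /negbTE ij; rewrite updE ij.
Qed.

Let csum : R := \sum_(b in A) `|taylor_coef f (mi_of b)|.

Let csum_ge0 : 0 <= csum.
Proof. exact: sumr_ge0. Qed.

Lemma principal_stretch j (x : 'rV[R]_n) (u : R) : `|u| <= 1 ->
  principal (fun=> 1) (upd x j ((1 + u) * x 0 j)) <=
  principal (fun=> 1) x + u * principal (fun b => (b j)%:R) x + csum * 4 ^+ N * u ^+ 2 * gauge x.
Proof.
move=> u1; rewrite -lerBlDl.
have -> : principal (fun=> 1) (upd x j ((1 + u) * x 0 j)) -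
    (principal (fun=> 1) x + u * principal (fun b => (b j)%:R) x) =
  \sum_(b in A) taylor_coef f (mi_of b) * monomial (mi_of b) x *
     ((1 + u) ^+ b j - 1 - (b j)%:R * u).
  rewrite /principal mulr_sumr -big_split/= -sumrB; apply: eq_bigr => b _.
  by rewrite monomial_stretch; ring.
apply: (le_trans (ler_norm _)); apply: (le_trans (ler_norm_sum _ _ _)).
have -> : csum * 4 ^+ N * u ^+ 2 * gauge x = csum * (4 ^+ N * u ^+ 2 * gauge x) by ring.
rewrite mulr_suml; apply: ler_sum => b bA.
rewrite normrM normrM -mulrA; apply: ler_pM; rewrite ?mulr_ge0//.
rewrite mulrC.
suff h : `|(1 + u) ^+ b j - 1 - (b j)%:R * u| <= 4 ^+ N * u ^+ 2.
  by apply: ler_pM => //; exact: le_gauge.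
apply: (le_trans (exp_second_order _ u1)).
by rewrite ler_wpM2r ?sqr_ge0// ler_weXn2l// ?ler1n// ltnW// ltn_ord.
Qed.

Lemma gauge_stretch j (x : 'rV[R]_n) (u : R) : `|u| <= 1 ->
  gauge (upd x j ((1 + u) * x 0 j)) <= 2 ^+ N * gauge x.
Proof.
move=> u1; rewrite /newton_gauge mulr_sumr; apply: ler_sum => b _.
rewrite monomial_stretch normrM normrX ler_wpM2r//.
have u2 : `|1 + u| <= 2 by have := ler_normD 1 u; rewrite normr1; lra.
apply: (@le_trans _ _ (2 ^+ b j)).
  by apply: lerXn2r; rewrite ?nnegrE.
by rewrite ler_weXn2l// ?ler1n// ltnW// ltn_ord.
Qed.

(** The logarithmic gradient of f is comparable with the gauge, while its second
    logarithmic derivatives are bounded by the gauge; a nonnegative function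
    with these two properties cannot be much smaller than its gradient, since a
    bounded stretch of one coordinate would make it negative. *)
Lemma function_lower_torus : exists2 c : R, 0 < c &
  \forall x \near (0 : 'rV[R]_n), torus x -> c * gauge x <= f x.
Proof.
have [k k0 kP] := principal_gradient.
have n0 : 0 < n.+1%:R :> R by rewrite ltr0n.
pose D : R := csum * 4 ^+ N.
have D0 : 0 <= D by rewrite mulr_ge0// exprn_ge0.
have D1 : 0 < D + 1 by rewrite ltr_wpDl.
(* The stretch s0 is small enough for the second-order term, of size D s0^2, to eat
   at most half of the first-order gain 2 q s0. *)
pose q : R := k / (2 * n.+1%:R).
have q0 : 0 < q by rewrite divr_gt0// mulr_gt0.
pose s0 := Num.min (1 / 2) (q / (D + 1)).
have s00 : 0 < s0 by rewrite lt_min !divr_gt0.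
have s01 : s0 <= 1 / 2 by rewrite ge_min lexx.
have s0D : D * s0 <= q.
  apply: (@le_trans _ _ ((D + 1) * (q / (D + 1)))).
    by apply: ler_pM => //; [exact: ltW|rewrite lerDl|rewrite ge_min lexx orbT].
  by rewrite mulrCA divff ?mulr1// gt_eqF.
pose M : R := 2 ^+ N + 1.
have M0 : 0 < M by rewrite ltr_wpDl// exprn_ge0.
pose eta : R := s0 * q / (2 * M).
have eta0 : 0 < eta by rewrite divr_gt0 ?mulr_gt0.
have [r r0' rP] : exists2 r : R, 0 < r & cube r `<=` [set x | [/\ cube k x, 0 <= f x &
    torus x -> `|f x - principal (fun=> 1) x| <= eta * gauge x]].
  apply/near_cube.
  have H1 : \forall x \near (0 : 'rV[R]_n), cube k x by apply/near_cube; exists k.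
  near=> x; split; [by near: x|by near: x|].
  by near: x; exact: approx_function.
exists (s0 * q / 2); first by rewrite divr_gt0 ?mulr_gt0.
apply/near_cube; exists (r / 2); first by rewrite divr_gt0.
move=> x xr x0.
have r2 : r / 2 <= r by rewrite ler_pdivrMr// ler_peMr ?ler1n// ltW.
have [xk fx0 /(_ x0) fP] := rP x (cube_le r2 xr).
have [g0|g0] := leP (gauge x) 0.
  by apply: le_trans fx0; rewrite mulr_ge0_le0// ltW// divr_gt0// mulr_gt0.
have [j jP] : exists j, k * gauge x <= n.+1%:R * `|principal (fun b => (b j)%:R) x|.
  apply: contrapT => nj.
  have : \sum_j `|principal (fun b => (b j)%:R) x| <= \sum_(j < n) k * gauge x / n.+1%:R.
    apply: ler_sum => j _; rewrite ler_pdivlMr// mulrC leNgt; apply/negP => h.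
    by apply: nj; exists j; exact: ltW.
  rewrite sumr_const card_ord => /(le_trans (kP x x0 xk)).
  rewrite leNgt => /negP; apply.
  have X0 : 0 < k * gauge x by rewrite mulr_gt0.
  move: (k * gauge x) X0 => X X0.
  by rewrite -[ltLHS]mulr_natr mulrAC ltr_pdivrMr// ltr_pM2l// ltr_nat.
set th := principal (fun b => (b j)%:R) x in jP.
pose u := if 0 <= th then - s0 else s0.
have uth : u * th = - (s0 * `|th|).
  rewrite /u; case: ifPn => [th0|]; first by rewrite ger0_norm// mulNr.
  by rewrite -ltNge => th0; rewrite ltr0_norm// mulrN opprK.
have u2 : u ^+ 2 = s0 ^+ 2 by rewrite /u; case: ifP; rewrite ?sqrrN.
have un : `|u| = s0 by rewrite /u; case: ifP; rewrite ?normrN gtr0_norm.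
have u1 : `|u| <= 1 by rewrite un; lra.
have hu : `|u| <= 1 / 2 by rewrite un.
have u1' : 1 / 2 <= 1 + u by move: hu; rewrite ler_norml => /andP[]; lra.
pose y := upd x j ((1 + u) * x 0 j).
have yr : cube r y.
  apply: cube_upd; first exact: cube_le xr.
  have u2' : `|1 + u| <= 2 by have := ler_normD 1 u; rewrite normr1; lra.
  rewrite normrM; apply: (@le_lt_trans _ _ (2 * `|x 0 j|)); first by rewrite ler_wpM2r.
  by rewrite mulrC -ltr_pdivlMr//; exact: xr.
have y0 : torus y.
  move=> i; rewrite updE; case: (i =P j) => _; last exact: x0.
  by rewrite mulf_neq0// gt_eqF//; lra.
have [_ fy0 /(_ y0) fyP] := rP y yr.
have gy := gauge_stretch j x u1.
have Py := principal_stretch j x u1.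
rewrite -/y in gy Py.
rewrite uth u2 -/D in Py.
have ey : eta * gauge y <= eta * (2 ^+ N * gauge x) by rewrite ler_wpM2l// ltW.
have h1 : s0 * (2 * q) * gauge x <= s0 * `|th|.
  rewrite -mulrA (ler_wpM2l (ltW s00))//.
  have -> : 2 * q = k / n.+1%:R by rewrite /q; field; rewrite nat1r pnatr_eq0.
  by rewrite mulrAC ler_pdivrMr// [leRHS]mulrC.
have h2 : D * s0 ^+ 2 * gauge x <= s0 * q * gauge x.
  by rewrite ler_wpM2r ?gauge_ge0// expr2 mulrA mulrC (ler_wpM2l (ltW s00)).
have h3 : eta * (2 ^+ N * gauge x) + eta * gauge x = s0 * q / 2 * gauge x.
  have <- : eta * M = s0 * q / 2 by rewrite /eta; field; rewrite gt_eqF.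
  by rewrite /M; ring.
have e1 : - (eta * gauge y) <= principal (fun=> 1) y.
  by move: fyP; rewrite ler_norml => /andP[_]; move: fy0; lra.
have e2 : principal (fun=> 1) x - eta * gauge x <= f x.
  by move: fP; rewrite ler_norml => /andP[+ _]; lra.
pose g := s0 * q * gauge x.
have E1 : s0 * (2 * q) * gauge x = 2 * g by rewrite /g; ring.
have E2 : s0 * q / 2 * gauge x = g / 2 by rewrite /g; ring.
rewrite E1 in h1; rewrite -/g in h2; rewrite E2 in h3; rewrite E2.
clear E1 E2; move: e1 e2 Py ey h1 h2 h3; move: g (eta * gauge y) (eta * gauge x)
  (eta * (2 ^+ N * gauge x)) (s0 * `|th|) (D * s0 ^+ 2 * gauge x)
  (principal (fun=> 1) x) (principal (fun=> 1) y).
move=> p1 p2 p3 p4 p5 p6 p7 p8; lra.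
Unshelve. all: by end_near. Qed.

Lemma function_upper_torus : exists2 C : R, 0 < C &
  \forall x \near (0 : 'rV[R]_n), torus x -> f x <= C * gauge x.
Proof.
exists (csum + 1); first by rewrite ltr_wpDl.
near=> x => x0.
have : `|f x - principal (fun=> 1) x| <= 1 * gauge x.
  by move: x0; near: x; exact: approx_function.
rewrite ler_norml => /andP[_]; rewrite lerBlDr => /le_trans; apply.
rewrite mulrDl addrC lerD2r /principal /csum mulr_suml; apply: ler_sum => b bA.
by apply: (le_trans (ler_norm _)); rewrite mulr1 normrM ler_wpM2l// le_gauge.
Unshelve. all: by end_near. Qed.

Lemma gauge_continuous : continuous gauge.
Proof.
move=> x; apply: (@cvg_big _ _ _ _ _ _ _ (nbhs x)) => [|b _]; first exact: add_continuous.
by apply: cvg_norm; exact: monomial_continuous.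
Qed.

Theorem local_bounds : exists r c C : R,
  [/\ [/\ 0 < r, r < r0, 0 < c & 0 < C], forall x, cube r x -> c * gauge x <= f x,
      forall x, cube r x -> f x <= C * gauge x &
      forall x, cube r x -> c * gauge x <= \sum_(i in I) `|x 0 i * partial i f x|].
Proof.
have [c1 c10 H1] := gradient_lower_torus.
have [c2 c20 H2] := function_lower_torus.
have [C C0 H3] := function_upper_torus.
pose c := Num.min c1 c2.
have [r r0' rP] : exists2 r : R, 0 < r & cube r `<=` [set x | torus x ->
    [/\ c2 * gauge x <= f x, f x <= C * gauge x &
        c1 * gauge x <= \sum_(i in I) `|x 0 i * partial i f x|]].
  apply/near_cube; near=> x => x0.
  by split; move: x0; near: x.
pose r' := Num.min r (r0 / 2).
have r'r x : cube r' x -> cube r x by apply: cube_le; rewrite ge_min lexx.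
have r'0 : r' < r0.
  by apply: (@le_lt_trans _ _ (r0 / 2)); rewrite ?ge_min ?lexx ?orbT// ltr_pdivrMr// ltr_pMr// ltr1n.
have r'r0 x : cube r' x -> cube r0 x by apply: cube_le; exact: ltW.
have gc (k : R) x : {for x, continuous (fun y => k * gauge y)}.
  have h : gauge @ x --> gauge x by exact: gauge_continuous.
  exact: (cvgM (cvg_cst k) h).
have fc x : cube r' x -> {for x, continuous f}.
  by move=> /r'r0; exact: smooth_continuous.
have pc' x : cube r' x -> {for x, continuous (fun y => \sum_(i in I) `|y 0 i * partial i f y|)}.
  move=> /r'r0 xr; apply: (@cvg_big _ _ _ _ _ _ _ (nbhs x)) => [|i _]; first exact: add_continuous.
  apply: cvg_norm.
  have h1 : (fun y : 'rV[R]_n => y 0 i) @ x --> x 0 i by exact: coord_continuous.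
  have h2 : partial i f @ x --> partial i f x.
    exact: (smooth_continuous (smooth_partial i sf)).
  exact: (cvgM h1 h2).
have cle x (k : R) : c <= k -> c * gauge x <= k * gauge x.
  by move=> ck; rewrite ler_wpM2r// gauge_ge0.
exists r', c, C; split.
- by split=> //; rewrite lt_min ?r0' ?c10// divr_gt0.
- move=> x xr; apply: (le_trans (cle _ _ _ : _ <= c2 * gauge x)).
    by rewrite ge_min lexx orbT.
  apply: (torus_dense (fun y _ => gc c2 y) fc _ xr) => y yr y0.
  by have [] := rP y (r'r y yr) y0.
- move=> x xr; apply: (torus_dense fc (fun y _ => gc C y) _ xr) => y yr y0.
  by have [] := rP y (r'r y yr) y0.
- move=> x xr; apply: (le_trans (cle _ _ _ : _ <= c1 * gauge x)).
    by rewrite ge_min lexx.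
  apply: (torus_dense (fun y _ => gc c1 y) pc' _ xr) => y yr y0.
  by have [] := rP y (r'r y yr) y0.
Unshelve. all: by end_near. Qed.

End LocalBounds.

(** * The exponents of a function comparable with a power of a distance *)

Section Norm.
Context {R : realType} {n : nat}.
Implicit Types (x y : 'rV[R]_n).

Lemma l2norm_ge0 x : 0 <= l2norm x.
Proof. exact: sqrtr_ge0. Qed.

Lemma le_l2norm x i : `|x 0 i| <= l2norm x.
Proof.
rewrite -sqrtr_sqr; apply: ler_wsqrtr; rewrite (bigD1 i)//= lerDl.
by apply: sumr_ge0 => j _; exact: sqr_ge0.
Qed.

Lemma l2norm_le_sum x : l2norm x <= \sum_i `|x 0 i|.
Proof.
have S0 : 0 <= \sum_i `|x 0 i| by exact: sumr_ge0.
rewrite -(ger0_norm S0) -sqrtr_sqr; apply: ler_wsqrtr.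
rewrite expr2 mulr_suml; apply: ler_sum => i _.
rewrite -[x 0 i ^+ 2]real_normK ?num_real// expr2.
apply: ler_wpM2l => //; rewrite (bigD1 i)//= lerDl.
exact: sumr_ge0.
Qed.

Lemma cube_l2norm x (e : R) : l2norm x < e -> cube e x.
Proof. by move=> xe i; apply: le_lt_trans (le_l2norm x i) xe. Qed.

End Norm.

(** Comparing orders as t tends to 0; all lower bounds for exponents reduce to
    this. *)
Lemma power_order {R : realType} (a b p q : R) : 0 < a ->
  (\forall t \near (0 : R)^'+, a * t `^ p <= b * t `^ q) -> q <= p.
Proof.
move=> a0 H; rewrite leNgt; apply/negP => pq.
have h : b * t `^ (q - p) @[t --> (0 : R)^'+] --> b * 0.
  by apply: cvgM; [exact: cvg_cst|apply: powR_cvg0; rewrite subr_gt0].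
have : a <= b * 0.
  apply: (ler_cvg_to (cvg_cst a) h); near=> t.
  have t0 : 0 < t by [].
  rewrite powRB ?(gt_eqF t0) ?implybT// mulrA ler_pdivlMr ?powR_gt0//.
  by near: t.
by rewrite mulr0 leNgt a0.
Unshelve. all: by end_near. Qed.

Section Coordinate.
Context {R : realType} {n : nat}.
Variable i0 : 'I_n.

Let affine (a b : R) (x : 'rV[R]_n) : R := a * x 0 i0 + b.

Let affine_derive a b i x :
  is_derive x (delta_mx 0 i) (affine a b) (a * (i == i0)%:R).
Proof.
have h : is_derive (upd x i (x 0 i)) (delta_mx 0 i) (affine a b) (a * (i == i0)%:R).
  apply/is_derive_upd; rewrite /affine; have [->|ii0] := eqVneq i i0.
    rewrite (_ : (fun u => _) = (a \*: id) + cst b); last first.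
      by apply/funext => u; rewrite updE eqxx.
    apply: (is_derive_eq (is_deriveD (is_deriveZ a (is_derive_id _ _)) (is_derive_cst _ _ _))).
    by rewrite addr0.
  rewrite mulr0 (_ : (fun u => _) = cst (a * x 0 i0 + b)); first exact: is_derive_cst.
  by apply/funext => u; rewrite updE eq_sym (negbTE ii0).
by rewrite upd_same in h.
Qed.

Lemma coordinate_smooth : smooth_near0 (fun x : 'rV[R]_n => x 0 i0).
Proof.
have E s : exists a b, iter_partial s (fun x : 'rV[R]_n => x 0 i0) = affine a b.
  elim: s => [|i s [a [b IH]]].
    by exists 1, 0; apply/funext => x; rewrite /affine/= mul1r addr0.
  exists 0, (a * (i == i0)%:R); apply/funext => x.
  rewrite /affine mul0r add0r /= -/(iter_partial s _) IH /partial.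
  exact: (derive_val (is_derive := affine_derive a b i x)).
exists setT; split=> //; first exact: openT.
move=> s x _; have [a [b ->]] := E s; split.
  have h : (fun y : 'rV[R]_n => y 0 i0) @ x --> x 0 i0 by exact: coord_continuous.
  exact: (cvgD (cvgM (cvg_cst a) h) (cvg_cst b)).
by move=> i; exact: (ex_derive (is_derive := affine_derive a b i x)).
Qed.

End Coordinate.

Section Exponents.
Context {R : realType} {n : nat}.
Variables (f : 'rV[R]_n -> R) (I : {set 'I_n}) (i0 : 'I_n) (k : nat) (r c C : R).
Implicit Types (x y : 'rV[R]_n) (i j : 'I_n).

Hypothesis i0I : i0 \in I.
Hypothesis k_gt0 : (0 < k)%N.
Hypothesis r_gt0 : 0 < r.
Hypothesis c_gt0 : 0 < c.
Hypothesis C_gt0 : 0 < C.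
Hypothesis f_smooth : smooth_on (cube r) f.
Hypothesis f_ge0 : forall x, cube r x -> 0 <= f x.
Hypothesis f_le1 : forall x, cube r x -> f x <= 1.
Hypothesis f_lower : forall x i, cube r x -> i \in I -> c * `|x 0 i| ^+ k <= f x.
Hypothesis f_zero : forall x, cube r x -> (forall i, i \in I -> x 0 i = 0) -> f x = 0.
Hypothesis f_axis : forall t : R, 0 < t < r -> f (upd 0 i0 t) <= C * t ^+ k.
Hypothesis f_grad : forall x, cube r x ->
  c * f x <= \sum_(i in I) `|x 0 i * partial i f x|.

Let k0 : 0 < k%:R :> R. Proof. by rewrite ltr0n. Qed.

(* The common bound for the coordinates of x in I. *)
Let rt x : R := (f x / c) `^ (k%:R^-1).

Let rt_ge0 x : 0 <= rt x. Proof. exact: powR_ge0. Qed.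

Let fc_ge0 x : cube r x -> 0 <= f x / c.
Proof. by move=> /f_ge0 fx; rewrite divr_ge0// ltW. Qed.

Let rtX x : cube r x -> rt x ^+ k = f x / c.
Proof.
move=> xr; rewrite -powR_mulrn// /rt -powRrM mulVf ?powRr1 ?fc_ge0//.
by rewrite gt_eqF.
Qed.

Let le_rt x i : cube r x -> i \in I -> `|x 0 i| <= rt x.
Proof.
move=> xr iI; rewrite -(@ler_pXn2r _ k) ?nnegrE// rtX// ler_pdivlMr// mulrC.
exact: f_lower.
Qed.

Let nI_gt0 : 0 < #|I|%:R :> R.
Proof. by rewrite ltr0n; apply/card_gt0P; exists i0. Qed.

Let pow_le0 (u : R) : `|u| ^+ k <= 0 -> u = 0.
Proof.
move=> h; have /eqP : `|u| ^+ k = 0 by apply/le_anti; rewrite h exprn_ge0.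
by rewrite expf_eq0 k_gt0 normr_eq0 => /eqP.
Qed.

Let axis_cube (t : R) : 0 < t < r -> cube r (upd 0 i0 t).
Proof.
move=> /andP[t0 tr] i; rewrite updE; case: (i =P i0) => _; first by rewrite gtr0_norm.
by rewrite mxE normr0.
Qed.

Let axis_norm (t : R) : 0 <= t -> l2norm (upd (0 : 'rV[R]_n) i0 t) <= t.
Proof.
move=> t0; apply: (le_trans (l2norm_le_sum _)).
rewrite (bigD1 i0)//= big1 ?addr0 => [|i /negbTE ii0]; first by rewrite updE eqxx ger0_norm.
by rewrite updE ii0 mxE normr0.
Qed.

Lemma gradient_inequality (th : R) : 0 < th -> 1 - k%:R^-1 <= th ->
  exists2 d : R, 0 < d & forall x, l2norm x < r -> d * `|f x| `^ th <= l2norm (grad f x).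
Proof.
move=> th0 kth.
pose K : R := #|I|%:R * (c `^ (k%:R^-1))^-1.
have K0 : 0 < K by rewrite mulr_gt0// invr_gt0 powR_gt0.
exists (c / K); first by rewrite divr_gt0.
move=> x /cube_l2norm xr; have fx := f_ge0 xr.
rewrite ger0_norm//; have [f0|f0] := eqVneq (f x) 0.
  by rewrite f0 powR0 ?mulr0 ?l2norm_ge0// gt_eqF.
have fpos : 0 < f x by rewrite lt_neqAle eq_sym f0.
rewrite mulrAC ler_pdivrMr//.
have h1 : c * f x <= l2norm (grad f x) * (#|I|%:R * rt x).
  apply: (le_trans (f_grad xr)).
  rewrite mulrCA mulr_natl -sumr_const; apply: ler_sum => i iI.
  rewrite normrM mulrC; apply: ler_pM => //; last exact: le_rt.
  by have := le_l2norm (grad f x) i; rewrite mxE.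
have h2 : f x `^ th <= f x / f x `^ k%:R^-1.
  apply: (@le_trans _ _ (f x `^ (1 - k%:R^-1))).
    by apply: ger_powR => //; rewrite fpos f_le1.
  by rewrite powRB ?powRr1// (negbTE f0) implybT.
apply: (@le_trans _ _ (c * (f x / f x `^ k%:R^-1))); first by rewrite ler_wpM2l// ltW.
rewrite mulrA ler_pdivrMr ?powR_gt0//; apply: (le_trans h1).
rewrite -mulrA ler_wpM2l ?l2norm_ge0// /K -mulrA.
rewrite /rt mulrC powRM ?invr_ge0 ?(ltW c_gt0)//.
rewrite -(powR_inv1 (ltW c_gt0)) -powRrM mulN1r powRN.
by rewrite le_eqVlt; apply/orP; left; apply/eqP; ring.
Qed.

(** The point with its coordinates in I replaced by 0 is a zero of f. *)
Lemma distance_inequality : exists2 d : R, 0 < d & forall x, l2norm x < r ->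
  d * l2dist x (f @^-1` [set 0]) `^ k%:R <= `|f x|.
Proof.
have q0 : 0 < #|I|%:R ^+ k :> R by rewrite exprn_gt0.
exists (c / #|I|%:R ^+ k); first by rewrite divr_gt0.
move=> x /cube_l2norm xr; rewrite ger0_norm ?f_ge0//.
pose y : 'rV[R]_n := \row_i (if i \in I then 0 else x 0 i).
have yr : cube r y.
  by move=> i; rewrite mxE; case: ifP => // _; rewrite normr0.
have fy : f y = 0 by apply: f_zero => // i iI; rewrite mxE iI.
have d_ge0 : 0 <= l2dist x (f @^-1` [set 0]).
  apply: lb_le_inf => [|_ [z _ <-]]; last exact: l2norm_ge0.
  by exists (l2norm (x - y)), y.
have d_le : l2dist x (f @^-1` [set 0]) <= #|I|%:R * rt x.
  apply: (@le_trans _ _ (l2norm (x - y))).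
    apply: ge_inf; last by exists y.
    by exists 0 => _ [z _ <-]; exact: l2norm_ge0.
  apply: (le_trans (l2norm_le_sum _)).
  rewrite (bigID (mem I))/= [X in _ + X]big1 ?addr0 => [|i /negbTE iI]; last first.
    by rewrite !mxE iI subrr normr0.
  rewrite mulr_natl -sumr_const; apply: ler_sum => i iI.
  by rewrite !mxE iI subr0 le_rt.
rewrite powR_mulrn// mulrAC ler_pdivrMr//.
rewrite (_ : f x = c * rt x ^+ k); last by rewrite rtX// mulrCA divff ?mulr1// gt_eqF.
rewrite -mulrA (ler_wpM2l (ltW c_gt0))// mulrC -exprMn.
by apply: lerXn2r; rewrite ?nnegrE ?mulr_ge0// mulrC.
Qed.

(** Moving the coordinates in I to 0 one at a time changes g by at most a multiple of
    their sizes, and g vanishes at the end point. *)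
Lemma vanishing_inequality g : smooth_near0 g ->
  (\forall x \near (0 : 'rV[R]_n), f x = 0 -> g x = 0) ->
  exists d e : R, [/\ 0 < d, 0 < e &
    forall x, l2norm x < e -> d * `|g x| `^ k%:R <= `|f x|].
Proof.
move=> [U [oU U0 sg]] /near_cube[r1 r10 fg].
have [r2 r20 r2U] : exists2 r2 : R, 0 < r2 & cube r2 `<=` U.
  by apply/near_cube; exact: open_nbhs_nbhs.
have sg2 : smooth_on (cube r2) g by move=> s x /r2U; exact: sg.
pose e := Num.min r (Num.min r1 (r2 / 2)).
have e0 : 0 < e by rewrite !lt_min r_gt0 r10 divr_gt0.
have er x : cube e x -> cube r x by apply: cube_le; rewrite ge_min lexx.
have er1 x : cube e x -> cube r1 x by apply: cube_le; rewrite !ge_min lexx orbT.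
have er2 : e < r2.
  apply: (@le_lt_trans _ _ (r2 / 2)); first by rewrite !ge_min lexx !orbT.
  by rewrite ltr_pdivrMr// ltr_pMr// ltr1n.
have hM i : exists M : R, 0 <= M /\ forall x, cube e x -> `|partial i g x| <= M.
  have [M M0 MP] := smooth_bounded (smooth_partial i sg2) e0 er2.
  by exists M.
have [M MP] := choice hM.
pose MM := \sum_i M i.
have M_le i : M i <= MM.
  by rewrite /MM (bigD1 i)//= lerDl; apply: sumr_ge0 => j _; have [] := MP j.
have MM0 : 0 <= MM by apply: sumr_ge0 => j _; have [] := MP j.
have path s x : cube e x -> `|g x - g (zero_on s x)| <= MM * \sum_(i <- s) `|x 0 i|.
  move=> xe; elim: s => [|i s IH].
    rewrite (_ : zero_on [::] x = x) ?subrr ?normr0 ?big_nil ?mulr0//.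
    by apply/rowP => j; rewrite mxE.
  rewrite big_cons mulrDr [leRHS]addrC.
  apply: (le_trans (ler_distD (g (zero_on s x)) _ _)); apply: lerD => //.
  pose y := zero_on s x; rewrite -/y.
  have ye : cube e y by exact: cube_zero_on.
  have yi : `|y 0 i| <= `|x 0 i| by rewrite mxE; case: ifP => // _; rewrite normr0.
  rewrite -upd_zero_on -/y -{1}(upd_same y i).
  have ue u : `|u| <= `|y 0 i| -> cube e (upd y i u).
    by move=> uy; apply: cube_upd => //; apply: le_lt_trans uy (ye i).
  apply: le_trans (ler_wpM2l MM0 yi).
  apply: (@mvt_bound _ (fun u => g (upd y i u)) (fun u => partial i g (upd y i u))) => u uy.
    by apply: smooth_is_derive sg2 _; apply: (cube_le (ltW er2)); exact: ue.
  by apply: le_trans (M_le i); have [_] := MP i; apply; exact: ue.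
pose L : R := MM * #|I|%:R + 1.
have L0 : 0 < L by rewrite ltr_wpDl// mulr_ge0.
exists (c / L ^+ k), e; split=> //; first by rewrite divr_gt0// exprn_gt0.
move=> x /cube_l2norm xe; have xr := er x xe.
have gx : `|g x| <= L * rt x.
  have zI i : i \in I -> zero_on (enum I) x 0 i = 0 by move=> iI; rewrite mxE mem_enum iI.
  have gz : g (zero_on (enum I) x) = 0.
    by apply: fg; [exact/er1/cube_zero_on|apply: f_zero => //; exact: cube_zero_on].
  have := path (enum I) x xe; rewrite gz subr0 => /le_trans; apply.
  rewrite big_enum/=; apply: (@le_trans _ _ (MM * (#|I|%:R * rt x))).
    rewrite ler_wpM2l// mulr_natl -sumr_const; apply: ler_sum => i iI.
    exact: le_rt.
  by rewrite mulrA ler_wpM2r// lerDl.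
rewrite (ger0_norm (f_ge0 xr)) powR_mulrn// mulrAC ler_pdivrMr ?exprn_gt0//.
rewrite (_ : f x = c * rt x ^+ k); last by rewrite rtX// mulrCA divff ?mulr1// gt_eqF.
rewrite -mulrA (ler_wpM2l (ltW c_gt0))// mulrC -exprMn.
by apply: lerXn2r; rewrite ?nnegrE ?mulr_ge0 ?(ltW L0)// mulrC.
Qed.

(** Test on the coordinate function of index i0. *)
Lemma vanishing_order (al : R) :
  (forall g, smooth_near0 g ->
      (\forall x \near (0 : 'rV[R]_n), f x = 0 -> g x = 0) ->
      exists d e : R, [/\ 0 < d, 0 < e &
        forall x, l2norm x < e -> d * `|g x| `^ al <= `|f x|]) ->
  k%:R <= al.
Proof.
move=> H.
have fg : \forall x \near (0 : 'rV[R]_n), f x = 0 -> x 0 i0 = 0.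
  apply/near_cube; exists r => // x xr fx0.
  by have := f_lower xr i0I; rewrite fx0 pmulr_rle0// => /pow_le0.
have [d [e [d0 e0 dP]]] := H _ (coordinate_smooth i0) fg.
apply: (@power_order R d C) => //; near=> t.
have t0 : 0 < t by [].
have tr : t < r by near: t; apply: nbhs_right_lt.
have te : t < e by near: t; apply: nbhs_right_lt.
have trr : 0 < t < r by rewrite t0.
have := dP (upd 0 i0 t) (le_lt_trans (axis_norm (ltW t0)) te).
rewrite updE eqxx gtr0_norm// (ger0_norm (f_ge0 (axis_cube trr))).
move=> /le_trans; apply; rewrite powR_mulrn ?(ltW t0)//; exact: f_axis.
Unshelve. all: by end_near. Qed.

(** On the axis of i0 the distance to the zero set is at least t: zeros in the cube
    have vanishing i0-th coordinate, and the others are far away. *)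
Lemma distance_order (L e d : R) : 0 < L -> 0 < d -> 0 < e ->
  (forall x, l2norm x < e -> d * l2dist x (f @^-1` [set 0]) `^ L <= `|f x|) ->
  k%:R <= L.
Proof.
move=> L0 d0 e0 dP; apply: (@power_order R d C) => //; near=> t.
have t0 : 0 < t by [].
have tr : t < r / 2 by near: t; apply: nbhs_right_lt; rewrite divr_gt0.
have te : t < e by near: t; apply: nbhs_right_lt.
have trr : 0 < t < r.
  by rewrite t0/=; apply: (lt_trans tr); rewrite ltr_pdivrMr// ltr_pMr// ltr1n.
have := dP (upd 0 i0 t) (le_lt_trans (axis_norm (ltW t0)) te).
rewrite (ger0_norm (f_ge0 (axis_cube trr))) => h.
rewrite powR_mulrn ?(ltW t0)//; apply: le_trans (f_axis trr); apply: le_trans h.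
rewrite (ler_wpM2l (ltW d0))//; apply: ge0_ler_powR; rewrite ?nnegrE ?(ltW L0) ?(ltW t0)//.
  apply: lb_le_inf => [|_ [z _ <-]]; last exact: l2norm_ge0.
  exists (l2norm (upd 0 i0 t - 0)), 0 => //=; apply: f_zero => [i|i _].
    by rewrite mxE normr0.
  by rewrite mxE.
apply: lb_le_inf.
  exists (l2norm (upd 0 i0 t - 0)), 0 => //=; apply: f_zero => [i|i _].
    by rewrite mxE normr0.
  by rewrite mxE.
move=> _ [z /= fz <-].
have [zr|/existsNP[i zi]] := pselect (cube r z).
  have z0 : z 0 i0 = 0.
    by have := f_lower zr i0I; rewrite fz pmulr_rle0// => /pow_le0.
  apply: le_trans (le_l2norm _ i0).
  by rewrite !mxE eqxx z0 subr0 gtr0_norm.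
move/negP: zi; rewrite -leNgt => zi; apply: le_trans (le_l2norm _ i).
have ti : `|upd (0 : 'rV[R]_n) i0 t 0 i| <= t.
  by rewrite updE; case: (i =P i0) => _; [rewrite gtr0_norm|rewrite mxE normr0 ltW].
rewrite [(_ - z) _ _]mxE [(- z) _ _]mxE.
have := ler_distD (upd 0 i0 t 0 i) 0 (z 0 i); rewrite !sub0r !normrN.
move: (upd 0 i0 t 0 i) ti => u ti h.
have : r <= t + `|u - z 0 i| by apply: (le_trans zi); apply: (le_trans h); rewrite lerD2r.
lra.
Unshelve. all: by end_near. Qed.

(** A Lojasiewicz gradient inequality cannot have a small exponent. Since f may
    have large derivatives across the axis, the axis points themselves do not
    show this; minimizing f plus a quadratic penalty centred at the axis point
    produces a nearby point where the gradient is the small gradient of the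
    penalty. *)
Lemma almost_critical_point (t : R) : 0 < t -> 2 * t < r -> exists y,
  (forall j, `|y 0 j - upd (0 : 'rV[R]_n) i0 t 0 j| <= t / 4) /\
  (forall j, `|partial j f y| <= 8 * C * (t ^+ k / t)).
Proof.
move=> t0 tr; set x0 := upd (0 : 'rV[R]_n) i0 t.
have t_lt_r : 0 < t < r by rewrite t0/=; lra.
(* The penalty is heavy enough to keep the minimizer within t / 4 of the axis
   point, hence inside the domain of minimization. *)
pose w : R := 16 * C * (t ^+ k / t ^+ 2).
have w0 : 0 < w by rewrite !mulr_gt0// ?invr_gt0 exprn_gt0.
pose F x := f x + w * \sum_i (x 0 i - x0 0 i) ^+ 2.
pose K := [set x : 'rV[R]_n | forall i, x 0 i \in `[x0 0 i - t / 2, x0 0 i + t / 2]].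
have KE x i : K x -> `|x 0 i - x0 0 i| <= t / 2.
  by move=> /(_ i); rewrite in_itv/= ler_distl.
have x0t i : `|x0 0 i| <= t.
  by rewrite updE; case: (i =P i0) => _; [rewrite gtr0_norm|rewrite mxE normr0 ltW].
have Kr x : K x -> cube r x.
  move=> Kx i; apply: le_lt_trans tr.
  have := ler_normD (x 0 i - x0 0 i) (x0 0 i); rewrite subrK => /le_trans; apply.
  have := KE x i Kx; have := x0t i; lra.
have cK : compact K.
  apply: (@rV_compact _ _ (fun i => `[x0 0 i - t / 2, x0 0 i + t / 2]%classic)).
  by move=> i; exact: segment_compact.
have Fc : {within K, continuous F}.
  apply: continuous_in_subspaceT => x; rewrite inE => /Kr xr.
  have h1 : f @ x --> f x by exact: smooth_continuous f_smooth xr.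
  have h2 : (fun y : 'rV[R]_n => \sum_i (y 0 i - x0 0 i) ^+ 2) @ x -->
      \sum_i (x 0 i - x0 0 i) ^+ 2.
    apply: (@cvg_sumr _ _ _ (nbhs x)) => i _.
    have h3 : (fun y : 'rV[R]_n => y 0 i) @ x --> x 0 i by exact: coord_continuous.
    have h4 : (fun y : 'rV[R]_n => y 0 i - x0 0 i) @ x --> x 0 i - x0 0 i.
      exact: (cvgB h3 (cvg_cst (x0 0 i))).
    rewrite expr2; under eq_fun do rewrite expr2.
    exact: (cvgM h4 h4).
  exact: (cvgD h1 (cvgM (cvg_cst w) h2)).
have Kx0 : K x0 by move=> i; rewrite in_itv/=; lra.
have [y yK ymin] := EVT_min_rV (ex_intro _ x0 Kx0) cK Fc.
rewrite inE in yK.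
have yx0 j : `|y 0 j - x0 0 j| <= t / 4.
  have h1 : F y <= C * t ^+ k.
    apply: le_trans (f_axis t_lt_r).
    apply: le_trans (ymin x0 _) _; first by rewrite inE.
    rewrite /F big1 ?mulr0 ?addr0// => i _.
    by rewrite subrr expr0n.
  have h2 : w * \sum_i (y 0 i - x0 0 i) ^+ 2 <= C * t ^+ k.
    by apply: le_trans h1; rewrite /F lerDr f_ge0//; exact: Kr.
  have h3 : (y 0 j - x0 0 j) ^+ 2 <= (t / 4) ^+ 2.
    apply: (@le_trans _ _ (\sum_i (y 0 i - x0 0 i) ^+ 2)).
      by rewrite (bigD1 j)//= lerDl; apply: sumr_ge0 => i _; exact: sqr_ge0.
    rewrite -(ler_pM2l w0); apply: (le_trans h2).
    rewrite le_eqVlt; apply/orP; left; apply/eqP.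
    by rewrite /w; field; rewrite gt_eqF.
  rewrite -(@ler_pXn2r _ 2)// ?nnegrE ?divr_ge0 ?(ltW t0)//.
  by rewrite real_normK ?num_real.
exists y; split=> // j.
pose phi s := F (upd y j s).
pose q := \sum_(i | i != j) (y 0 i - x0 0 i) ^+ 2.
have phiE s : phi s = f (upd y j s) + w * ((s - x0 0 j) ^+ 2 + q).
  rewrite /phi /F; congr (_ + _ * _); rewrite (bigD1 j)//= updE eqxx; congr (_ + _).
  by apply: eq_bigr => i /negbTE ij; rewrite updE ij.
have phiK s : s \in `]y 0 j - t / 8, y 0 j + t / 8[ -> K (upd y j s).
  rewrite in_itv/= => /andP[s1 s2] i; rewrite updE; case: (i =P j) => [->|_]; last exact: yK.
  have := yx0 j; rewrite ler_norml in_itv/= => /andP[y1 y2].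
  apply/andP; split; lra.
have phid s : s \in `]y 0 j - t / 8, y 0 j + t / 8[ ->
    is_derive s 1 phi (partial j f (upd y j s) + w * (2 * (s - x0 0 j))).
  move=> /phiK/Kr sr.
  have d1 := smooth_is_derive f_smooth sr.
  have d2 : is_derive s 1 (fun u : R => w * ((u - x0 0 j) ^+ 2 + q)) (w * (2 * (s - x0 0 j))).
    rewrite (_ : (fun u => _) = w \*: (((id : R -> R) - cst (x0 0 j)) ^+ 2 + cst q)); last first.
      by apply/funext => u; rewrite /= !fctE.
    apply: is_derive_eq; rewrite /GRing.scale/= !fctE; ring.
  rewrite (_ : phi = (fun u => f (upd y j u)) + (fun u => w * ((u - x0 0 j) ^+ 2 + q))).
    exact: is_deriveD.
  by apply/funext => u; rewrite phiE.
have yin : y 0 j \in `]y 0 j - t / 8, y 0 j + t / 8[ by rewrite in_itv/=; apply/andP; split; lra.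
have ab : y 0 j - t / 8 <= y 0 j + t / 8 by lra.
have phi0 : is_derive (y 0 j) 1 phi 0.
  apply: (derive1_at_min ab) => // [s /phid ds|s /phiK sK]; first exact: (ex_derive (is_derive := ds)).
  by rewrite /phi upd_same; apply: ymin; rewrite inE.
have := derive_val (is_derive := phi0).
rewrite (derive_val (is_derive := phid _ yin)) upd_same => /eqP.
rewrite addr_eq0 => /eqP ->; rewrite normrN normrM (gtr0_norm w0) normrM ger0_norm//.
apply: (@le_trans _ _ (w * (2 * (t / 4)))).
  by rewrite (ler_wpM2l (ltW w0))// ler_wpM2l.
rewrite le_eqVlt; apply/orP; left; apply/eqP; rewrite /w; field.
by rewrite gt_eqF.
Qed.

Lemma gradient_order (th d e : R) : 0 < th -> 0 < d -> 0 < e ->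
  (forall x, l2norm x < e -> d * `|f x| `^ th <= l2norm (grad f x)) ->
  1 - k%:R^-1 <= th.
Proof.
move=> th0 d0 e0 dP.
suff : k%:R - 1 <= k%:R * th.
  by move=> h; rewrite -(ler_pM2l k0) mulrBr mulr1 divff// gt_eqF.
pose a := d * (c * (1 / 2) ^+ k) `^ th.
have a0 : 0 < a by rewrite mulr_gt0// powR_gt0// mulr_gt0// exprn_gt0.
apply: (@power_order R a (n%:R * (8 * C))) => //; near=> t.
have t0 : 0 < t by [].
have tr : 2 * t < r.
  by rewrite mulrC -ltr_pdivlMr//; near: t; apply: nbhs_right_lt; rewrite divr_gt0.
have te : (n%:R * 2 + 1) * t < e.
  rewrite mulrC -ltr_pdivlMr ?ltr_wpDl ?mulr_ge0//.
  by near: t; apply: nbhs_right_lt; rewrite divr_gt0// ltr_wpDl// mulr_ge0.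
have [y [yx0 ygrad]] := almost_critical_point t0 tr.
have yt i : `|y 0 i| <= 2 * t.
  have := ler_normD (y 0 i - upd (0 : 'rV[R]_n) i0 t 0 i) (upd (0 : 'rV[R]_n) i0 t 0 i).
  rewrite subrK => /le_trans; apply.
  have h : `|upd (0 : 'rV[R]_n) i0 t 0 i| <= t.
    by rewrite updE; case: (i =P i0) => _; [rewrite gtr0_norm|rewrite mxE normr0 ltW].
  have := yx0 i; lra.
have yr : cube r y by move=> i; exact: le_lt_trans (yt i) tr.
have ye : l2norm y < e.
  apply: le_lt_trans te; apply: (le_trans (l2norm_le_sum _)).
  apply: (@le_trans _ _ (n%:R * (2 * t))).
    by rewrite -[n in n%:R]card_ord mulr_natl -sumr_const; apply: ler_sum => i _.
  by rewrite mulrA ler_wpM2r ?(ltW t0)// lerDl.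
have yi0 : t / 2 <= `|y 0 i0|.
  have := yx0 i0; rewrite updE eqxx ler_norml => /andP[h _].
  by apply: le_trans (ler_norm _); lra.
have fy : c * (t / 2) ^+ k <= f y.
  apply: le_trans (f_lower yr i0I); rewrite (ler_wpM2l (ltW c_gt0))//.
  by apply: lerXn2r; rewrite ?nnegrE// divr_ge0// ltW.
have h1 : a * t `^ (k%:R * th) <= d * `|f y| `^ th.
  rewrite /a -mulrA (ler_wpM2l (ltW d0))// powRrM powR_mulrn ?(ltW t0)//.
  rewrite -powRM; [|by rewrite mulr_ge0 ?exprn_ge0// ltW|by rewrite exprn_ge0// ltW].
  rewrite -mulrA -exprMn ger0_norm ?f_ge0//.
  apply: ge0_ler_powR; rewrite ?nnegrE ?(ltW th0) ?f_ge0//.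
    by rewrite mulr_ge0 ?exprn_ge0 ?mulr_ge0// ltW.
  by rewrite (_ : 1 / 2 * t = t / 2)//; ring.
apply: (le_trans h1); apply: (le_trans (dP y ye)); apply: (le_trans (l2norm_le_sum _)).
rewrite powRB ?(gt_eqF t0) ?implybT// powRr1 ?(ltW t0)// powR_mulrn ?(ltW t0)//.
rewrite -mulrA -[n in n%:R]card_ord mulr_natl -sumr_const; apply: ler_sum => i _.
by rewrite mxE.
Unshelve. all: by end_near. Qed.

Theorem theta_value : theta_exp f = (1 - 1 / k%:R)%:E.
Proof.
have k1 : 1 <= k%:R :> R by rewrite ler1n.
have ki : k%:R^-1 <= 1 :> R by rewrite invf_le1.
have ki0 : 0 < k%:R^-1 :> R by rewrite invr_gt0.
rewrite div1r; apply/eqP; rewrite eq_le; apply/andP; split; last first.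
  apply/ereal_infP => _ [th /= [/andP[th0 _] [d [e [d0 e0 dP]]]] <-].
  by rewrite lee_fin; exact: gradient_order dP.
apply/lee_addgt0Pr => eps eps0.
pose th := 1 - k%:R^-1 + Num.min eps (k%:R^-1 / 2).
have m0 : 0 < Num.min eps (k%:R^-1 / 2) by rewrite lt_min eps0 divr_gt0.
have me : Num.min eps (k%:R^-1 / 2) <= eps by rewrite ge_min lexx.
have mk : Num.min eps (k%:R^-1 / 2) <= k%:R^-1 / 2 by rewrite ge_min lexx orbT.
apply: ge_ereal_inf; exists th%:E; last by rewrite -EFinD lee_fin /th lerD2l.
have th0 : 0 < th by rewrite /th; move: (Num.min _ _) m0 mk => m; lra.
exists th => //; split.
  rewrite th0/= /th; move: (Num.min _ _) m0 mk => m; lra.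
have kth : 1 - k%:R^-1 <= th by rewrite /th lerDl ltW.
have [d d0 dP] := gradient_inequality th0 kth.
by exists d, r.
Qed.

Theorem alpha_value : alpha_exp f = k%:R%:E.
Proof.
apply/eqP; rewrite eq_le; apply/andP; split; last first.
  by apply/ereal_infP => _ [al /= [al0 H] <-]; rewrite lee_fin; exact: vanishing_order.
apply: ge_ereal_inf; exists k%:R%:E => //; exists k%:R => //; split=> //.
exact: vanishing_inequality.
Qed.

Theorem distance_value : lojasiewicz_exp f = k%:R%:E.
Proof.
apply/eqP; rewrite eq_le; apply/andP; split; last first.
  apply/ereal_infP => _ [L /= [L0 [d [e [d0 e0 dP]]]] <-]; rewrite lee_fin.
  exact: distance_order dP.
apply: ge_ereal_inf; exists k%:R%:E => //; exists k%:R => //; split=> //.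
have [d d0 dP] := distance_inequality.
by exists d, r.
Qed.

End Exponents.

(** * The theorem *)

(** A valid pair that singles out the vertex on the axis of i has a positive i-th
    weight, because otherwise moving along that axis would not leave the face. *)
Lemma axis_vertex_min {R : realType} {n : nat} (f : 'rV[R]_n -> R) i (p q : nat) :
  vertices f (p%:R *: delta_mx 0 i) -> newton_polyhedron f (q%:R *: delta_mx 0 i) ->
  (p <= q)%N.
Proof.
move=> vp Gq; have Gp := vertices_sub vp; case: vp => a [l [va e _]].
have al : a 0 i * p%:R = l.
  have : [set (p%:R *: delta_mx 0 i : 'rV[R]_n)] (p%:R *: delta_mx 0 i) by [].
  by rewrite e => -[_]; rewrite dotv_axis.
have a0 : 0 < a 0 i.
  rewrite lt_neqAle (valid_pair_ge0 (ex_intro _ _ Gp) va) andbT.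
  apply/eqP => ai0; have Gp1 := newton_polyhedronD Gp (orthant_axis i (@ler01 R)).
  have : [set (p%:R *: delta_mx 0 i : 'rV[R]_n)] (p%:R *: delta_mx 0 i + 1 *: delta_mx 0 i).
    by rewrite e; split=> //; rewrite -scalerDl dotv_axis -al -ai0 !mul0r.
  rewrite /= -scalerDl => /matrixP/(_ 0 i); rewrite !mxE !eqxx !mulr1 => /eqP.
  by rewrite -subr_eq0 addrAC subrr add0r oner_eq0.
by have := va _ Gq; rewrite dotv_axis -al ler_pM2l// ler_nat.
Qed.

Unset Implicit Arguments.

Theorem theorem4p5p1 (R : realType) (n : nat) (f : 'rV[R]_n -> R)
  (f_smooth : smooth_near0 f)
  (f0 : f 0 = 0)
  (gradf0 : grad f 0 = 0)
  (newton_neq0 : newton_polyhedron f !=set0)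
  (f_ge0 : \forall x \near (0 : 'rV[R]_n), 0 <= f x)
  (f_nondeg : newton_nondegenerate f)
  (f_pconv : partially_convenient f)
  (f_KN : KN_condition f) :
  [/\ theta_exp f = (1 - 1 / (nuN f)%:R)%:E,
      alpha_exp f = (nuN f)%:R%:E &
      lojasiewicz_exp f = (nuN f)%:R%:E].
Proof.
have [U [oU U0 sU]] := f_smooth.
have [r0 r0_gt0 r0U] : exists2 r0 : R, 0 < r0 & cube r0 `<=` U.
  by apply/near_cube; exact: open_nbhs_nbhs.
have sf : smooth_on (cube r0) f by move=> s x /r0U; exact: sU.
have [I [nu pc]] := f_pconv.
have S_neq0 : supp f !=set0.
  apply: contrapT => S0; have [x Gx] := newton_neq0.
  apply: (@newton_sub _ _ f set0 _ _ x Gx) => // al y Sal _.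
  by case: S0; exists al.
pose M := (\max_(i in I) nu i)%N.
have nuM : nuN f = M by exact: nuNE.
have [N0 dick] := dickson_box (supp f).
(* The box must contain the minimal exponents, and the expansion order must exceed
   every nu_i by at least one. *)
pose N' := (N0 + M).+1.
have box al : supp f al -> exists2 b : {ffun 'I_n -> 'I_N'.+1},
    supp f (mi_of b) & forall i, (b i <= al i)%N.
  move=> /dick[be Sbe beP].
  have E i : (inord (be i) : 'I_N'.+1) = be i :> nat.
    rewrite inordK//; have [_ /leq_trans] := beP i; apply.
    exact: (leq_trans (leq_addr M N0) (leqW (leqnSn _))).
  exists [ffun i => inord (be i)]; last by move=> i; rewrite ffunE E; have [] := beP i.
  by rewrite (_ : mi_of _ = be)//; apply/ffunP => i; rewrite !ffunE E.
have nu_M i : i \in I -> (nu i <= M)%N by move=> iI; exact: leq_bigmax_cond.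
have nu_lt i : i \in I -> (nu i < N')%N.
  by move=> /nu_M h; rewrite /N' ltnS (leq_trans h)// leq_addl.
have [r [c [C [[r_gt0 rr0 c_gt0 C_gt0] low upp grd]]]] :=
  local_bounds r0_gt0 sf box S_neq0 pc nu_lt f_KN f_nondeg f_ge0.
have support_mem b : b \in plane_exps f N'.+1 I -> exists2 i, i \in I & (b : {ffun 'I_n -> 'I_N'.+1}) i != 0 :> nat.
  move=> /(plane_expsP _ _ _)[Sb bI].
  apply: contrapT => h; have b0 i : b i = 0%N :> nat.
    have [iI|/bI//] := boolP (i \in I).
    by apply/eqP/negPn/negP => bi; apply: h; exists i.
  move: Sb; rewrite /supp/= /taylor_coef (_ : flatten _ = [::]).
    by rewrite /iter_partial/= f0 mul0r eqxx.
  by elim: (enum 'I_n) => //= i s ->; rewrite ffunE b0.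
have [i0 i0I nui0] : exists2 i, i \in I & nu i = M.
  have z0 i : 0 <= (0 : 'rV[R]_n) 0 i by rewrite mxE.
  have [b /support_mem[i iI _] _] := plane_exps_min box S_neq0 pc z0.
  have I0 : (0 < #|I|)%N by apply/card_gt0P; exists i.
  by have [i0 i0I Mi0] := eq_bigmax_cond nu I0; exists i0.
have M_gt0 : (0 < M)%N by rewrite -nui0; have [] := pc.1 i0 i0I.
have r0' : cube r (0 : 'rV[R]_n) by move=> i; rewrite mxE normr0.
have [d d_gt0 dP] : exists2 d : R, 0 < d & forall p : 'rV[R]_n,
    (forall k, `|p 0 k - (0 : 'rV[R]_n) 0 k| <= d) -> `|f p - f 0| < 1.
  apply: continuous_cube => //; apply: (smooth_continuous sf).
  exact: (cube_le (ltW rr0) r0').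
pose rho := Num.min r (Num.min 1 d).
have rho_gt0 : 0 < rho by rewrite !lt_min r_gt0 ltr01.
have rho_r (x : 'rV[R]_n) : cube rho x -> cube r x by apply: cube_le; rewrite ge_min lexx.
have rho_1 (x : 'rV[R]_n) : cube rho x -> cube 1 x by apply: cube_le; rewrite !ge_min lexx orbT.
have rho_d (x : 'rV[R]_n) : cube rho x -> cube d x by apply: cube_le; rewrite !ge_min lexx !orbT.
pose gauge := newton_gauge (N' := N') f I.
have gauge0 (x : 'rV[R]_n) : 0 <= gauge x by exact: gauge_ge0.
pose c1 := Num.min c (c / C).
have c1_gt0 : 0 < c1 by rewrite lt_min c_gt0 divr_gt0.
have f_nonneg (x : 'rV[R]_n) : cube rho x -> 0 <= f x.
  by move=> /rho_r xr; apply: le_trans (low x xr); rewrite mulr_ge0// ltW.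
have f_le1 (x : 'rV[R]_n) : cube rho x -> f x <= 1.
  move=> /rho_d xd; have := dP x; rewrite f0 subr0 => h.
  apply: (le_trans (ler_norm _)); apply/ltW/h => k.
  by rewrite [X in _ - X]mxE subr0 ltW.
have f_lower (x : 'rV[R]_n) i : cube rho x -> i \in I -> c1 * `|x 0 i| ^+ M <= f x.
  move=> xr iI; apply: le_trans (low x (rho_r x xr)).
  apply: ler_pM; rewrite ?(ltW c1_gt0) ?exprn_ge0//; first by rewrite ge_min lexx.
  apply: le_trans (axis_gauge box S_neq0 pc x iI).
  by rewrite ler_wiXn2l// ?nu_M// ltW// rho_1.
have f_zero (x : 'rV[R]_n) : cube rho x -> (forall i, i \in I -> x 0 i = 0) -> f x = 0.
  move=> xr xI; apply/le_anti; rewrite f_nonneg// andbT.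
  apply: le_trans (upp x (rho_r x xr)) _; rewrite [newton_gauge _ _ _]big1 ?mulr0//.
  move=> b /support_mem[i iI bi]; apply/eqP; rewrite normr_eq0.
  by apply/prodf_eq0; exists i => //; rewrite xI// ffunE expf_eq0 lt0n bi eqxx.
have f_axis (t : R) : 0 < t < rho -> f (upd 0 i0 t) <= C * #|plane_exps f N'.+1 I|.+1%:R * t ^+ M.
  move=> /andP[t0 tr].
  have xr : cube rho (upd 0 i0 t).
    move=> i; rewrite updE; case: (i =P i0) => _; first by rewrite gtr0_norm.
    by rewrite mxE normr0.
  have t1 : t <= 1.
    by apply/ltW/(lt_le_trans tr); rewrite !ge_min lexx orbT.
  apply: le_trans (upp _ (rho_r _ xr)) _; rewrite -mulrA (ler_wpM2l (ltW C_gt0))//.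
  apply: (@le_trans _ _ (#|plane_exps f N'.+1 I|%:R * t ^+ M)); last first.
    by rewrite ler_wpM2r ?exprn_ge0 ?(ltW t0)// ler_nat.
  rewrite mulr_natl -sumr_const; apply: ler_sum => b bA.
  rewrite normr_monomial.
  have [/forallP bax|/forallPn[i]] := boolP [forall i, (i != i0) ==> (b i == 0 :> nat)].
    have bE i : i != i0 -> b i = 0%N :> nat by move=> ii0; have := bax i; rewrite ii0 => /eqP.
    rewrite (bigD1 i0)//= big1 ?mulr1 => [|i ii0]; last by rewrite ffunE bE.
    rewrite updE eqxx ffunE gtr0_norm//; apply: ler_wiXn2l => //; first exact: ltW.
    rewrite -nui0; apply: (@axis_vertex_min R n f i0); first by have [] := pc.1 i0 i0I.
    have /(plane_expsP _ _ _)[/newton_supp Gb _] := bA.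
    rewrite (_ : _ *: _ = mi_vec (mi_of b))//; apply/rowP => i.
    rewrite !mxE ffunE eqxx/=; have [->|ii0] := eqVneq i i0; first by rewrite mulr1.
    by rewrite (bE i ii0)/= mulr0.
  rewrite negb_imply => /andP[ii0 bi]; rewrite (bigD1 i)//= updE (negbTE ii0) mxE normr0.
  by rewrite ffunE expr0n (negbTE bi) mul0r exprn_ge0// ltW.
have f_grad (x : 'rV[R]_n) : cube rho x -> c1 * f x <= \sum_(i in I) `|x 0 i * partial i f x|.
  move=> xr; apply: le_trans (grd x (rho_r x xr)).
  apply: (@le_trans _ _ (c / C * (C * gauge x))); last by rewrite mulrA divfK// gt_eqF.
  apply: ler_pM; rewrite ?(ltW c1_gt0) ?f_nonneg//; first by rewrite ge_min lexx orbT.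
  exact: (upp x (rho_r x xr)).
have srho : smooth_on (cube rho) f.
  by move=> s y yr; apply: sf; exact: (cube_le (ltW rr0) (rho_r _ yr)).
have C1_gt0 : 0 < C * #|plane_exps f N'.+1 I|.+1%:R by rewrite mulr_gt0// ltr0n.
rewrite nuM; split.
- exact: (theta_value i0I M_gt0 rho_gt0 c1_gt0 C1_gt0 srho f_nonneg f_le1 f_lower f_axis f_grad).
- exact: (alpha_value i0I M_gt0 rho_gt0 c1_gt0 f_nonneg f_lower f_zero f_axis).
- exact: (distance_value i0I M_gt0 rho_gt0 c1_gt0 f_nonneg f_lower f_zero f_axis).
Qed.
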